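(* Let $k,\ell\ge 1$ be integers, let $\beta>0$ be a real number, and let $1\le p\le k$, $1\le q\le\ell$. Then the limits $c^{(\beta;k,\ell)}_{p,E}=\lim_{n\to\infty}c^{(\beta;k,\ell)}_{p,E}(n)$ and $c'^{(\beta;k,\ell)}_{q,E}=\lim_{n\to\infty}c'^{(\beta;k,\ell)}_{q,E}(n)$ exist, and are given by $$c^{(\beta;k,\ell)}_{p,E}=\frac{\int_{\Omega_{k}} x_p\cdot\left[D_k(x_1,\ldots,x_k)\cdot e^{-\frac{k+\ell}{2}(x_1^2+\cdots+x_k^2)}\right]^\beta d^{(k-1)}(x)}{\int_{\Omega_{k}}\left[D_k(x_1,\ldots,x_k)\cdot e^{-\frac{k+\ell}{2}(x_1^2+\cdots+x_k^2)}\right]^\beta d^{(k-1)}(x)}$$ and $$c'^{(\beta;k,\ell)}_{q,E}=\frac{\int_{\Omega_{\ell}} y_q\cdot\left[D_\ell(y_1,\ldots,y_\ell)\cdot e^{-\frac{k+\ell}{2}(y_1^2+\cdots+y_\ell^2)}\right]^\beta d^{(\ell-1)}(y)}{\int_{\Omega_{\ell}}\left[D_\ell(y_1,\ldots,y_\ell)\cdot e^{-\frac{k+\ell}{2}(y_1^2+\cdots+y_\ell^2)}\right]^\beta d^{(\ell-1)}(y)}.$$ Thus, as $n$ goes to infinity, $$\lambda^{(\beta;k,\ell)}_{p,E}(n)\sim\frac{n}{k+\ell}+c^{(\beta;k,\ell)}_{p,E}\cdot\sqrt n\qquad\text{and}\qquad \lambda'^{(\beta;k,\ell)}_{q,E}(n)\sim\frac{n}{k+\ell}+c'^{(\beta;k,\ell)}_{q,E}\cdot\sqrt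 n.$$
   Context: For a partition $\lambda=(\lambda_1,\lambda_2,\ldots)$ of $n$ (written $\lambda\vdash n$, with $\lambda_i=0$ for $i$ larger than the number of parts), $\lambda'=(\lambda'_1,\lambda'_2,\ldots)$ denotes the conjugate partition, and $f^\lambda$ denotes the number of standard Young tableaux of shape $\lambda$. For integers $k,\ell\ge0$, $H(k,\ell;n)=\{\lambda\vdash n\mid\lambda_{k+1}\le\ell\}$. For $\beta>0$, $1\le p\le k$ and $1\le q\le\ell$ put $$\lambda^{(\beta;k,\ell)}_{p,E}(n)=\frac{\sum_{\lambda\in H(k,\ell;n)}\lambda_{p}\,(f^\lambda)^{\beta}}{\sum_{\lambda\in H(k,\ell;n)}(f^\lambda)^{\beta}},\qquad \lambda'^{(\beta;k,\ell)}_{q,E}(n)=\frac{\sum_{\lambda\in H(k,\ell;n)}\lambda'_{q}\,(f^\lambda)^{\beta}}{\sum_{\lambda\in H(k,\ell;n)}(f^\lambda)^{\beta}},$$ and define $c^{(\beta;k,\ell)}_{p,E}(n)$, $c'^{(\beta;k,\ell)}_{q,E}(n)$ by $$\lambda^{(\beta;k,\ell)}_{p,E}(n)=\frac{n}{k+\ell}+c^{(\beta;k,\ell)}_{p,E}(n)\cdot\sqrt n,\qquad \lambda'^{(\beta;k,\ell)}_{q,E}(n)=\frac{n}{k+\ell}+c'^{(\beta;k,\ell)}_{q,E}(n)\cdot\sqrt n.$$ For $r\ge1$, $\Omega_r=\{(x_1,\ldots,x_r)\in\mathbb{R}^r\mid x_1\ge\cdots\ge x_r\text{ and }x_1+\cdots+x_r=0\}$,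 $D_r(x_1,\ldots,x_r)=\prod_{1\le i<j\le r}(x_i-x_j)$ (so $D_1=1$), and $d^{(r-1)}(x)$ denotes $(r-1)$-dimensional Lebesgue measure on the hyperplane $x_1+\cdots+x_r=0$ (the ratios do not depend on its normalization). When $r=1$, $\Omega_1=\{0\}$ and the measure is the unit mass at the point $0$. For real sequences with $b_n\neq0$ for large $n$, $a_n\sim b_n$ means $\lim_{n\to\infty}a_n/b_n=1$. *)

(* Defs.v *)
From HB Require Import structures.
From mathcomp Require Import all_boot all_order all_algebra.
From mathcomp Require Import all_classical all_reals all_analysis.
From mathcomp Require Import measurable_realfun.

Set Implicit Arguments.
Unset Strict Implicit.
Unset Printing Implicit Defensive.

Import Order.TTheory GRing.Theory Num.Theory.
Import numFieldNormedType.Exports.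

Local Open Scope classical_set_scope.
Local Open Scope ring_scope.

(* A partition of n, padded with zeros to length n (n parts always suffice). *)
Definition intpart (n : nat) : finType :=
  {la : n.-tuple 'I_n.+1 |
    sorted geq (map val la) && (sumn (map val la) == n)%N}.

Section Partitions.
Local Open Scope nat_scope.
Variable n : nat.
Implicit Type la : intpart n.

(* Indices are 0-based throughout: [part la i] is lambda_(i+1) and
   [conj_part la j] is lambda'_(j+1), the length of column j+1. *)
Definition part la (i : nat) : nat := nth 0 (map val (val la)) i.

Definition conj_part la (j : nat) : nat :=
  count (fun m => j < m) (map val (val la)).

Definition hook (k l : nat) : {set intpart n} :=
  [set la : intpart n | part la k <= l].

(* The cells of the Young diagram, as (row, column); it fits in an n x n box. *)
Definition diagram la : {set 'I_n * 'I_n} :=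
  [set c : 'I_n * 'I_n | c.2 < part la c.1].

(* A filling has the value 0 exactly outside the diagram. As the diagram has n
   cells, injectivity makes the entries 1, ..., n each occur once. *)
Definition is_SYT la (t : {ffun 'I_n * 'I_n -> 'I_n.+1}) : bool :=
  [&& [forall c, (t c != ord0) == (c \in diagram la)],
      [forall c in diagram la, forall d in diagram la,
        (t c == t d) ==> (c == d)],
      [forall c in diagram la, forall d in diagram la,
        (c.1 == d.1) && (c.2 < d.2) ==> (t c < t d)] &
      [forall c in diagram la, forall d in diagram la,
        (c.2 == d.2) && (c.1 < d.1) ==> (t c < t d)]].

Definition num_SYT la : nat :=
  #|[set t : {ffun 'I_n * 'I_n -> 'I_n.+1} | is_SYT la t]|.

End Partitions.

Section Expectations.
Variable R : realType.
Implicit Types (beta : R) (k l n p q : nat).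

Definition hook_mean k l beta n (g : intpart n -> nat) : R :=
  (\sum_(la in hook n k l) (g la)%:R * (num_SYT la)%:R `^ beta) /
  (\sum_(la in hook n k l) (num_SYT la)%:R `^ beta).

Definition row_mean k l beta p n : R :=
  hook_mean k l beta (fun la : intpart n => part la p).

Definition col_mean k l beta q n : R :=
  hook_mean k l beta (fun la : intpart n => conj_part la q).

(* The c(n) solving a(n) = n / (k + l) + c(n) * sqrt n, for n > 0. *)
Definition sqrt_coef k l (a : nat -> R) n : R :=
  (a n - n%:R / (k + l)%:R) / Num.sqrt n%:R.

Definition row_coef k l beta p : nat -> R := sqrt_coef k l (row_mean k l beta p).

Definition col_coef k l beta q : nat -> R := sqrt_coef k l (col_mean k l beta q).

Lemma sqrt_coefE k l (a : nat -> R) n : (0 < n)%N ->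
  a n = n%:R / (k + l)%:R + sqrt_coef k l a n * Num.sqrt n%:R.
Proof.
move=> n0; rewrite /sqrt_coef divfK; first by rewrite addrC subrK.
by rewrite gt_eqF// sqrtr_gt0 ltr0n.
Qed.

Definition asymp_equiv (a b : nat -> R) : Prop :=
  (\forall n \near \oo, b n != 0) /\ (a n / b n @[n --> \oo] --> (1 : R)).

End Expectations.

Section TupleLebesgue.
Variable R : realType.
Local Notation T := (measurableTypeR R).

Definition cons_pair n (p : T * n.-tuple T) : n.+1.-tuple T :=
  [tuple of p.1 :: p.2].

Lemma measurable_cons_pair n :
  measurable_fun [set: T * n.-tuple T] (@cons_pair n).
Proof.
by apply: measurable_cons; [exact: measurable_fst | exact: measurable_snd].
Qed.

HB.instance Definition _ n :=
  isMeasurableFun.Build _ _ _ _ (@cons_pair n) (@measurable_cons_pair n).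

Definition uncons n (x : n.+1.-tuple T) : T * n.-tuple T :=
  (thead x, [tuple of behead x]).

Lemma measurable_uncons n : measurable_fun [set: n.+1.-tuple T] (@uncons n).
Proof.
apply/measurable_fun_pairP; split.
- exact: (@measurable_tnth _ T n.+1 ord0).
- exact: measurable_behead.
Qed.

Lemma cons_pairK n : cancel (@cons_pair n) (@uncons n).
Proof. by move=> [a x]; congr pair; apply: val_inj. Qed.

Section ConsMeasure.
Variables (n : nat) (m : {sigma_finite_measure set (n.-tuple T) -> \bar R}).

Definition cons_measure : set (n.+1.-tuple T) -> \bar R :=
  pushforward (@lebesgue_measure R \x m)%E (@cons_pair n).

Let cons_measure0 : cons_measure set0 = 0%E.
Proof. exact: measure0. Qed.

Let cons_measure_ge0 A : (0 <= cons_measure A)%E.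
Proof. exact: measure_ge0. Qed.

Let cons_measure_sigma_additive : semi_sigma_additive cons_measure.
Proof. exact: measure_semi_sigma_additive. Qed.

HB.instance Definition _ := isMeasure.Build _ _ _ cons_measure
  cons_measure0 cons_measure_ge0 cons_measure_sigma_additive.

Let cons_measure_sigma_finite : sigma_finite setT cons_measure.
Proof.
have /sigma_finiteP[F [FT ndF Foo]] := sigma_finiteT (@lebesgue_measure R).
have /sigma_finiteP[G [GT ndG Goo]] := sigma_finiteT m.
exists (fun i => @uncons n @^-1` (F i `*` G i)).
  apply/esym; rewrite -subTset => x _.
  have [i _ Fi] : (\bigcup_i F i) (thead x) by rewrite -FT.
  have [j _ Gj] : (\bigcup_i G i) [tuple of behead x] by rewrite -GT.
  exists (maxn i j) => //; split => /=.
  - by move: Fi; exact/subsetPset/ndF/leq_maxl.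
  - by move: Gj; exact/subsetPset/ndG/leq_maxr.
move=> i; have [mF Fi] := Foo i; have [mG Gi] := Goo i; split.
  rewrite -[X in measurable X]setTI; apply: measurable_uncons => //.
  exact: measurableX.
rewrite /cons_measure /pushforward -comp_preimage.
rewrite (_ : _ @^-1` (F i `*` G i) = F i `*` G i); last first.
  have -> : @uncons n \o @cons_pair n = id by apply/funext; exact: cons_pairK.
  by rewrite preimage_id.
by rewrite product_measure1E// lte_mul_pinfty// ge0_fin_numE.
Qed.

HB.instance Definition _ := Measure_isSigmaFinite.Build _ _ _ cons_measure
  cons_measure_sigma_finite.

End ConsMeasure.

(* Lebesgue measure on R^n; for n = 0 it is the unit mass at the empty tuple. *)
Fixpoint tuple_lebesgue (n : nat) :
    {sigma_finite_measure set (n.-tuple T) -> \bar R} :=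
  match n with
  | 0 => \d_([tuple] : 0.-tuple T)
  | n'.+1 => cons_measure (tuple_lebesgue n')
  end.

(* The point (x_1, ..., x_(r-1), - (x_1 + ... + x_(r-1))) of the hyperplane of
   zero sum. *)
Definition hyperplane_point r (x : r.-1.-tuple T) : r.-tuple T :=
  [tuple (if insub (val i) is Some j then tnth x j
          else - \sum_(j < r.-1) tnth x j) : T | i < r].

Lemma measurable_hyperplane_point r :
  measurable_fun [set: r.-1.-tuple T] (@hyperplane_point r).
Proof.
apply/measurable_fun_tnthP => i.
rewrite (_ : _ \o _ = fun x => if insub (val i) is Some j then tnth x j
          else - \sum_(j < r.-1) tnth x j); last first.
  by apply/funext => x /=; rewrite tnth_mktuple.
case: insubP => [j _ _|_]; first exact: measurable_tnth.
apply: measurable_funN.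
by apply: measurable_sum => j; exact: measurable_tnth.
Qed.

HB.instance Definition _ r := isMeasurableFun.Build _ _ _ _
  (@hyperplane_point r) (@measurable_hyperplane_point r).

(* Lebesgue measure on the hyperplane of zero sum in R^r, in the coordinates
   x_1, ..., x_(r-1); the Euclidean normalization differs by sqrt r. *)
Definition hyperplane_lebesgue r : set (r.-tuple T) -> \bar R :=
  pushforward (tuple_lebesgue r.-1) (@hyperplane_point r).

Arguments hyperplane_lebesgue : clear implicits.

Section HyperplaneMeasure.
Variable r : nat.

Let hyperplane0 : hyperplane_lebesgue r set0 = 0%E.
Proof. exact: measure0. Qed.

Let hyperplane_ge0 A : (0 <= hyperplane_lebesgue r A)%E.
Proof. exact: measure_ge0. Qed.

Let hyperplane_sigma_additive : semi_sigma_additive (hyperplane_lebesgue r).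
Proof. exact: measure_semi_sigma_additive. Qed.

HB.instance Definition _ := isMeasure.Build _ _ _ (hyperplane_lebesgue r)
  hyperplane0 hyperplane_ge0 hyperplane_sigma_additive.

End HyperplaneMeasure.

Definition Omega r : set (r.-tuple T) :=
  [set x | (forall i j : 'I_r, (i <= j)%N -> (tnth x j : R) <= tnth x i) /\
           \sum_(i < r) (tnth x i : R) = 0].

Arguments Omega : clear implicits.

Definition vandermonde_prod r (x : r.-tuple R) : R :=
  \prod_(i < r) \prod_(j < r | (i < j)%N) (tnth x i - tnth x j).

(* [m] stands for k + l. *)
Definition weight r (m : nat) (beta : R) (x : r.-tuple R) : R :=
  (vandermonde_prod x * expR (- (m%:R / 2) * \sum_(i < r) tnth x i ^+ 2))
    `^ beta.

Definition limit_coef r (m : nat) (beta : R) (p : 'I_r) : R :=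
  (\int[hyperplane_lebesgue r]_(x in Omega r) (tnth x p * weight m beta x)) /
  (\int[hyperplane_lebesgue r]_(x in Omega r) weight m beta x).

End TupleLebesgue.

Arguments Omega R r : clear implicits.
Arguments hyperplane_lebesgue R r : clear implicits.

(* Main.v *)
Require Import Defs.
From mathcomp Require Import all_boot all_order all_algebra.
From mathcomp Require Import all_classical all_reals all_analysis.
From mathcomp Require Import perm measurable_realfun zify ring lra.
Set Implicit Arguments.
Unset Strict Implicit.
Unset Printing Implicit Defensive.
Import Order.TTheory GRing.Theory Num.Theory.
Import numFieldNormedType.Exports.

(** Let k, l >= 1 and m = k + l.  Almost all the weight of the hook sits on the
    partitions containing the k x l rectangle.  Such a partition is determined by
    its arms a_i (what sticks out of the rectangle in row i, made strictly
    decreasing by adding k - 1 - i) and its legs b_j (the same for columns), and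
    the number of its standard tableaux is
      n! V(a) V(b) / (prod a_i! * prod b_j! * prod (a_i + b_j + 1)),
    where V is the Vandermonde product ([num_SYT_hook]).  This is Frobenius's
    formula ([num_std_Frobenius]) after the row beads i >= k have been traded
    for the l holes that they leave free ([num_std_hook]).

    Put M = floor (n / m), a_i = M + d_i and b_j = M + e_j.  The numbers d_i, e_j
    are of order sqrt n, and their sum is a bounded integer fixed by n.  As
    M! M^d / (M + d)! is close to exp (- d^2 / (2 M)), the number of tableaux is a
    factor that depends on n only ([norming]) times a function [gcore] of the
    d_i / sqrt n and e_j / sqrt n that converges to a multiple of
      V(x) V(y) exp (- (m / 2) (|x|^2 + |y|^2))
    and has a Gaussian bound that is uniform in n ([cvg_gcore], [gcore_bound]).
    The norming factor cancels from a mean.  A sum over partitions equals, up to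
    a power of sqrt n, the integral of a function that is constant on boxes, one
    box for each partition ([integral_sample_term]); dominated convergence then
    replaces it by the integral of the limiting density over the pairs (x, y)
    with total sum zero ([limit_term_cvg]).

    Let s be the sum of the x_i.  In x_i = s / k + x'_i and y_j = - s / l + y'_j,
    with x' and y' of zero sum, the Vandermonde products do not see s and the sum
    of squares splits, so that the limiting density is a Gaussian density in s
    times the weight of the statement at x' times that at y'
    ([core_lim_split]).  The mean of x_p is therefore the weighted mean of x'_p,
    because the contribution of s / k is the integral of an odd function
    ([integral_limit_row], [integral_limit_col]).

    A partition of the hook that misses the corner of the rectangle contains
    the smaller rectangle (k - d) x (l - d) for some d > 0 and lies in the
    corresponding smaller hook.  Its product formula has 2 d fewer factors
    M^M / M!, each of which is exponentially large in n, while there are only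
    polynomially many such partitions ([defective_le], [defective_sum]). *)

(** * The Vandermonde product under unit shifts *)

Section Vandermonde.
Local Open Scope ring_scope.
Variable R : comNzRingType.

Definition falling (x : R) (j : nat) : R := \prod_(t < j) (x - t%:R).

(** Shifting the argument of a falling factorial trades its first factor for a new last
    one; this is what makes falling factorials a good basis for [vander_shift]. *)
Lemma falling_shift x j : x * falling (x - 1) j = (x - j%:R) * falling x j.
Proof.
rewrite [RHS]mulrC -[RHS](@big_ord_recr _ _ _ j (fun t : 'I__ => x - t%:R)).
rewrite big_ord_recl subr0; congr (_ * _); apply: eq_bigr => t _.
by rewrite /= /bump /= natrD opprD addrA.
Qed.

Definition vander n (x : 'I_n -> R) : R :=
  \prod_(i < n) \prod_(j < n | (i < j)%N) (x i - x j).

(** The falling factorials are monic of degrees 0, 1, 2, and so on, so that passing to them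
    from the powers is a unitriangular change of basis. *)
Lemma det_falling n (x : 'I_n -> R) :
  \det (\matrix_(i < n, j < n) falling (x i) j) =
  \prod_(i < n) \prod_(j < n | (i < j)%N) (x j - x i).
Proof.
pose P (i : nat) : {poly R} := \prod_(t < i) ('X - (t%:R : R)%:P).
have sP i : size (P i) = i.+1.
  by rewrite /P size_prod_XsubC /index_enum -enumT size_enum_ord.
have -> : (\matrix_(i < n, j < n) falling (x i) j) =
   ((\matrix_(j < n, s < n) (P j)`_s) *m Vandermonde n (\row_i x i))^T.
  apply/matrixP => i j; rewrite !mxE.
  have -> : falling (x i) j = (P j).[x i].
    by rewrite horner_prod; apply: eq_bigr => t _; rewrite hornerXsubC.
  rewrite (@horner_coef_wide _ n); last by rewrite sP.
  by apply: eq_bigr => s _; rewrite !mxE.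
rewrite det_tr det_mulmx det_Vandermonde det_trig; last first.
  by apply/is_trig_mxP => i j lij; rewrite mxE nth_default // sP.
rewrite big1 ?mul1r => [|i _]; last first.
  rewrite mxE; have /monicP : P i \is monic.
    by apply: monic_prod => t _; exact: monicXsubC.
  by rewrite lead_coefE sP.
by apply: eq_bigr => i _; apply: eq_bigr => j _; rewrite !mxE.
Qed.

Lemma vander_rev n (x : 'I_n -> R) : vander x =
  (\prod_(i < n) \prod_(j < n | (i < j)%N) -1) *
  \det (\matrix_(i < n, j < n) falling (x i) j).
Proof.
rewrite det_falling -big_split; apply: eq_bigr => i _.
by rewrite -big_split; apply: eq_bigr => j _; rewrite /= mulN1r opprB.
Qed.

(** The step of the recursion behind Frobenius's formula. Expanded over permutations,
    lowering x_i by one changes a single factor of each term, the falling factorial of x_i of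
    degree s i, and multiplied by x_i it becomes itself times x_i - s i ([falling_shift]); the sum of these
    factors over i is the same for every permutation s. *)
Lemma vander_shift n (x : 'I_n -> R) :
  \sum_(i < n) x i * vander (fun j => x j - (i == j)%:R) =
  (\sum_(i < n) x i - (\sum_(i < n) i)%:R) * vander x.
Proof.
rewrite vander_rev mulrCA.
under eq_bigr do rewrite vander_rev mulrCA.
rewrite -mulr_sumr; congr (_ * _).
under eq_bigr do rewrite mulr_sumr.
rewrite exchange_big mulr_sumr; apply: eq_bigr => s _.
rewrite (_ : \sum_(i < n) x i - _ = \sum_(i < n) (x i - (s i)%:R)); last first.
  rewrite sumrB natr_sum; congr (_ - _).
  by rewrite (reindex_inj (@perm_inj _ s)).
rewrite mulr_suml; apply: eq_bigr => i _.
rewrite mulrCA [in RHS]mulrCA; congr (_ * _).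
rewrite (bigD1 i) //= [in RHS](bigD1 i) //= !mxE eqxx.
rewrite mulr1n [LHS]mulrA falling_shift -[LHS]mulrA.
congr (_ * (_ * _)).
by apply: eq_bigr => j ji; rewrite !mxE eq_sym (negbTE ji) subr0.
Qed.

Lemma vander_eq0 n (x : 'I_n -> R) (i j : 'I_n) :
  (i < j)%N -> x i = x j -> vander x = 0.
Proof.
move=> ij xij; rewrite /vander (bigD1 i) //= (bigD1 j) //= xij subrr.
by rewrite !mul0r.
Qed.

End Vandermonde.

(** * Standard fillings of a set of cells *)

Section StandardFillings.
Local Open Scope nat_scope.
Variable n : nat.
Local Notation cell := ('I_n * 'I_n)%type.
Local Notation filling := {ffun 'I_n * 'I_n -> 'I_n.+1}.
Implicit Types (D : {set cell}) (c d : cell) (t : filling).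

(** Strict order inside a common row or column: the cells that a standard filling compares. *)
Definition cell_lt c d : bool :=
  ((c.1 == d.1) && (c.2 < d.2)) || ((c.2 == d.2) && (c.1 < d.1)).

Definition corner D c : bool :=
  (c \in D) && [forall d in D, ~~ cell_lt c d].

(** Entries are 1, ..., #|D| on D and 0 outside; D is an arbitrary set of cells, so that
    cells can be removed one at a time. *)
Definition is_std D t : bool :=
  [&& [forall c, (t c != ord0) == (c \in D)],
      [forall c in D, forall d in D, (t c == t d) ==> (c == d)],
      [forall c in D, forall d in D, cell_lt c d ==> (t c < t d)] &
      [forall c, t c <= #|D|]].

Lemma is_stdP D t : reflect
  [/\ forall c, (t c != ord0) = (c \in D),
      {in D &, injective t},
      {in D &, forall c d, cell_lt c d -> t c < t d} &
      forall c, t c <= #|D|] (is_std D t).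
Proof.
apply: (iffP and4P) => -[H1 H2 H3 H4]; split.
- by move=> c; have /eqP := fintype.forallP H1 c.
- move=> c d cD dD tcd; apply/eqP.
  by move/forall_inP: H2 => /(_ _ cD)/forall_inP/(_ _ dD)/implyP; apply; apply/eqP.
- move=> c d cD dD; apply/implyP.
  by move/forall_inP: H3 => /(_ _ cD)/forall_inP/(_ _ dD).
- exact/fintype.forallP.
- by apply/fintype.forallP => c; rewrite H1.
- apply/forall_inP => c cD; apply/forall_inP => d dD.
  by apply/implyP => /eqP/H2 ->.
- apply/forall_inP => c cD; apply/forall_inP => d dD.
  by apply/implyP; exact: H3.
- by apply/fintype.forallP.
Qed.

Definition num_std D : nat := #|[set t | is_std D t]|.

(** The largest entry of a standard filling sits at exactly one cell, and that cell is a
    corner since nothing to its right or below it could be larger. *)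
Lemma std_top D t : 0 < #|D| -> is_std D t ->
  #|[set c | corner D c && (t c == #|D| :> nat)]| = 1.
Proof.
move=> D0 /is_stdP[t0 tinj tlt tle].
have [c cD tc] : exists2 c, c \in D & t c = #|D| :> nat.
  pose s := [seq val (t c) | c <- enum D].
  have us : uniq s.
    rewrite map_inj_in_uniq ?enum_uniq// => c d; rewrite !mem_enum => cD dD.
    by move/val_inj/tinj; apply.
  have [_ ms] : (size s = size (iota 1 #|D|)) * (s =i iota 1 #|D|).
    apply: uniq_min_size => //; last by rewrite size_iota size_map -cardE.
    move=> v /mapP[c]; rewrite mem_enum => cD ->; rewrite mem_iota add1n ltnS tle.
    by rewrite andbT lt0n; have := t0 c; rewrite cD => /idP.
  have : #|D| \in s by rewrite ms mem_iota add1n ltnSn D0.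
  by move=> /mapP[c]; rewrite mem_enum => cD ->; exists c.
rewrite -(cards1 c); apply: eq_card => d; rewrite !inE.
apply/andP/eqP => [[/andP[dD _] /eqP td]|->].
  by apply: tinj => //; apply: val_inj; rewrite /= tc td.
rewrite tc eqxx; split=> //; apply/andP; split=> //.
apply/forall_inP => e eD; apply/negP => /(tlt _ _ cD eD).
by rewrite tc ltnNge tle.
Qed.

(** Erasing the largest entry, or putting it back, is a bijection. *)
Lemma std_remove D c : #|D| <= n -> corner D c ->
  #|[set t | is_std D t && (t c == #|D| :> nat)]| = num_std (D :\ c).
Proof.
move=> Dn /andP[cD /forall_inP cmax].
have DE : #|D| = #|D :\ c|.+1 by rewrite (cardsD1 c D) cD.
pose g t : filling := [ffun d => if d == c then inord #|D| else t d].
pose f t : filling := [ffun d => if d == c then ord0 else t d].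
have vD : (inord #|D| : 'I_n.+1) = #|D| :> nat by rewrite inordK.
rewrite /num_std -(@card_in_imset _ _ g [set t | is_std (D :\ c) t]); last first.
  move=> t1 t2; rewrite !inE => /is_stdP[h1 _ _ _] /is_stdP[h2 _ _ _] e.
  apply/ffunP => d; have [->|dc] := eqVneq d c.
    have /negbFE/eqP -> : t1 c != ord0 = false by rewrite h1 !inE eqxx.
    by have /negbFE/eqP -> : t2 c != ord0 = false by rewrite h2 !inE eqxx.
  by move/ffunP/(_ d): e; rewrite !ffunE (negbTE dc).
apply: eq_card => t; rewrite inE; apply/andP/imsetP => [[/is_stdP[t0 ti tl te] /eqP tc]|].
  exists (f t); last first.
    by apply/ffunP => d; rewrite !ffunE; case: eqP => // ->; apply: val_inj; rewrite /= vD.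
  rewrite inE; apply/is_stdP; split.
  - by move=> d; rewrite !inE ffunE; case: (eqVneq d c) => [->|_]; rewrite ?t0.
  - move=> d e; rewrite !inE !ffunE => /andP[/negbTE -> dD] /andP[/negbTE -> eD].
    exact: ti.
  - move=> d e; rewrite !inE !ffunE => /andP[/negbTE -> dD] /andP[/negbTE -> eD].
    exact: tl.
  - move=> d; rewrite ffunE; case: eqP => // /eqP dc.
    have [dD|dD] := boolP (d \in D).
      have := te d; rewrite leq_eqVlt => /orP[/eqP td|]; last by rewrite DE.
      by case/eqP: dc; apply: ti => //; apply: val_inj; rewrite /= td tc.
    by have /negbFE/eqP -> : t d != ord0 = false by rewrite t0 (negbTE dD).
move=> [t']; rewrite inE => /is_stdP[t0 ti tl te] ->; split; last first.
  by rewrite ffunE eqxx vD.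
have ltc d : t' d < #|D| by rewrite DE ltnS te.
apply/is_stdP; split.
- move=> d; rewrite ffunE; have [->|dc] := eqVneq d c; last by rewrite t0 !inE dc.
  by rewrite cD -val_eqE /= vD DE.
- move=> d e dD eD; rewrite !ffunE; have [->|dc] := eqVneq d c; have [->|ec] := eqVneq e c => //.
  + by move/(congr1 val); rewrite /= vD => h; have := ltc e; rewrite h ltnn.
  + by move/(congr1 val); rewrite /= vD => h; have := ltc d; rewrite h ltnn.
  + by apply: ti; rewrite !inE ?dc ?ec.
- move=> d e dD eD; rewrite !ffunE; have [->|dc] := eqVneq d c; have [->|ec] := eqVneq e c => //.
  + by rewrite (negbTE (cmax _ cD)).
  + by rewrite (negbTE (cmax _ eD)).
  + by rewrite vD ltc.
  + by apply: tl; rewrite !inE ?dc ?ec.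
- by move=> d; rewrite ffunE; case: eqP => _; [rewrite vD | exact: ltnW].
Qed.

Lemma num_std_rec D : 0 < #|D| <= n ->
  num_std D = \sum_(c | corner D c) num_std (D :\ c).
Proof.
move=> /andP[D0 Dn]; rewrite /num_std -sum1_card.
transitivity (\sum_(t in [set t | is_std D t]) \sum_(c | corner D c && (t c == #|D| :> nat)) 1).
  apply: eq_bigr => t; rewrite inE => tD.
  by rewrite -[LHS](std_top D0 tD) -sum1_card; apply: eq_bigl => c; rewrite inE.
rewrite (exchange_big_dep (corner D)) /=; last by move=> t c _ /andP[].
apply: eq_bigr => c cc; rewrite -[RHS]/(num_std (D :\ c)) -(std_remove Dn cc) -sum1_card.
by apply: eq_bigl => t; rewrite !inE cc.
Qed.

Lemma num_std0 : num_std finset.set0 = 1.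
Proof.
rewrite /num_std -(cards1 ([ffun=> ord0] : filling)).
apply: eq_card => t; rewrite !inE; apply/is_stdP/eqP => [[t0 _ _ _]|->].
  apply/ffunP => c; rewrite ffunE.
  by have /negbFE/eqP -> : t c != ord0 = false by rewrite t0 inE.
split => [c|c d|c d|c]; rewrite ?inE ?ffunE ?eqxx//.
Qed.

End StandardFillings.

(** * Frobenius's formula *)

Section Frobenius.
Local Open Scope nat_scope.
Variables (R : realFieldType) (n : nat).
Implicit Types (la : nat -> nat).

(** A partition as a weakly decreasing function, extended by zeros, that fits in an
    n x n box. *)
Definition is_shape la := [/\ forall i, la i.+1 <= la i, la n = 0 & la 0 <= n].

Definition cells la : {set 'I_n * 'I_n} :=
  [set c : 'I_n * 'I_n | c.2 < la c.1].

Definition dec la (i j : nat) := la j - (i == j).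

(** First-column hook lengths of the shape padded to n rows; they are distinct, and
    decrease strictly with i. *)
Definition bead la (i : nat) := la i + (n - i.+1).

Lemma shape_mono la i j : is_shape la -> i <= j -> la j <= la i.
Proof. by case=> la1 _ _; apply: (homo_leq (r := fun x y => y <= x)) => // x y z; exact: (fun h1 h2 => leq_trans h2 h1). Qed.

Lemma shape_le la i : is_shape la -> la i <= n.
Proof. by move=> sla; case: (sla) => _ _; apply: leq_trans; exact: shape_mono. Qed.

Lemma card_cells la : is_shape la -> #|cells la| = \sum_(i < n) la i.
Proof.
move=> sla; rewrite -sum1_card (partition_big (fun c : 'I_n * 'I_n => c.1) predT) //=.
apply: eq_bigr => i _.
rewrite (reindex_onto (fun j : 'I_n => (i, j)) snd) /=; last first.
  by move=> [a b] /andP[_ /eqP /= ->].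
under eq_bigl do rewrite inE /= !eqxx !andbT.
rewrite (big_ord_narrow (shape_le i sla)) sum1_card card_ord //.
Qed.

Lemma dec_shape la i : is_shape la -> la i.+1 < la i -> is_shape (dec la i).
Proof.
move=> [la1 lan la0] hi; rewrite /dec; split => [j||].
- have := la1 j; case: (i =P j.+1) => [->|_]; case: (i =P j) => [ij|_] /=; subst; lia.
- by rewrite lan.
- by apply: leq_trans la0; exact: leq_subr.
Qed.

Lemma corner_cells la (c : 'I_n * 'I_n) : is_shape la ->
  corner (cells la) c = (la c.1.+1 < la c.1) && (c.2.+1 == la c.1).
Proof.
move=> sla; case: c => i j /=; apply/andP/andP => /=.
  rewrite !inE /= => -[jl /forall_inP h].
  have e : j.+1 = la i.
    apply/eqP; rewrite eqn_leq jl leqNgt; apply/negP => jl'.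
    have jn : j.+1 < n by apply: leq_trans jl' (shape_le _ sla).
    have := h (i, Ordinal jn); rewrite inE /= jl' => /(_ isT).
    by rewrite /cell_lt /= eqxx ltnSn.
  split; last exact/eqP.
  rewrite ltnNge -e; apply/negP => jl'.
  have il : i.+1 < n.
    rewrite ltn_neqAle ltn_ord andbT; apply/eqP => ie; case: (sla) => _ lan _.
    by move: jl'; rewrite ie lan.
  have := h (Ordinal il, j); rewrite inE /= jl' => /(_ isT).
  by rewrite /cell_lt /= eqxx ltnSn orbT.
move=> [hi /eqP e]; split; first by rewrite inE /= -e.
apply/forall_inP => -[i' j']; rewrite inE /= => jl; rewrite /cell_lt /=.
apply/negP => /orP[|] /andP[/eqP ? h]; subst; first by move: jl; rewrite -e ltnS leqNgt h.
have := shape_mono sla h; lia.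
Qed.

Lemma cells_remove la (c : 'I_n * 'I_n) : is_shape la -> corner (cells la) c ->
  cells la :\ c = cells (dec la c.1).
Proof.
move=> sla; rewrite corner_cells // => /andP[_ /eqP h]; apply/setP => -[i j].
rewrite !inE /dec; case: c h => a b /= h.
rewrite xpair_eqE -!val_eqE /=.
rewrite (eq_sym (nat_of_ord i)); case: eqVneq => [<-|_] /=; last by rewrite subn0.
by rewrite -h subn1 /=; lia.
Qed.

(** A row has a corner at its end exactly when it is longer than the next row. *)
Lemma num_std_shape la : is_shape la -> 0 < \sum_(i < n) la i <= n ->
  num_std (cells la) = \sum_(i < n | la i.+1 < la i) num_std (cells (dec la i)).
Proof.
move=> sla h; rewrite num_std_rec ?card_cells //.
rewrite (partition_big (fun c : 'I_n * 'I_n => c.1) (fun i : 'I_n => la i.+1 < la i)); last first.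
  by move=> c; rewrite corner_cells // => /andP[].
apply: eq_bigr => i hi.
have jn : (la i).-1 < n.
  by apply: leq_trans (shape_le i sla); rewrite prednK // (leq_trans _ hi).
rewrite (big_pred1 (i, Ordinal jn)) => [|[a b]]; last first.
  rewrite corner_cells //= xpair_eqE /=; have [->|ai] := eqVneq a i; last by rewrite andbF.
  rewrite hi andbT /= -val_eqE /=; lia.
rewrite cells_remove // corner_cells //= hi prednK ?eqxx //; lia.
Qed.

Local Open Scope ring_scope.

Lemma vander_staircase : \prod_(i < n) (n - i.+1)`!%:R =
  vander (fun i : 'I_n => (n - i.+1)%:R : R).
Proof.
apply: eq_bigr => i _.
transitivity (\prod_(i.+1 <= j < n) ((j - i)%N%:R : R)).
  rewrite fact_prod natr_prod [RHS]big_add1 [RHS](@big_addn _ _ _ 0%N _ i).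
  rewrite big_add1; case: n i => [[]//|m] i; rewrite /= subSS.
  by apply: eq_bigr => j _; congr (_%:R); lia.
rewrite big_geq_mkord; apply: eq_bigr => j ij.
have := ltn_ord j; rewrite -natrB; last lia.
by move=> ?; congr (_%:R); lia.
Qed.

(** Induction on the number of cells. Removing a cell of row i lowers the bead i by one,
    and the rows without a corner would contribute nothing, their term in [vander_shift] being
    zero; so the recursion for fillings matches [vander_shift]. *)
Theorem num_std_Frobenius la : is_shape la -> (\sum_(i < n) la i <= n)%N ->
  (num_std (cells la))%:R * \prod_(i < n) (bead la i)`!%:R =
  (\sum_(i < n) la i)%N`!%:R * vander (fun i : 'I_n => (bead la i)%:R : R).
Proof.
move: {2}(\sum_(i < n) la i)%N (erefl (\sum_(i < n) la i)%N) => m.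
elim: m la => [|m IHm] la sm sla.
  have la0 (i : 'I_n) : la i = 0%N.
    by apply/eqP; rewrite -leqn0 -sm (bigD1 i) //= leq_addr.
  have -> : cells la = finset.set0.
    by apply/setP => -[i j]; rewrite !inE /= la0.
  move=> _; rewrite num_std0 sm mul1r fact0 mul1r.
  transitivity (\prod_(i < n) (n - i.+1)`!%:R : R).
    by apply: eq_bigr => i _; rewrite /bead la0.
  rewrite vander_staircase; apply: eq_bigr => i _; apply: eq_bigr => j _.
  by rewrite /bead !la0.
rewrite {1}sm => mn; rewrite num_std_shape ?sm // natr_sum mulr_suml.
pose X (i : 'I_n) : R := (bead la i)%:R.
transitivity (\sum_(i < n) X i * (m`!%:R * vander (fun j => X j - (i == j)%:R))).
  rewrite big_mkcond; apply: eq_bigr => i _; case: ifPn => hi.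
    have sd := dec_shape sla hi.
    have dm : (\sum_(j < n) dec la i j = m)%N.
      apply/eqP; rewrite -eqSS -sm /dec (bigD1 i) //= [X in _ == X](bigD1 i) //= eqxx.
      rewrite -addSn; apply/eqP; congr (_ + _)%N; first by lia.
      apply: eq_bigr => j ji; rewrite -val_eqE eq_sym in ji.
      by rewrite (negbTE ji) subn0.
    have be (j : 'I_n) : (bead (dec la i) j + (i == j) = bead la j)%N.
      rewrite /bead /dec -val_eqE; case: (nat_of_ord i =P j) => /= [<-|]; lia.
    have := IHm _ dm sd; rewrite dm => /(_ (ltnW mn)).
    have -> : vander (fun j : 'I_n => (bead (dec la i) j)%:R : R) =
              vander (fun j : 'I_n => X j - (i == j)%:R).
      by apply: eq_bigr => a _; apply: eq_bigr => b _; rewrite /X -!be !natrD !addrK.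
    move=> <-; rewrite mulrCA; congr (_ * _).
    rewrite (bigD1 i) //= [in RHS](bigD1 i) //= mulrA; congr (_ * _).
      rewrite /X -be eqxx addn1 factS natrM //.
    apply: eq_bigr => j ji; congr (_`!%:R); rewrite -be.
    by rewrite eq_sym (negbTE ji) addn0.
  (* A row without a corner: its lowered bead equals the next bead, or, in the
     last row, the bead itself is 0. *)
  have e : la i.+1 = la i.
    by case: (sla) => h _ _; apply/eqP; rewrite eqn_leq h leqNgt.
  have [il|] := ltnP i.+1 n.
    rewrite (@vander_eq0 _ _ _ i (Ordinal il)) ?mulr0 //.
    have -> : i == Ordinal il = false by rewrite -val_eqE /=; lia.
    rewrite eqxx subr0 /X /bead /= e -natrB; first by congr (_%:R); lia.
    by lia.
  move=> ni; have ei : i.+1 = n by apply/eqP; rewrite eqn_leq ni ltn_ord.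
  by case: (sla) => _ lan _; rewrite /X /bead -e ei lan subnn mul0r.
under eq_bigr do rewrite mulrCA.
rewrite -mulr_sumr vander_shift mulrA; congr (_ * _).
rewrite factS natrM mulrC; congr (_ * _); rewrite /X -natr_sum.
rewrite (_ : (\sum_(i < n) bead la i = m.+1 + \sum_(i < n) i)%N) ?natrD ?addrK//.
rewrite big_split sm /=; congr (_ + _)%N.
by rewrite (reindex_inj rev_ord_inj); apply: eq_bigr => i _; have := ltn_ord i; move=> /=; lia.
Qed.

End Frobenius.

(** * The product formula for shapes containing a rectangle *)

Section Discriminant.
Local Open Scope ring_scope.
Variable R : realFieldType.
Implicit Types (s t : seq R).

(** Product of the distances of all pairs: the absolute value of the Vandermonde product,
    in a form that does not depend on the order of the sequence ([disc_perm]). *)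
Fixpoint disc s : R :=
  if s is x :: s' then (\prod_(y <- s') `|x - y|) * disc s' else 1.

Lemma disc_cat s t :
  disc (s ++ t) = disc s * disc t * \prod_(x <- s) \prod_(y <- t) `|x - y|.
Proof.
elim: s => [|x s IH] /=; first by rewrite big_nil mul1r mulr1.
by rewrite IH big_cons big_cat /=; ring.
Qed.

Lemma disc_perm s t : perm_eq s t -> disc s = disc t.
Proof.
pose cross (u v : seq R) : R := \prod_(x <- u) \prod_(y <- v) `|x - y|.
have crossC u v : cross u v = cross v u.
  rewrite /cross exchange_big /=; apply: eq_bigr => x _.
  by apply: eq_bigr => y _; rewrite distrC.
have cross_cat u v w : cross u (v ++ w) = cross u v * cross u w.
  by rewrite /cross -big_split; apply: eq_bigr => x _; rewrite big_cat.
apply: catCA_perm_subst => s1 s2 s3.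
rewrite !disc_cat -!/(cross _ _) !cross_cat (crossC s2 s1).
ring.
Qed.

Lemma disc_shift c s : disc [seq x + c | x <- s] = disc s.
Proof.
elim: s => //= x s ->; rewrite big_map; congr (_ * _).
by apply: eq_bigr => y _; congr (`|_|); ring.
Qed.

Lemma disc_opp c s : disc [seq c - x | x <- s] = disc s.
Proof.
elim: s => //= x s ->; rewrite big_map; congr (_ * _).
by apply: eq_bigr => y _; rewrite distrC; congr (`|_|); ring.
Qed.

Lemma disc_vander n (f : nat -> R) :
  disc [seq f i | i <- iota 0 n] = `|vander (fun i : 'I_n => f i)|.
Proof.
suff H m : disc [seq f i | i <- iota m n] =
    `|vander (fun i : 'I_n => f (m + i)%N)| by exact: H.
elim: n m => [|n IH] m; first by rewrite /vander big_ord0 normr1.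
rewrite /= IH /vander [in RHS]big_ord_recl /= normrM.
rewrite [in RHS]big_mkcond big_ord_recl /= mul1r; congr (_ * _).
  rewrite big_map -[m.+1]addn0 iotaDl big_map normr_prod -[n in iota 0 n]subn0.
  by rewrite big_mkord; apply: eq_bigr => i _; rewrite /= addn0 addSnnS.
congr (`|_|); apply: eq_bigr => i _; rewrite [in RHS]big_mkcond big_ord_recl /=.
rewrite mul1r big_mkcond; apply: eq_bigr => j _.
by rewrite /bump /= !add1n ltnS !addSnnS.
Qed.

(** In the square every unordered pair occurs twice, once from each of its ends. *)
Lemma disc_sqr s : uniq s ->
  disc s ^+ 2 = \prod_(x <- s) \prod_(y <- s | y != x) `|x - y|.
Proof.
elim: s => [|x s IH] /=; first by rewrite big_nil expr1n.
move=> /andP[xs us]; rewrite exprMn IH // big_cons big_cons eqxx /= expr2.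
rewrite -mulrA; congr (_ * _).
  rewrite big_seq [RHS]big_seq_cond; apply: eq_bigl => y.
  by case: eqP => [->|_]; rewrite ?andbT ?andbF ?(negbTE xs).
rewrite !big_seq -big_split /=; apply: eq_bigr => y ys.
rewrite big_cons; case: eqP => [xy|_]; first by move: xs; rewrite xy ys.
by rewrite distrC.
Qed.

End Discriminant.

Lemma bead_lt n (la : nat -> nat) i j : is_shape n la ->
  (i < j)%N -> (j < n)%N -> (bead n la j < bead n la i)%N.
Proof. by move=> sla ij jn; rewrite /bead; have := shape_mono sla (ltnW ij); lia. Qed.

Lemma conj_mono (la cj : nat -> nat) i j :
  (forall i j, (i < cj j)%N = (j < la i)%N) -> (i <= j)%N -> (cj j <= cj i)%N.
Proof.
move=> cjP ij; rewrite leqNgt; apply/negP => h.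
have := cjP (cj i) j; rewrite h => /esym h1.
by have := cjP (cj i) i; rewrite ltnn; lia.
Qed.

Section BeadsAndHoles.
Variables (R : realFieldType) (n k l : nat) (la cj : nat -> nat).
Hypothesis sla : is_shape n la.
Hypothesis cjP : forall i j, (i < cj j)%N = (j < la i)%N.
Hypothesis kn : (k <= n)%N.
Hypothesis rect : forall i, (i < k)%N -> (l <= la i)%N.
Hypothesis hook : (la k <= l)%N.

Local Open Scope nat_scope.

Let c := n - k + l.
Let A i := la i - l + (k - i.+1).
Let B j := cj j - k + (l - j.+1).
Let hole j := n - cj j + j.

Lemma cj_le j : cj j <= n.
Proof. by rewrite leqNgt cjP; case: sla => _ -> _. Qed.

Lemma cj_ge j : j < l -> k <= cj j.
Proof.
case: (posnP k) => [->//|k0] jl; rewrite -(prednK k0) cjP.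
by apply: leq_trans jl _; apply: rect; rewrite prednK.
Qed.

Let low := [seq bead n la i | i <- iota k (n - k)].
Let holes := [seq hole j | j <- iota 0 l].

(** Part i exceeds j exactly when column j exceeds i. If it does, the bead is larger than
    the hole, and otherwise it is smaller. *)
Lemma hole_bead i j : i < n -> j < l -> bead n la i != hole j.
Proof.
move=> ni jl; rewrite /bead /hole; have := cjP i j; have := cj_le j.
by case: (leqP (la i) j) => h; rewrite ?ltnNge => h1 h2; apply/eqP => h3; lia.
Qed.

Lemma hole_lt i j : i < j -> hole i < hole j.
Proof. by move=> ij; rewrite /hole; have := conj_mono cjP (ltnW ij); have := cj_le j; lia. Qed.

Lemma hole_bound j : j < l -> hole j < c.
Proof. by move=> jl; rewrite /hole /c; have := cj_ge jl; have := cj_le j; lia. Qed.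

Lemma uniq_holes : uniq holes.
Proof.
rewrite map_inj_in_uniq ?iota_uniq // => i j _ _ h.
by case: (ltngtP i j) => // /hole_lt; rewrite h ltnn.
Qed.

(** The beads of the rows i >= k and the l holes fill the interval from 0 to n - k + l - 1:
    they are distinct, lie in it, and there are as many as it has points. *)
Lemma perm_low_holes : perm_eq (low ++ holes) (iota 0 c).
Proof.
have u : uniq (low ++ holes).
  rewrite cat_uniq uniq_holes andbT; apply/andP; split.
    rewrite map_inj_in_uniq ?iota_uniq // => i j; rewrite !mem_iota subnKC //.
    move=> /andP[_ ni] /andP[_ nj] h.
    by case: (ltngtP i j) => // ij; [have := bead_lt sla ij nj | have := bead_lt sla ij ni];
      rewrite h ltnn.
  apply/hasPn => y /mapP[j]; rewrite mem_iota => jl ->.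
  apply/mapP => -[i]; rewrite mem_iota subnKC // => /andP[_ ni] /eqP.
  by rewrite eq_sym (negbTE (hole_bead _ _)).
apply: uniq_perm => //; first exact: iota_uniq.
have sub : {subset low ++ holes <= iota 0 c}.
  move=> y; rewrite mem_cat mem_iota add0n /= => /orP[] /mapP[i]; rewrite mem_iota.
    rewrite subnKC // => /andP[ki ni] ->; rewrite /bead /c.
    by have := shape_mono sla ki; lia.
  by move=> jl ->; apply: hole_bound; case/andP: jl.
by have [] := uniq_min_size u sub _; rewrite // size_cat !size_map !size_iota.
Qed.

Local Open Scope ring_scope.

Let rr := (fun x : nat => x%:R : R).

Lemma prod_iota_fact a : \prod_(y <- iota 0 c) (a + c - y)%N%:R * a`!%:R = (a + c)`!%:R :> R.
Proof.
elim: c a => [|m IH] a; first by rewrite big_nil mul1r addn0.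
rewrite -addn1 iotaD big_cat /= big_seq1 add0n.
have -> : (a + (m + 1) = a.+1 + m)%N by lia.
rewrite -IH -mulrA; congr (_ * _).
by rewrite factS natrM; congr (_%:R * _); lia.
Qed.

Lemma disc_iota m : disc (map rr (iota 0 m)) = \prod_(y <- iota 0 m) y`!%:R.
Proof.
elim: m => [|m IH]; first by rewrite big_nil.
rewrite -addn1 iotaD map_cat disc_cat big_cat /= !big_nil !mulr1 IH big_seq1 add0n.
congr (_ * _); rewrite big_map fact_prod natr_prod big_add1 /=.
rewrite [RHS]big_nat_rev /= /index_iota subn0 !big_seq; apply: eq_bigr => i.
by rewrite mem_iota add0n /= big_seq1 => im; rewrite ler0_norm ?subr_le0 ?ler_nat ?opprB -?natrB; [congr (_%:R)| |]; lia.
Qed.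

(** The distances from h to the other points of an interval are 1, ..., h on one side
    and 1, ..., c - h - 1 on the other. *)
Lemma prod_iota_dist h : (h < c)%N ->
  \prod_(y <- iota 0 c | y != h) `|rr h - rr y| = h`!%:R * (c - h.+1)`!%:R.
Proof.
move=> hc; have e : iota 0 c = iota 0 h ++ h :: iota h.+1 (c - h.+1).
  by rewrite -{1}(subnKC hc) addSnnS iotaD /= add0n.
rewrite {}e big_cat big_cons eqxx /=; congr (_ * _).
  rewrite fact_prod natr_prod big_add1 /= [RHS]big_nat_rev /= /index_iota subn0.
  rewrite [LHS]big_seq_cond [RHS]big_seq; apply: eq_big => i.
    by rewrite mem_iota /=; case: ltngtP.
  rewrite mem_iota => im; rewrite /rr -natrB ?normr_nat; [congr (_%:R)|]; lia.
rewrite fact_prod natr_prod /index_iota subSS subn0 -[h.+1]addn1 addnC [in RHS]addnC -addn1.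
rewrite addnC iotaDl big_map [LHS]big_seq_cond [RHS]big_seq; apply: eq_big => i.
  by rewrite mem_iota /= andbC; case: eqP => //=; lia.
rewrite mem_iota => im; rewrite /rr distrC -natrB ?normr_nat; [congr (_%:R)|]; lia.
Qed.

Lemma vander_ge0 m (x : 'I_m -> R) :
  (forall i j : 'I_m, (i < j)%N -> x j <= x i) -> 0 <= vander x.
Proof.
by move=> h; apply: prodr_ge0 => i _; apply: prodr_ge0 => j ij; rewrite subr_ge0 h.
Qed.

Lemma prod_low_holes (Q : pred nat) (F : nat -> R) :
  \prod_(y <- iota 0 c | Q y) F y =
  \prod_(y <- low | Q y) F y * \prod_(y <- holes | Q y) F y.
Proof. by rewrite -big_cat; apply/esym/perm_big/perm_low_holes. Qed.

Lemma bead_arm i : (i < k)%N -> bead n la i = (A i + c)%N.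
Proof. by move=> ik; rewrite /bead /A /c; have := rect ik; lia. Qed.

Lemma hole_leg j : (j < l)%N -> hole j = (c - (B j).+1)%N.
Proof. by move=> jl; rewrite /hole /B /c; have := cj_ge jl; have := cj_le j; lia. Qed.

Lemma leg_bound j : (j < l)%N -> (B j < c)%N.
Proof. by move=> jl; rewrite /B /c; have := cj_ge jl; have := cj_le j; lia. Qed.

Lemma arm_mono i j : (i < j < k)%N -> (A j < A i)%N.
Proof. by move=> h; rewrite /A; have := @shape_mono _ _ i j sla; have := @rect j; lia. Qed.

Lemma leg_mono i j : (i < j < l)%N -> (B j < B i)%N.
Proof. by move=> h; rewrite /B; have := @conj_mono la cj i j cjP; have := @cj_ge j; lia. Qed.

Lemma prod_ord_iota m (F : nat -> R) : \prod_(i < m) F i = \prod_(i <- iota 0 m) F i.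
Proof. by rewrite -(big_mkord xpredT) /index_iota subn0. Qed.

Lemma disc_decr m (f : nat -> nat) : (forall i j, (i < j < m)%N -> (f j < f i)%N) ->
  disc [seq rr (f i) | i <- iota 0 m] = vander (fun i : 'I_m => (f i)%:R : R).
Proof.
move=> h; rewrite (disc_vander m (fun i => rr (f i))) ger0_norm // vander_ge0 // => i j ij.
by rewrite ler_nat ltnW // h // ij ltn_ord.
Qed.

(** Frobenius's formula involves all n beads; those of the rows i >= k are unbounded in
    number. As they complete the holes to an interval ([perm_low_holes]), every product over
    them is a product over an interval, which is made of factorials, divided by a product over
    the l holes. *)
Theorem num_std_hook : (\sum_(i < n) la i <= n)%N ->
  (num_std (cells n la))%:R * ((\prod_(i < k) (A i)`!%:R) * (\prod_(j < l) (B j)`!%:R) *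
     \prod_(i < k) \prod_(j < l) (A i + B j + 1)%N%:R) =
  (\sum_(i < n) la i)%N`!%:R * (vander (fun i : 'I_k => (A i)%:R : R) *
     vander (fun j : 'I_l => (B j)%:R)).
Proof.
move=> sn.
rewrite -(disc_decr arm_mono) -(disc_decr leg_mono).
rewrite (prod_ord_iota k (fun i => (A i)`!%:R)) (prod_ord_iota l (fun i => (B i)`!%:R)).
rewrite (prod_ord_iota k (fun i => \prod_(j < l) (A i + B j + 1)%N%:R)).
under [X in _ * (_ * _ * X) = _]eq_bigr do
  rewrite (prod_ord_iota l (fun j => (A _ + B j + 1)%N%:R)).
pose L : R := \prod_(x <- low) x`!%:R.
pose H : R := \prod_(x <- holes) x`!%:R.
pose P : R := \prod_(x <- iota 0 c) x`!%:R.
pose D := disc (map rr low).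
pose U : R := \prod_(h <- holes) \prod_(x <- low) `|rr h - rr x|.
pose V : R := \prod_(i <- iota 0 k) \prod_(x <- low) (A i + c - x)%N%:R.
pose T : R := \prod_(i <- iota 0 k) (A i + c)`!%:R.
set f := (num_std _)%:R; set N := (_`!%:R : R).
set Af := \prod_(i <- iota 0 k) (A i)`!%:R; set Bf := \prod_(j <- iota 0 l) _.
set W := \prod_(i <- iota 0 k) \prod_(j <- _) _.
set dA := disc _; set E := disc _.
have splitn : iota 0 n = iota 0 k ++ iota k (n - k) by rewrite -{1}(subnKC kn) iotaD.
(* Frobenius's formula, split into the beads of the first k rows and the low ones. *)
have e1 : f * (T * L) = N * (dA * D * V).
  have := num_std_Frobenius R sla sn; rewrite -/f -/N.
  rewrite (prod_ord_iota n (fun i => (bead n la i)`!%:R)) -disc_decr; last first.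
    by move=> i j /andP[]; exact: (bead_lt sla).
  rewrite splitn big_cat map_cat disc_cat /=.
  have -> : \prod_(i <- iota 0 k) (bead n la i)`!%:R = T.
    by rewrite /T !big_seq; apply: eq_bigr => i; rewrite mem_iota => /= ik; rewrite bead_arm.
  have -> : \prod_(i <- iota k (n - k)) (bead n la i)`!%:R = L by rewrite /L big_map.
  have -> : [seq rr (bead n la i) | i <- iota k (n - k)] = map rr low by rewrite -map_comp.
  have -> : [seq rr (bead n la i) | i <- iota 0 k] =
     [seq x + rr c | x <- [seq rr (A i) | i <- iota 0 k]].
    rewrite -map_comp; apply/eq_in_map => i; rewrite mem_iota => /= ik.
    by rewrite bead_arm // /rr natrD.
  rewrite disc_shift => ->; congr (_ * (_ * _)).
  rewrite !big_map; apply: eq_bigr => i _; rewrite !big_map !big_seq; apply: eq_bigr => j.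
  rewrite mem_iota subnKC // => /andP[kj jn].
  have lj : (bead n la j <= A i + c)%N.
    by rewrite /bead /c; have := shape_mono sla kj; lia.
  by rewrite /rr -natrD -natrB // normr_nat.
have e2 : L * H = P.
  by rewrite /L /H /P -big_cat; apply: perm_big; exact: perm_low_holes.
have dE : disc (map rr holes) = E.
  rewrite /E -(disc_opp (rr c - 1)) -map_comp -map_comp; congr disc.
  apply/eq_in_map => j; rewrite mem_iota => /= jl; rewrite hole_leg //.
  by rewrite /rr natrB; [rewrite -natr1; ring | exact: leg_bound jl].
have e3 : D * E * U = P.
  rewrite /P -disc_iota -dE -(disc_perm (perm_map rr perm_low_holes)) map_cat disc_cat.
  congr (_ * _); rewrite /U exchange_big [RHS]big_map; apply: eq_bigr => x _.
  by rewrite [RHS]big_map; apply: eq_bigr => y _; rewrite distrC.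
(* For each hole, the distances to the low beads and to the other holes are
   together the distances to all other points of the interval. *)
have e4 : U * E ^+ 2 = H * Bf.
  have uh : uniq (map rr holes).
    rewrite map_inj_in_uniq ?uniq_holes // => x y _ _ /eqP.
    by rewrite eqr_nat => /eqP.
  rewrite -dE disc_sqr // big_map /U -big_split /=.
  have -> : Bf = \prod_(h <- holes) (c - h.+1)`!%:R.
    rewrite big_map [LHS]big_seq [RHS]big_seq; apply: eq_bigr => j; rewrite mem_iota => /= jl.
    by rewrite hole_leg //; congr (_`!%:R); have := leg_bound jl; lia.
  rewrite /H -big_split /= !big_seq; apply: eq_bigr => h hh.
  have hc : (h < c)%N.
    by move/mapP: hh => [j]; rewrite mem_iota => /= jl ->; exact: hole_bound.
  rewrite -prod_iota_dist // prod_low_holes; congr (_ * _).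
    rewrite [LHS]big_seq [RHS]big_seq_cond; apply: eq_bigl => x.
    case: (boolP (x \in low)) => //= xl; apply/esym/negP => /eqP xh; subst x.
    have := perm_uniq perm_low_holes.
    rewrite iota_uniq cat_uniq => /andP[_ /andP[/hasPn /(_ _ hh)]].
    by rewrite /= xl.
  rewrite big_map; apply: eq_bigl => x; by rewrite /rr eqr_nat.
have e5 : V * W * Af = T.
  rewrite /V /W /Af -big_split -big_split /=; apply: eq_bigr => i _.
  rewrite -prod_iota_fact; congr (_ * _).
  rewrite prod_low_holes; congr (_ * _).
  rewrite big_map [LHS]big_seq [RHS]big_seq; apply: eq_bigr => j; rewrite mem_iota => /= jl.
  by rewrite hole_leg //; congr (_%:R); have := leg_bound jl; lia.
have P0 : P != 0.
  by rewrite prodf_seq_neq0; apply/allP => x _; rewrite /= pnatr_eq0 -lt0n fact_gt0.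
have V0 : V != 0.
  rewrite prodf_seq_neq0; apply/allP => i _ /=; rewrite prodf_seq_neq0.
  apply/allP => x /mapP[j]; rewrite mem_iota subnKC // => /andP[kj jn] -> /=.
  rewrite pnatr_eq0 /bead /c; have := shape_mono sla kj; lia.
apply: (mulfI V0); apply: (mulfI P0).
transitivity (f * (T * L) * H * Bf); first by rewrite -e2 -e5; ring.
rewrite e1; transitivity (N * dA * D * V * (H * Bf)); first by ring.
by rewrite -e4 -e3; ring.
Qed.
End BeadsAndHoles.

(** * Partitions in a hook and their arms and legs *)

Section IntPart.
Local Open Scope nat_scope.

(** In a decreasing list the entries exceeding j form an initial segment. *)
Lemma count_sorted (s : seq nat) i j : sorted geq s ->
  (i < count (fun m => j < m) s) = (j < nth 0 s i).
Proof.
elim: s i => [|a s IH] i /= srt; first by rewrite nth_nil.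
have sa : all (fun m => m <= a) s.
  by apply: (order_path_min (leT := geq)) => // x y z; rewrite /geq /= => h1 h2; exact: leq_trans h2 h1.
have ss := path_sorted srt.
case: (ltnP j a) => ja; first by case: i => [//|i]; rewrite add1n ltnS IH.
have -> : count (fun m => j < m) s = 0.
  apply/eqP; rewrite -leqn0 leqNgt -has_count; apply/hasPn => m /(allP sa) ma.
  by rewrite -leqNgt (leq_trans ma ja).
case: i => [|i] /=; first by rewrite (ltnNge j a) ja.
apply/esym/negbTE; rewrite -leqNgt; have [/(mem_nth 0) /(allP sa) h|h] := ltnP i (size s).
  exact: leq_trans h ja.
by rewrite nth_default.
Qed.

Section Facts.
Variables (n : nat) (la : intpart n).

Lemma part_default i : n <= i -> part la i = 0.
Proof. by move=> ni; rewrite /part nth_default // size_map size_tuple. Qed.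

Lemma sum_part : \sum_(i < n) part la i = n.
Proof.
have /andP[_ /eqP h] := valP la; rewrite -[RHS]h sumnE.
rewrite (big_nth 0) size_map size_tuple big_mkord //.
Qed.

Lemma part_le0 : part la 0 <= n.
Proof.
have [n0|n0] := ltnP 0 n; last by rewrite part_default.
rewrite /part (nth_map (Ordinal (ltn0Sn n))) ?size_tuple //.
exact: leq_ord.
Qed.

Lemma part_shape : is_shape n (part la).
Proof.
split; [move=> i|exact: part_default|exact: part_le0].
have /andP[srt _] := valP la.
have [h|h] := ltnP i.+1 n; last by rewrite (part_default h).
apply: (sorted_ltn_nth (leT := geq)) => //; rewrite ?inE ?size_map ?size_tuple //.
- by move=> x y z h1 h2; exact: leq_trans h2 h1.
- exact: ltnW.
Qed.

Lemma conj_partP i j : (i < conj_part la j) = (j < part la i).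
Proof. by apply: count_sorted; have /andP[] := valP la. Qed.

Lemma num_SYT_std : num_SYT la = num_std (cells n (part la)).
Proof.
apply: eq_card => t; rewrite [RHS]inE [LHS]asboolb /is_SYT /is_std.
have -> : diagram la = cells n (part la) by [].
have -> : [forall c, t c <= #|cells n (part la)|].
  by apply/fintype.forallP => c; rewrite card_cells ?sum_part -1?ltnS //; exact: part_shape.
rewrite andbT; congr (_ && (_ && _)).
apply/andP/idP => [[/forall_inP h1 /forall_inP h2]|/forall_inP h].
  apply/forall_inP => c cD; apply/forall_inP => d dD; apply/implyP => /orP[] h.
    by move: (h1 _ cD) => /forall_inP/(_ _ dD)/implyP; apply.
  by move: (h2 _ cD) => /forall_inP/(_ _ dD)/implyP; apply.
by split; apply/forall_inP => c cD; apply/forall_inP => d dD; apply/implyP => e;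
  move: (h _ cD) => /forall_inP/(_ _ dD)/implyP; apply; rewrite /cell_lt e ?orbT.
Qed.

End Facts.

Lemma intpart_eq n (la mu : intpart n) : part la =1 part mu -> la = mu.
Proof.
move=> h; do 2 apply: val_inj; apply: (inj_map val_inj).
by apply: (@eq_from_nth _ 0); rewrite ?size_map ?size_tuple // => i _; exact: h.
Qed.

Lemma shape_intpart n (f : nat -> nat) : is_shape n f -> \sum_(i < n) f i = n ->
  exists la : intpart n, part la =1 f.
Proof.
move=> sf fn; pose s := [tuple (inord (f i) : 'I_n.+1) | i < n].
have es : map val s = [seq f i | i <- iota 0 n].
  rewrite -val_enum_ord -!map_comp; apply/eq_map => i /=.
  by rewrite inordK // ltnS; exact: shape_le.
have hs : sorted geq (map val s) && (sumn (map val s) == n).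
  rewrite es sumnE big_map -{3}fn; apply/andP; split.
    rewrite sorted_map; apply: sub_sorted (iota_sorted 0 n) => i j ij.
    exact: shape_mono sf ij.
  by rewrite -(big_mkord xpredT) /index_iota subn0.
exists (Sub s hs : intpart n) => i; rewrite /part /= es.
have [h|h] := ltnP i n; first by rewrite (nth_map 0) ?size_iota // nth_iota.
rewrite nth_default ?size_map ?size_iota //; apply/esym/eqP.
by case: (sf) => _ f0 _; rewrite -leqn0 -f0 (shape_mono sf h).
Qed.

(** The diagram contains the k x l rectangle; for k = 0 this holds trivially. *)
Definition is_rect k l n (la : intpart n) := (k == 0) || (l <= part la k.-1).

(** The excess of a row over the rectangle, spread out by a staircase to be strictly
    decreasing in i; [leg] is the same for columns. *)
Definition arm k l n (la : intpart n) i := part la i - l + (k - i.+1).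
Definition leg k l n (la : intpart n) j := conj_part la j - k + (l - j.+1).

Section Hook.
Variables (n k l : nat) (la : intpart n).
Hypothesis kn : k <= n.
Hypothesis rect : is_rect k l la.
Hypothesis hook : la \in hook n k l.

Lemma rectP i : i < k -> l <= part la i.
Proof.
clear kn hook; move=> ik; case/orP: rect => [/eqP k0|h]; first by rewrite k0 in ik.
by apply: leq_trans h _; apply: shape_mono (part_shape la) _; lia.
Qed.

Lemma hookP : part la k <= l. Proof. by move: hook; rewrite inE. Qed.

Lemma num_SYT_hook (R : realFieldType) : ((num_SYT la)%:R *
   ((\prod_(i < k) (arm k l la i)`!%:R) * (\prod_(j < l) (leg k l la j)`!%:R) *
     \prod_(i < k) \prod_(j < l) (arm k l la i + leg k l la j + 1)%N%:R) =
  n`!%:R * (vander (fun i : 'I_k => (arm k l la i)%:R : R) *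
     vander (fun j : 'I_l => (leg k l la j)%:R)))%R.
Proof.
rewrite num_SYT_std; have := num_std_hook R (part_shape la) (conj_partP la) kn rectP hookP.
by rewrite sum_part; apply.
Qed.

(** Rows below the rectangle consist of cells in the first l columns only. *)
Lemma part_hook i : k <= i -> part la i = \sum_(j < l) (i < conj_part la j).
Proof.
move=> ki; have pl : part la i <= l.
  exact: leq_trans (shape_mono (part_shape la) ki) hookP.
under eq_bigr do rewrite conj_partP.
transitivity (\sum_(j < l | j < part la i) 1).
  by rewrite (big_ord_narrow pl) sum1_card card_ord.
by rewrite big_mkcond; apply: eq_bigr => j _; case: ifP.
Qed.

Lemma conj_ge j : j < l -> k <= conj_part la j.
Proof. exact: (cj_ge (conj_partP la) rectP). Qed.

Lemma conj_le j : conj_part la j <= n.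
Proof. exact: (cj_le (part_shape la) (conj_partP la)). Qed.

Lemma sum_arm_leg : \sum_(i < k) arm k l la i + \sum_(j < l) leg k l la j + k * l =
  n + \sum_(i < k) i + \sum_(j < l) j.
Proof.
have e1 : \sum_(i < k) arm k l la i + k * l = \sum_(i < k) part la i + \sum_(i < k) i.
  rewrite [X in _ = _ + X](reindex_inj rev_ord_inj) -big_split /= -[k in k * l]card_ord.
  rewrite -sum_nat_const -big_split /=; apply: eq_bigr => i _; rewrite /arm.
  by have := @rectP i (ltn_ord i); lia.
have e2 : \sum_(j < l) leg k l la j = \sum_(j < l) (conj_part la j - k) + \sum_(j < l) j.
  by rewrite [X in _ = _ + X](reindex_inj rev_ord_inj) -big_split.
have e3 : \sum_(j < l) (conj_part la j - k) = \sum_(k <= i < n) part la i.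
  transitivity (\sum_(k <= i < n) \sum_(j < l) (i < conj_part la j)); last first.
    by rewrite !big_nat; apply: eq_bigr => i /andP[ki _]; rewrite part_hook.
  rewrite exchange_big /=; apply: eq_bigr => j _.
  rewrite (@big_cat_nat _ _ _ (conj_part la j)) ?conj_ge ?conj_le //=.
  rewrite big_nat [X in _ = X + _](eq_bigr (fun=> 1)); last by move=> i /andP[_ ->].
  rewrite -big_nat sum_nat_const_nat muln1 big_nat big1 ?addn0 // => i /andP[h _].
  by rewrite ltnNge h.
have e4 : \sum_(i < n) part la i = \sum_(i < k) part la i + \sum_(k <= i < n) part la i.
  by rewrite -!(big_mkord xpredT) -big_cat_nat.
by have := sum_part la; lia.
Qed.

End Hook.

Lemma conj_part_eq n (la : intpart n) j c :
  (forall i, (i < c) = (j < part la i)) -> conj_part la j = c.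
Proof.
move=> h; case: (ltngtP (conj_part la j) c) => // hc.
  by have := h (conj_part la j); rewrite hc -conj_partP ltnn.
by have := h c; rewrite -conj_partP hc ltnn.
Qed.

(** Below row k a partition of the hook is read off from its first l columns. *)
Lemma hook_inj n k l (la mu : intpart n) : la \in hook n k l -> mu \in hook n k l ->
  (forall i, i < k -> part la i = part mu i) ->
  (forall j, j < l -> conj_part la j = conj_part mu j) -> la = mu.
Proof.
move=> hla hmu hp hc; apply: intpart_eq => i.
have [ik|ki] := ltnP i k; first exact: hp.
rewrite (part_hook hla ki) (part_hook hmu ki).
by apply: eq_bigr => j _; rewrite hc.
Qed.

(** Peel off one row and one column at a time: if the corner of the rectangle is missing
    then the partition already lies in the next smaller hook. *)
Lemma hook_defect n k l (la : intpart n) : la \in hook n k l ->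
  exists d, [/\ d <= k, d <= l, la \in hook n (k - d) (l - d) & is_rect (k - d) (l - d) la].
Proof.
elim: k l => [|k IH] l h; first by exists 0; rewrite !subn0; split.
have [r|] := boolP (is_rect k.+1 l la); first by exists 0; rewrite !subn0; split.
rewrite /is_rect /= -ltnNge => hl.
case: l h hl => // l h hl.
have : la \in hook n k l by rewrite inE.
by move=> /IH[d [dk dl h1 h2]]; exists d.+1; rewrite !subSS; split.
Qed.

(** The arms prescribe the first k rows and the legs the first l columns. Strict decrease
    makes the resulting rows weakly decreasing, with room for the rectangle, and the condition
    on the sum says that the size is n. *)
Lemma hook_surj n k l (a b : nat -> nat) :
  (forall i j, i < j < k -> a j < a i) -> (forall i j, i < j < l -> b j < b i) ->
  \sum_(i < k) a i + \sum_(j < l) b j + k * l = n + \sum_(i < k) i + \sum_(j < l) j ->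
  exists la : intpart n, [/\ la \in hook n k l, is_rect k l la,
    forall i, i < k -> arm k l la i = a i & forall j, j < l -> leg k l la j = b j].
Proof.
move=> ha hb hs.
(* Strictly decreasing integers drop by at least one at each step. *)
have gap m (f : nat -> nat) : (forall i j, i < j < m -> f j < f i) ->
    forall i j, i <= j < m -> f j + (j - i) <= f i.
  move=> hf i; elim=> [|j IHj]; first by rewrite leqn0 => /andP[/eqP -> _]; lia.
  rewrite leq_eqVlt => /andP[/orP[/eqP ->|ij] jm]; first by rewrite subnn addn0.
  have := hf j j.+1; rewrite ltnSn jm => /(_ isT).
  by have := IHj; rewrite (ltnW jm) -ltnS ij => /(_ isT); lia.
have low m (f : nat -> nat) : (forall i j, i < j < m -> f j < f i) ->
    forall i, i < m -> m - i.+1 <= f i.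
  by move=> hf i im; have := gap _ _ hf i m.-1; lia.
have {}la_low := low _ _ ha; have {}lb_low := low _ _ hb.
(* The column lengths; the rows from k on are then counted off the columns. *)
pose c j := b j + k + j.+1 - l.
have cmono i j : i < j < l -> c j <= c i.
  by move=> h; have := gap _ _ hb i j; rewrite /c; lia.
have srt : sorted geq [seq c j | j <- iota 0 l].
  apply/(sortedP 0) => i; rewrite size_map size_iota => il.
  rewrite !(nth_map 0) ?size_iota //; last exact: ltnW.
  by rewrite !nth_iota //; [apply: cmono; lia | lia].
pose f i := if i < k then a i + l + i.+1 - k else count (fun m => i < m) [seq c j | j <- iota 0 l].
have fc i j : k <= i -> (j < f i) = (j < l) && (i < c j).
  move=> ki; rewrite /f (ltnNge i k) ki /= count_sorted //.
  have [jl|jl] := ltnP j l; first by rewrite (nth_map 0) ?size_iota // nth_iota.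
  by rewrite nth_default ?size_map ?size_iota.
have fl i : k <= i -> f i <= l.
  by move=> ki; rewrite leqNgt fc // ltnn.
have fk i : i < k -> l <= f i.
  by move=> ik; rewrite /f ik; have := la_low _ ik; lia.
have f1 i : f i.+1 <= f i.
  have [ik|ki] := ltnP i.+1 k.
    by rewrite /f ik (ltnW ik); have := ha i i.+1; have := la_low _ ik; lia.
  have [ik|ki'] := ltnP i k; first exact: leq_trans (fl _ ki) (fk _ ik).
  rewrite leqNgt; apply/negP => h.
  have := fc _ (f i) ki; rewrite h => /esym/andP[h1 h2].
  by have := fc _ (f i) ki'; rewrite ltnn h1 (ltnW h2).
have fmono i j : i <= j -> f j <= f i.
  by apply: (homo_leq (r := fun x y => y <= x)) => // x y z h1 h2; exact: leq_trans h2 h1.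
(* A bound on all columns, large enough that f vanishes from N on; that f
   already vanishes from n on is known only once its sum is. *)
pose N := k + (n + c 0).+1.
have cN j : j < l -> c j <= N.
  move=> jl; rewrite /N; case: j jl => [|j] jl; first lia.
  by have := cmono 0 j.+1; lia.
have kc j : j < l -> k <= c j.
  by move=> jl; have := lb_low _ jl; rewrite /c; lia.
have fN i : N <= i -> f i = 0.
  move=> Ni; apply/eqP; rewrite -leqn0 leqNgt fc; last by move: Ni; rewrite /N; lia.
  by apply/negP => /andP[h]; have := cN _ h; lia.
have sN : \sum_(0 <= i < N) f i = n.
  rewrite (@big_cat_nat _ _ _ k) //=; last by rewrite /N; lia.
  have e1 : \sum_(0 <= i < k) f i + \sum_(i < k) i = \sum_(i < k) a i + k * l.
    rewrite big_mkord [X in _ + X = _](reindex_inj rev_ord_inj) -big_split /= -[k in k * l]card_ord.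
    rewrite -sum_nat_const -big_split /=; apply: eq_bigr => i _; rewrite /f ltn_ord.
    by have := la_low _ (ltn_ord i); have := ltn_ord i; lia.
  have e2 : \sum_(k <= i < N) f i = \sum_(j < l) (c j - k).
    transitivity (\sum_(k <= i < N) \sum_(j < l) (i < c j)).
      rewrite !big_nat; apply: eq_bigr => i /andP[ki _]; rewrite /f (ltnNge i k) ki /=.
      rewrite -sum1_count big_map -(big_mkord xpredT (fun j => nat_of_bool (i < c j))).
      by rewrite /index_iota subn0 big_mkcond.
    rewrite exchange_big /=; apply: eq_bigr => j _.
    rewrite (@big_cat_nat _ _ _ (c j)) ?kc ?cN //=.
    rewrite big_nat [X in X + _ = _](eq_bigr (fun=> 1)); last by move=> i /andP[_ ->].
    rewrite -big_nat sum_nat_const_nat muln1 big_nat big1 ?addn0 // => i /andP[h _].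
    by rewrite ltnNge h.
  have e3 : \sum_(j < l) (c j - k) + \sum_(j < l) j = \sum_(j < l) b j.
    rewrite [X in _ + X = _](reindex_inj rev_ord_inj) -big_split /=.
    apply: eq_bigr => j _; rewrite /c; have := lb_low _ (ltn_ord j); have := ltn_ord j.
    by lia.
  lia.
have fn : f n = 0.
  apply/eqP; rewrite -leqn0 leqNgt; apply/negP => h.
  have nN : n < N by rewrite /N; lia.
  have : \sum_(0 <= i < n.+1) 1 <= \sum_(0 <= i < N) f i.
    rewrite [X in _ <= X](@big_cat_nat _ _ _ n.+1) //= -[X in X <= _]addn0; apply: leq_add => //.
    rewrite big_nat [X in _ <= X]big_nat; apply: leq_sum => i /andP[_ ik].
    by apply: leq_trans h _; apply: fmono.
  by rewrite sN sum_nat_const_nat muln1 subn0 ltnn.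
have f0 : f 0 <= n by rewrite -[X in _ <= X]sN /N addnS big_nat_recl //= leq_addr.
have sf : is_shape n f by split.
have sfn : \sum_(i < n) f i = n.
  rewrite -[RHS]sN (@big_cat_nat _ _ _ n) //=; last by rewrite /N; lia.
  rewrite big_mkord [X in _ = _ + X]big_nat [X in _ = _ + X]big1 ?addn0 // => i /andP[h _].
  by apply/eqP; rewrite -leqn0 -fn fmono.
have [la hla] := shape_intpart sf sfn.
exists la; split.
- by rewrite inE hla fl.
- by rewrite /is_rect; case: (k) fk => //= k' fk; rewrite hla fk.
- move=> i ik; rewrite /arm hla /f ik; have := la_low _ ik; lia.
- move=> j jl; rewrite /leg (@conj_part_eq _ _ _ (c j)).
    by rewrite /c; have := lb_low _ jl; lia.
  move=> i; rewrite hla; have [ki|ik] := leqP k i; first by rewrite fc // jl.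
  by rewrite (leq_trans ik (kc _ jl)) (leq_trans jl (fk _ ik)).
Qed.

End IntPart.

Local Open Scope classical_set_scope.
Local Open Scope ring_scope.

(** * A discrete Gaussian *)

Section Phi.
Variable R : realType.
Implicit Types (M d : nat) (z : int).

(** M! M^z / (M + z)!, extended by zero to the z for which M + z is negative. As a function
    of z it is a Poisson density of mean M, scaled to be 1 at 0, so it looks like
    exp (- z^2 / (2 M)). *)
Definition phi M z : R :=
  if 0 <= M%:Z + z then M`!%:R * M%:R ^ z / (absz (M%:Z + z))`!%:R else 0.

Lemma phi_ge0 M z : 0 <= phi M z.
Proof.
rewrite /phi; case: ifP => // _.
by rewrite divr_ge0 ?mulr_ge0 ?exprz_ge0 ?ler0n.
Qed.

Lemma phi_fact M (a : nat) : (0 < M)%N ->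
  phi M (a%:Z - M%:Z) * a`!%:R = M`!%:R * M%:R ^ (a%:Z - M%:Z).
Proof.
move=> M0; rewrite /phi addrC subrK /= divfK // pnatr_eq0 -lt0n fact_gt0 //.
Qed.

Lemma phi0 M : phi M 0 = 1.
Proof. by rewrite /phi addr0 /= expr0z mulr1 divff // pnatr_eq0 -lt0n fact_gt0. Qed.

Lemma phi_posS M d : (0 < M)%N ->
  phi M d.+1%:Z = phi M d%:Z * (M%:R / (M + d.+1)%:R).
Proof.
move=> M0; rewrite /phi -!PoszD /= addnS factS natrM invfM.
rewrite -[in LHS]addn1 PoszD expfzDr ?pnatr_eq0 -?lt0n // expr1z.
ring.
Qed.

Lemma phi_negS M d : (0 < M)%N -> (d < M)%N ->
  phi M (- d.+1%:Z) = phi M (- d%:Z) * (1 - d%:R / M%:R).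
Proof.
move=> M0 dM; rewrite /phi.
have e1 : M%:Z - d.+1%:Z = (M - d.+1)%N%:Z by lia.
have e2 : M%:Z - d%:Z = (M - d)%N%:Z by lia.
rewrite e1 e2 /=.
have -> : (M - d = (M - d.+1).+1)%N by lia.
have Mr0 : M%:R != 0 :> R by rewrite pnatr_eq0 -lt0n.
have -> : 1 - d%:R / M%:R = (M - d.+1).+1%:R / M%:R :> R.
  have -> : (M - d.+1).+1%:R = M%:R - d%:R :> R by rewrite -natrB; [congr (_%:R); lia | lia].
  by rewrite mulrBl divff.
rewrite factS natrM invfM.
have -> : - d.+1%:Z = - d%:Z - 1 by lia.
rewrite expfzDr // exprN1.
set q := (M - d.+1).+1%:R.
have q0 : q != 0 :> R by rewrite pnatr_eq0.
have f0 : (M - d.+1)`!%:R != 0 :> R by rewrite pnatr_eq0 -lt0n fact_gt0.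
by field; do ?[apply/andP; split => //].
Qed.

(** The quotient of consecutive values is 1 - (d + 1) / (M + d + 1), at most
    exp (- (d + 1) / (M + D)); multiply these up. *)
Lemma phi_pos_upper M d D : (0 < M)%N -> (d <= D)%N ->
  phi M d%:Z <= expR (- ((d%:R ^+ 2 + d%:R) / (2 * (M + D)%:R))).
Proof.
move=> M0; elim: d => [|d IH] dD.
  by rewrite phi0 expr0n /= addr0 mul0r oppr0 expR0.
have MD0 : 0 < (M + D)%:R :> R by rewrite ltr0n addn_gt0 M0.
have Md0 : 0 < (M + d.+1)%:R :> R by rewrite ltr0n addn_gt0 M0.
rewrite phi_posS //.
have -> : - ((d.+1%:R ^+ 2 + d.+1%:R) / (2 * (M + D)%:R)) =
   - ((d%:R ^+ 2 + d%:R) / (2 * (M + D)%:R)) + - (d.+1%:R / (M + D)%:R) :> R.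
  by rewrite -natr1; field; rewrite -natrD gt_eqF.
rewrite expRD; apply: ler_pM; [exact: phi_ge0|by rewrite divr_ge0|exact/IH/ltnW|].
apply: (@le_trans _ _ (1 - d.+1%:R / (M + d.+1)%:R)).
  have -> // : M%:R / (M + d.+1)%:R = 1 - d.+1%:R / (M + d.+1)%:R :> R.
  apply: (mulIf (lt0r_neq0 Md0)); rewrite mulrBl mul1r !divfK ?gt_eqF //.
  by rewrite natrD addrK.
apply: (@le_trans _ _ (1 - d.+1%:R / (M + D)%:R)).
  rewrite lerD2l lerN2 ler_pM2l ?ltr0n // lef_pV2 ?posrE // ler_nat leq_add2l //.
exact: expR_ge1Dx.
Qed.

(** The quotient M / (M + d + 1) is at least exp (- (d + 1) / M). *)
Lemma phi_pos_lower M d : (0 < M)%N ->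
  expR (- ((d%:R ^+ 2 + d%:R) / (2 * M%:R))) <= phi M d%:Z.
Proof.
move=> M0; have Mr : 0 < M%:R :> R by rewrite ltr0n.
elim: d => [|d IH].
  by rewrite phi0 expr0n /= addr0 mul0r oppr0 expR0.
have Md0 : 0 < (M + d.+1)%:R :> R by rewrite ltr0n addn_gt0 M0.
rewrite phi_posS //.
have -> : - ((d.+1%:R ^+ 2 + d.+1%:R) / (2 * M%:R)) =
   - ((d%:R ^+ 2 + d%:R) / (2 * M%:R)) + - (d.+1%:R / M%:R) :> R.
  by rewrite -natr1; field; rewrite gt_eqF.
rewrite expRD; apply: ler_pM => //; try exact: expR_ge0.
rewrite expRN -[M%:R / (M + _)%:R]invf_div lef_pV2 ?posrE ?expR_gt0 ?divr_gt0 //.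
apply: le_trans (expR_ge1Dx _).
by rewrite natrD mulrDl divff ?gt_eqF.
Qed.

(** Now the quotient of consecutive values is 1 - d / M. *)
Lemma phi_neg_upper M d : (0 < M)%N -> (d <= M)%N ->
  phi M (- d%:Z) <= expR (- ((d%:R ^+ 2 - d%:R) / (2 * M%:R))).
Proof.
move=> M0; have Mr : 0 < M%:R :> R by rewrite ltr0n.
elim: d => [|d IH] dM.
  by rewrite oppr0 phi0 expr0n /= subr0 mul0r oppr0 expR0.
rewrite phi_negS //.
have -> : - ((d.+1%:R ^+ 2 - d.+1%:R) / (2 * M%:R)) =
   - ((d%:R ^+ 2 - d%:R) / (2 * M%:R)) + - (d%:R / M%:R) :> R.
  by rewrite -natr1; field; rewrite gt_eqF.
rewrite expRD; apply: ler_pM => //.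
- exact: phi_ge0.
- by rewrite subr_ge0 ler_pdivrMr // mul1r ler_nat ltnW.
- exact/IH/ltnW.
- exact: expR_ge1Dx.
Qed.

(** The inverse quotient is 1 + d / (M - d), at most exp (d / (M - D)). *)
Lemma phi_neg_lower M d D : (0 < M)%N -> (d <= D)%N -> (D < M)%N ->
  expR (- ((d%:R ^+ 2 - d%:R) / (2 * (M%:R - D%:R)))) <= phi M (- d%:Z).
Proof.
move=> M0 + DM; have Mr : 0 < M%:R :> R by rewrite ltr0n.
have MD : 0 < M%:R - D%:R :> R by rewrite subr_gt0 ltr_nat.
elim: d => [|d IH] dD.
  by rewrite expr0n /= subr0 mul0r !oppr0 expR0 phi0.
have dM : (d < M)%N by lia.
have Md : 0 < M%:R - d%:R :> R by rewrite subr_gt0 ltr_nat.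
rewrite phi_negS //.
have -> : - ((d.+1%:R ^+ 2 - d.+1%:R) / (2 * (M%:R - D%:R))) =
   - ((d%:R ^+ 2 - d%:R) / (2 * (M%:R - D%:R))) + - (d%:R / (M%:R - D%:R)) :> R.
  by rewrite -natr1; field; rewrite gt_eqF.
rewrite expRD; apply: ler_pM => //; try exact: expR_ge0; first exact/IH/ltnW.
have -> : 1 - d%:R / M%:R = (M%:R / (M%:R - d%:R))^-1 :> R.
  by rewrite invf_div mulrBl divff // gt_eqF.
rewrite expRN lef_pV2 ?posrE ?expR_gt0 ?divr_gt0 //.
apply: (@le_trans _ _ (1 + d%:R / (M%:R - d%:R))).
  rewrite -[X in _ <= X + _](@divff _ (M%:R - d%:R)) ?gt_eqF // -mulrDl subrK //.
apply: le_trans (expR_ge1Dx _) _; rewrite ler_expR ler_wpM2l // lef_pV2 ?posrE //.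
by rewrite lerD2l lerN2 ler_nat ltnW.
Qed.

Local Notation az z := (`|z%:~R : R|).

(** A form of the bound for both signs, strong enough to dominate for all z and exact
    enough for the limit when z is of order sqrt M. *)
Lemma phi_upper M z : (0 < M)%N ->
  phi M z <= expR (- ((az z ^+ 2 - az z) / (2 * (M%:R + az z)))).
Proof.
move=> M0; have Mr : 0 < M%:R :> R by rewrite ltr0n.
have sq d : 0 <= d%:R ^+ 2 - d%:R :> R.
  rewrite subr_ge0 -natrX ler_nat; case: d => // d; rewrite expnS expn1; lia.
have [d [->|->]] : exists d : nat, z = d%:Z \/ z = - d%:Z.
  by exists (absz z); lia.
- rewrite normr_nat; apply: le_trans (phi_pos_upper M0 (leqnn d)) _.
  rewrite natrD ler_expR lerN2 ler_wpM2r ?invr_ge0 ?mulr_ge0 ?addr_ge0 ?ler0n //.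
  by have := ler0n R d; lra.
- rewrite rmorphN normrN normr_nat.
  have [dM|Md] := leqP d M.
    apply: le_trans (phi_neg_upper M0 dM) _; rewrite ler_expR lerN2.
    have Md0 : 0 < M%:R + d%:R :> R by rewrite ltr_wpDr.
    apply: ler_wpM2l => //; rewrite lef_pV2 ?posrE ?mulr_gt0 //.
    by rewrite ler_pM2l // lerDl.
  have -> : phi M (- d%:Z) = 0.
    by rewrite /phi; case: ifP => // h; exfalso; lia.
  exact: expR_ge0.
Qed.

Lemma phi_lower M z : (absz z < M)%N ->
  expR (- ((az z ^+ 2 + az z) / (2 * (M%:R - az z)))) <= phi M z.
Proof.
move=> zM; have M0 : (0 < M)%N by lia.
have Mr : 0 < M%:R :> R by rewrite ltr0n.
have [d [zd|zd]] : exists d : nat, z = d%:Z \/ z = - d%:Z.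
  by exists (absz z); lia.
- rewrite zd normr_nat; apply: le_trans (phi_pos_lower d M0).
  have dM : d%:R < M%:R :> R by rewrite ltr_nat; lia.
  rewrite ler_expR lerN2 ler_wpM2l ?addr_ge0 ?exprn_ge0 ?ler0n //.
  by rewrite lef_pV2 ?posrE ?mulr_gt0 ?subr_gt0 // ler_pM2l // lerBlDr lerDl.
- have dM : (d < M)%N by lia.
  rewrite zd rmorphN normrN normr_nat; apply: le_trans (phi_neg_lower M0 (leqnn d) dM).
  rewrite ler_expR lerN2 ler_wpM2r ?invr_ge0 ?mulr_ge0 ?subr_ge0 ?ler_nat 1?ltnW //.
  by have := ler0n R d; lra.
Qed.

Lemma phi_le1 M z : (0 < M)%N -> phi M z <= 1.
Proof.
move=> M0; apply: le_trans (phi_upper z M0) _.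
have -> : az z = (absz z)%:R by rewrite natr_absz intr_norm.
rewrite -[X in _ <= X]expR0 ler_expR oppr_le0 divr_ge0 //.
rewrite subr_ge0 -natrX ler_nat; case: (absz z) => // d; rewrite expnS expn1; lia.
Qed.

End Phi.

(** * Integrals over products of lines *)

Section ProductIntegral.
Variables (d1 d2 : measure_display) (T1 : measurableType d1) (T2 : measurableType d2).
Variables (R : realType).
Variables (m1 : {sigma_finite_measure set T1 -> \bar R}).
Variables (m2 : {sigma_finite_measure set T2 -> \bar R}).
Variables (f : T1 -> R) (g : T2 -> R).
Hypothesis intf : m1.-integrable setT (EFin \o f).
Hypothesis intg : m2.-integrable setT (EFin \o g).

Let mf : measurable_fun setT f.
Proof. exact/measurable_EFinP/(measurable_int _ intf). Qed.

Let mg : measurable_fun setT g.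
Proof. exact/measurable_EFinP/(measurable_int _ intg). Qed.

Lemma measurable_prodf : measurable_fun setT (fun z : T1 * T2 => f z.1 * g z.2).
Proof.
by apply: measurable_funM; apply: measurableT_comp.
Qed.

Lemma integrable_prodf :
  (m1 \x m2)%E.-integrable setT (fun z : T1 * T2 => (f z.1 * g z.2)%:E).
Proof.
apply/(integrable12ltyP m1 m2); first by apply/measurable_EFinP; exact: measurable_prodf.
have h x : (\int[m2]_y `|(f x * g y)%:E| = `|f x|%:E * \int[m2]_y `|(g y)%:E|)%E.
  rewrite -ge0_integralZl ?lee_fin //; last first.
    by apply: measurableT_comp => //; exact: measurable_int intg.
  by apply: eq_integral => y _; rewrite -abse_EFin EFinM abseM.
under eq_integral do rewrite h.
have /integrableP[_ gfin] := intg.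
have -> : (\int[m2]_y `|(g y)%:E|)%E = (fine (\int[m2]_y `|(g y)%:E|)%E)%:E.
  by rewrite fineK // ge0_fin_numE ?integral_ge0.
rewrite ge0_integralZr ?lee_fin ?fine_ge0 ?integral_ge0 //; last first.
  by apply/measurable_EFinP; exact: measurableT_comp.
have /integrableP[_ ffin] := intf.
by rewrite muleC lte_mul_pinfty ?lee_fin ?fine_ge0 ?integral_ge0.
Qed.

Lemma integral_prodf :
  \int[(m1 \x m2)%E]_z (f z.1 * g z.2) = (\int[m1]_x f x) * (\int[m2]_y g y).
Proof.
rewrite /Rintegral -(integral12_prod_meas1 integrable_prodf) /fubini_F /=.
under eq_integral do under eq_integral do rewrite EFinM.
under eq_integral do rewrite integralZl //.
have ig := integrable_fin_num measurableT intg.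
have jf := integrable_fin_num measurableT intf.
rewrite -[in LHS](fineK ig) integralZr // fineM //.
Qed.

End ProductIntegral.

Section TupleMeasure.
Variable R : realType.
Local Notation T := (measurableTypeR R).
Local Notation mu := (tuple_lebesgue R).
Local Notation leb := (@lebesgue_measure R).

Lemma tnth_uncons r (x : r.+1.-tuple T) (i : 'I_r) :
  tnth (uncons x).2 i = tnth x (lift ord0 i).
Proof. by rewrite !(tnth_nth (thead x)) /= nth_behead. Qed.

(** The measure on tuples is the image of a product, so integrating over it splits off the
    first coordinate. *)
Lemma integrable_uncons r (F : T * r.-tuple T -> R) :
  (leb \x mu r)%E.-integrable setT (EFin \o F) ->
  (mu r.+1).-integrable setT (fun x => (F (@uncons R r x))%:E).
Proof.
move=> iF; have mF := measurable_int _ iF.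
apply: (@integrable_pushforward _ _ _ _ _ _ (@measurable_cons_pair R r) (leb \x mu r)%E).
- exact: (measurableT_comp mF (@measurable_uncons R r)).
- rewrite preimage_setT (_ : _ \o _ = EFin \o F) //.
  by apply/funext => z /=; rewrite cons_pairK.
- exact: measurableT.
Qed.

Lemma integral_uncons r (F : T * r.-tuple T -> R) :
  (leb \x mu r)%E.-integrable setT (EFin \o F) ->
  \int[mu r.+1]_x F (@uncons R r x) = \int[(leb \x mu r)%E]_z F z.
Proof.
move=> iF; have mF := measurable_int _ iF.
rewrite /Rintegral; congr fine.
rewrite (@integral_pushforward _ _ _ _ _ _ (@measurable_cons_pair R r) (leb \x mu r)%E) //.
- by rewrite preimage_setT; apply: eq_integral => z _ /=; rewrite cons_pairK.
- exact: (measurableT_comp mF (@measurable_uncons R r)).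
- rewrite preimage_setT (_ : _ \o _ = EFin \o F) //.
  by apply/funext => z /=; rewrite cons_pairK.
Qed.

Lemma integrable_prod_tuple r (g : R -> R) : leb.-integrable setT (EFin \o g) ->
  (mu r).-integrable setT (fun x => (\prod_(i < r) g (tnth x i))%:E).
Proof.
move=> ig; elim: r => [|r IH].
  rewrite (_ : (fun _ => _) = cst 1%E); last first.
    by apply/funext => x /=; rewrite big_ord0.
  apply/integrableP; split; first exact: measurable_cst.
  under eq_integral do rewrite /= normr1.
  by rewrite integral_cst // mul1e /= diracE mem_set // ltry.
have := integrable_uncons (integrable_prodf ig IH).
congr (integrable _ _ _); apply/funext => x /=.
rewrite big_ord_recl; congr ((_ * _)%:E).
by apply: eq_bigr => i _; rewrite tnth_uncons.
Qed.

(** The points that an affine map followed by rounding down sends to a given lattice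
    point; a cube of side 1 / s. *)
Definition cube r (a s : R) (z : 'I_r -> int) : set (r.-tuple T) :=
  [set x | forall j, Num.floor (a + s * tnth x j) = z j].

Lemma floor_interval (a s : R) (z : int) : 0 < s ->
  [set x : T | Num.floor (a + s * x) = z] =
  [set` `[(z%:~R - a) / s, (z%:~R - a) / s + s^-1[ ].
Proof.
move=> s0; have -> : (z%:~R - a) / s + s^-1 = (z%:~R - a + 1) / s by rewrite [RHS]mulrDl mul1r.
apply/seteqP; split=> x /=; rewrite in_itv /=.
  move=> <-; have /andP[h1 h2] := floor_itv (a + s * x).
  rewrite ler_pdivrMr // ltr_pdivlMr //; move: h1 h2; rewrite intrD; lra.
rewrite ler_pdivrMr // ltr_pdivlMr // => /andP[h1 h2].
by apply: floor_def; rewrite intrD; apply/andP; split; lra.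
Qed.

Lemma measurable_floor_interval (a s : R) (z : int) : 0 < s ->
  measurable [set x : T | Num.floor (a + s * x) = z].
Proof. by move=> s0; rewrite floor_interval //; exact: measurable_itv. Qed.

Lemma lebesgue_floor_interval (a s : R) (z : int) : 0 < s ->
  leb [set x : T | Num.floor (a + s * x) = z] = (s^-1)%:E.
Proof.
move=> s0; rewrite floor_interval // lebesgue_measure_itv /= lte_fin ltrDl invr_gt0 s0.
by rewrite -EFinD addrAC subrr add0r.
Qed.

Lemma cube_uncons r a s (z : 'I_r.+1 -> int) :
  cube a s z = @uncons R r @^-1`
    ([set x : T | Num.floor (a + s * x) = z ord0] `*` cube a s (z \o lift ord0)).
Proof.
apply/seteqP; split=> x /=.
  move=> h; split; first exact: h.
  by move=> j; rewrite /= -[LHS]/(Num.floor (a + s * tnth (uncons x).2 j)) tnth_uncons h.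
move=> [h0 h] j; case: (unliftP ord0 j) => [i ->|->]; last exact: h0.
by rewrite -tnth_uncons; exact: h.
Qed.

Lemma measurable_cube r a s (z : 'I_r -> int) : 0 < s -> measurable (cube a s z).
Proof.
move=> s0; elim: r z => [|r IH] z.
  by rewrite (_ : cube _ _ _ = setT); [exact: measurableT | apply/seteqP; split => // x _ []].
rewrite cube_uncons -[X in measurable X]setTI; apply: measurable_uncons => //.
by apply: measurableX; [exact: measurable_floor_interval | exact: IH].
Qed.

Lemma tuple_lebesgue_cons r (A : set T) (B : set (r.-tuple T)) :
  measurable A -> measurable B ->
  mu r.+1 (@uncons R r @^-1` (A `*` B)) = (leb A * mu r B)%E.
Proof.
move=> mA mB; rewrite -(product_measure1E leb (mu r)) //=.
rewrite /cons_measure /pushforward -comp_preimage.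
by have -> : @uncons R r \o @cons_pair R r = id by apply/funext; exact: cons_pairK.
Qed.

Lemma tuple_lebesgue_cube r a s (z : 'I_r -> int) : 0 < s ->
  mu r (cube a s z) = (s^-1 ^+ r)%:E.
Proof.
move=> s0; elim: r z => [|r IH] z.
  by rewrite /= diracE mem_set // => -[].
rewrite cube_uncons tuple_lebesgue_cons ?lebesgue_floor_interval ?IH ?exprS //.
- exact: measurable_floor_interval.
- exact: measurable_cube.
Qed.

End TupleMeasure.

(** * Gaussian integrals *)

Section GaussianIntegrals.
Variable R : realType.
Local Notation T := (measurableTypeR R).
Local Notation mu := (tuple_lebesgue R).
Local Notation leb := (@lebesgue_measure R).

(** A polynomial factor costs only half of the exponential decay: each factor 1 + t is at
    most (1 + 1 / e) exp (e t), and e can be chosen as small as required. *)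
Lemma gauss_absorb (N : nat) (c : R) : 0 < c -> exists2 C : R, 0 < C &
  forall t, 0 <= t -> (1 + t) ^+ N * expR (- (c * t)) <= C * expR (- (c / 2 * t)).
Proof.
move=> c0; pose e := c / 2 / N.+1%:R.
have e0 : 0 < e by rewrite !divr_gt0.
exists ((1 + e^-1) ^+ N); first by rewrite exprn_gt0 // addr_gt0 ?invr_gt0.
move=> t t0.
have h : 1 + t <= (1 + e^-1) * expR (e * t).
  apply: (@le_trans _ _ ((1 + e^-1) * (1 + e * t))); last first.
    by rewrite ler_pM2l ?expR_ge1Dx // addr_gt0 ?invr_gt0.
  have -> : (1 + e^-1) * (1 + e * t) = 1 + t + (e * t + e^-1).
    by field; rewrite gt_eqF.
  by rewrite lerDl addr_ge0 ?mulr_ge0 ?invr_ge0 // ltW.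
apply: (@le_trans _ _ (((1 + e^-1) * expR (e * t)) ^+ N * expR (- (c * t)))).
  by rewrite ler_wpM2r ?expR_ge0 // lerXn2r ?nnegrE ?mulr_ge0 ?expR_ge0 ?addr_ge0 ?invr_ge0 // ltW.
rewrite exprMn -[leLHS]mulrA ler_wpM2l ?exprn_ge0 ?addr_ge0 ?invr_ge0 ?(ltW e0) //.
rewrite -expRM_natl -expRD ler_expR.
have : N%:R * (e * t) <= c / 2 * t.
  rewrite mulrA ler_wpM2r // /e mulrCA ler_piMr ?divr_ge0 ?(ltW c0) //.
  by rewrite ler_pdivrMr // mul1r ler_nat.
lra.
Qed.

Lemma integrable_gauss1 (c : R) : 0 < c ->
  leb.-integrable setT (EFin \o (fun x : R => expR (- (c * x ^+ 2)))).
Proof.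
move=> c0; pose s := Num.sqrt ((2 * c)^-1).
have s2 : s ^+ 2 = (2 * c)^-1 by rewrite sqr_sqrtr // invr_ge0 mulr_ge0 // ltW.
have s0 : s != 0 by rewrite gt_eqF // sqrtr_gt0 invr_gt0 mulr_gt0.
have := integrableZl measurableT (normal_peak s)^-1 (integrable_normal_pdf 0 s).
congr (integrable _ _ _); apply/funext => x /=; rewrite -EFinM; congr EFin.
rewrite normal_pdfE // mulKf ?gt_eqF ?normal_peak_gt0 //.
rewrite /normal_fun subr0; congr expR.
rewrite s2; have : c != 0 by rewrite gt_eqF.
by move=> ?; field.
Qed.

(** Both measures agree on intervals. *)
Lemma lebesgue_opp (A : set T) : measurable A ->
  leb A = pushforward leb (fun x : T => - x : T) A.
Proof.
move=> mA; pose m := pushforward leb (fun x : T => - x : T).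
apply: (@lebesgue_measure_unique R m) => // [|mopp X].
  exact: (measurable_funN (@measurable_id _ T setT)).
move=> /ocitvP[->|[[a b] /= ab ->]]; first by rewrite !measure0.
rewrite /m /pushforward (_ : _ @^-1` _ = [set` `[- b, - a[]); last first.
  by apply/seteqP; split => x /=; rewrite !in_itv /= lerNl ltrNr andbC.
rewrite !lebesgue_measure_itv /= !lte_fin ltrN2; case: ifP => // _.
by rewrite -!EFinD; congr EFin; ring.
Qed.

Lemma Rintegral_odd (f : T -> R) : leb.-integrable setT (EFin \o f) ->
  (forall x, f (- x : R) = - f x) -> \int[leb]_x f x = 0.
Proof.
move=> intf fodd.
have mopp : measurable_fun setT (fun x : T => - x : T).
  exact: (measurable_funN (@measurable_id _ T setT)).
have mf := measurable_int _ intf.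
suff : \int[leb]_x f x = - \int[leb]_x f x by move/eqP; rewrite -addr_eq0 -mulr2n mulrn_eq0 => /eqP.
rewrite -[X in _ = - X]mul1r -mulNr -RintegralZl //.
rewrite /Rintegral; congr fine.
rewrite (eq_measure_integral (pushforward leb (fun x : T => - x : T))); last first.
  by move=> A mA _; exact: lebesgue_opp.
rewrite (integral_pushforward mopp) //.
  by rewrite preimage_setT; apply: eq_integral => x _ /=; rewrite fodd mulN1r.
rewrite preimage_setT (_ : _ \o _ = \- (EFin \o f))%E; first exact: integrableN.
by apply/funext => x /=; rewrite fodd.
Qed.

(** The common dominating function, a product of one-variable Gaussians. *)
Definition gaussT (c : R) r (x : r.-tuple T) : R :=
  expR (- (c * \sum_(i < r) (tnth x i : R) ^+ 2)).

Lemma gaussT_prod c r (x : r.-tuple T) :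
  gaussT c x = \prod_(i < r) expR (- (c * (tnth x i : R) ^+ 2)).
Proof. by rewrite /gaussT mulr_sumr -sumrN expR_sum. Qed.

Lemma integrable_gaussT c r : 0 < c -> (mu r).-integrable setT (EFin \o @gaussT c r).
Proof.
move=> c0; have := integrable_prod_tuple r (integrable_gauss1 c0).
by congr (integrable _ _ _); apply/funext => x /=; rewrite gaussT_prod.
Qed.

End GaussianIntegrals.

(** * The chamber weights *)

Section Weights.
Variable R : realType.
Local Notation T := (measurableTypeR R).
Local Notation mu := (tuple_lebesgue R).

(** The Vandermonde product cut off outside the chamber of decreasing points, where it is
    set to zero. It is continuous everywhere, so integrals over the chamber become integrals
    over the whole space. *)
Definition pvander n (x : 'I_n -> R) : R :=
  \prod_(i < n) \prod_(j < n | (i < j)%N) Num.max (x i - x j) 0.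

Definition sumsq n (x : 'I_n -> R) : R := \sum_(i < n) x i ^+ 2.

(** The weight of the statement with c = m / 2, cut off outside the chamber. *)
Definition cweight (c beta : R) n (x : 'I_n -> R) : R :=
  (pvander x * expR (- c * sumsq x)) `^ beta.

(** The point of the hyperplane with given first r coordinates, as a function of the
    index. *)
Definition hp r (x : r.-tuple T) : 'I_r.+1 -> R :=
  fun i => tnth (@hyperplane_point R r.+1 x) i.

Lemma sumsq_ge0 n (x : 'I_n -> R) : 0 <= sumsq x.
Proof. by apply: sumr_ge0 => i _; exact: sqr_ge0. Qed.

Lemma pvander_ge0 n (x : 'I_n -> R) : 0 <= pvander x.
Proof. by apply: prodr_ge0 => i _; apply: prodr_ge0 => j _; rewrite le_max lexx orbT. Qed.

Lemma le_sumsq n (x : 'I_n -> R) i : x i ^+ 2 <= sumsq x.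
Proof. by rewrite /sumsq (bigD1 i) //= lerDl; apply: sumr_ge0 => j _; exact: sqr_ge0. Qed.

Lemma norm_le_sumsq n (x : 'I_n -> R) i : `|x i| <= 1 + sumsq x.
Proof.
apply: le_trans (_ : 1 + x i ^+ 2 <= _); last by rewrite lerD2l le_sumsq.
by rewrite -real_normK ?num_real //; set t := `|_|; have := sqr_ge0 (t - 1); have := normr_ge0 (x i); rewrite -/t; nra.
Qed.

(** 2 (x - y) <= 2 + x^2 + y^2, by completing both squares. *)
Lemma diff_le_sumsq n (x : 'I_n -> R) (i j : 'I_n) : i != j -> x i - x j <= 1 + sumsq x.
Proof.
move=> ij; rewrite /sumsq (bigD1 i) //= (bigD1 j) 1?eq_sym //=.
set S := \sum_(_ < _ | _) _; have : 0 <= S by apply: sumr_ge0 => a _; exact: sqr_ge0.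
have := sqr_ge0 (x i - 1); have := sqr_ge0 (x j + 1); nra.
Qed.

Lemma pvander_le n (x : 'I_n -> R) : pvander x <= (1 + sumsq x) ^+ (n * n).
Proof.
have S1 : 1 <= 1 + sumsq x by rewrite lerDl sumsq_ge0.
rewrite exprM -[X in _ ^+ X]card_ord -prodr_const; apply: ler_prod => i _.
rewrite prodr_ge0 /=; last by move=> j _; rewrite le_max lexx orbT.
rewrite big_mkcond -[X in _ ^+ X]card_ord -prodr_const; apply: ler_prod => j _.
case: ifP => ij; last by rewrite ler01.
rewrite le_max lexx orbT ge_max diff_le_sumsq ?(le_trans ler01) //.
by apply: contraTneq ij => ->; rewrite ltnn.
Qed.

Lemma hp_widen r (x : r.-tuple T) (j : 'I_r) : hp x (widen_ord (leqnSn r) j) = tnth x j.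
Proof.
rewrite /hp /hyperplane_point tnth_mktuple /=; case: insubP => [i _ /val_inj -> //|].
by rewrite ltn_ord.
Qed.

Lemma hp_max r (x : r.-tuple T) : hp x ord_max = - \sum_(j < r) (tnth x j : R).
Proof. by rewrite /hp /hyperplane_point tnth_mktuple /= insubF // ltnn. Qed.

Lemma sum_hp r (x : r.-tuple T) : \sum_i hp x i = 0.
Proof.
rewrite big_ord_recr /= hp_max; apply/eqP; rewrite subr_eq0; apply/eqP.
by apply: eq_bigr => i _; rewrite hp_widen.
Qed.

Lemma sumsq_hp r (x : r.-tuple T) : \sum_(j < r) (tnth x j : R) ^+ 2 <= sumsq (hp x).
Proof.
rewrite /sumsq big_ord_recr /= -[leLHS]addr0 lerD ?sqr_ge0 //.
by apply: ler_sum => i _; rewrite hp_widen.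
Qed.

Lemma measurable_hp r (i : 'I_r.+1) : measurable_fun setT (fun x : r.-tuple T => hp x i).
Proof.
exact: (measurableT_comp (@measurable_tnth _ _ r.+1 i) (@measurable_hyperplane_point R r.+1)).
Qed.

Lemma measurable_cweight d (U : measurableType d) c beta n (x : 'I_n -> U -> R) :
  (forall i, measurable_fun setT (x i)) ->
  measurable_fun setT (fun u => cweight c beta (fun i => x i u)).
Proof.
move=> mx.
apply: (measurableT_comp (measurable_powR beta)); apply: measurable_funM.
  apply: measurable_prod => i _.
  rewrite (_ : (fun _ => _) = fun u => \prod_(j < n) (if (i < j)%N then Num.max (x i u - x j u) 0 else 1)); last first.
    by apply/funext => u; rewrite big_mkcond.
  apply: measurable_prod => j _; case: (i < j)%N; last exact: measurable_cst.
  by apply: measurable_maxr; [apply: measurable_funB | exact: measurable_cst].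
apply: (measurableT_comp (@measurable_expR R)); apply: measurable_funM; first exact: measurable_cst.
by apply: measurable_sum => i; apply: measurable_funX.
Qed.

Lemma cweight_ge0 c beta n (x : 'I_n -> R) : 0 <= cweight c beta x.
Proof. exact: powR_ge0. Qed.

(** The Vandermonde product grows polynomially, so part of the Gaussian absorbs it together
    with a factor of quadratic growth. *)
Lemma cweight_bound c beta n : 0 < c -> 0 < beta -> exists2 C : R, 0 < C &
  forall x : 'I_n -> R,
   cweight c beta x * (1 + sumsq x) <= C * expR (- (c * beta / 4 * sumsq x)).
Proof.
move=> c0 b0; have [C1 C10 h1] := gauss_absorb (n * n) c0.
have cb : 0 < c / 2 * beta by rewrite mulr_gt0 ?divr_gt0.
have [C2 C20 h2] := gauss_absorb 1 cb.
exists (C1 `^ beta * C2) => [|x]; first by rewrite mulr_gt0 ?powR_gt0.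
have S0 := sumsq_ge0 x.
have h : pvander x * expR (- c * sumsq x) <= C1 * expR (- (c / 2 * sumsq x)).
  by apply: le_trans (h1 _ S0); rewrite mulNr ler_wpM2r ?expR_ge0 ?pvander_le.
have : cweight c beta x <= C1 `^ beta * expR (- (c / 2 * beta * sumsq x)).
  apply: (@le_trans _ _ ((C1 * expR (- (c / 2 * sumsq x))) `^ beta)).
    by apply: ge0_ler_powR; rewrite ?nnegrE ?mulr_ge0 ?expR_ge0 ?pvander_ge0 // ltW.
  rewrite powRM ?expR_ge0 ?(ltW C10) // -expRM le_eqVlt; apply/orP; left.
  by apply/eqP; congr (_ * expR _); ring.
move=> h3; apply: (@le_trans _ _ (C1 `^ beta * expR (- (c / 2 * beta * sumsq x)) * (1 + sumsq x))).
  by rewrite ler_wpM2r // addr_ge0.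
rewrite -[leLHS]mulrA -[leRHS]mulrA ler_wpM2l ?powR_ge0 // [leLHS]mulrC; apply: le_trans (h2 _ S0) _.
by rewrite le_eqVlt; apply/orP; left; apply/eqP; congr (_ * expR _); field.
Qed.

Lemma gaussT_ge0 c r (x : r.-tuple T) : 0 <= gaussT c x.
Proof. exact: expR_ge0. Qed.

Lemma exp_sumsq_hp c r (x : r.-tuple T) : 0 <= c ->
  expR (- (c * sumsq (hp x))) <= gaussT c x.
Proof. by move=> c0; rewrite ler_expR lerN2 ler_wpM2l // sumsq_hp. Qed.

Lemma integrable_cweight_hp c beta r (H : r.-tuple T -> R) : 0 < c -> 0 < beta ->
  measurable_fun setT H -> (forall x, `|H x| <= 1 + sumsq (hp x)) ->
  (mu r).-integrable setT (fun x => (H x * cweight c beta (hp x))%:E).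
Proof.
move=> c0 b0 mH Hb; have [C C0 h] := cweight_bound r.+1 c0 b0.
have e0 : 0 < c * beta / 4 by rewrite divr_gt0 ?mulr_gt0.
have := integrableZl measurableT C (integrable_gaussT r e0).
apply: le_integrable => //.
  apply/measurable_EFinP/measurable_funM => //.
  apply: (@measurable_cweight _ _ c beta _ (fun i x => hp x i)) => i; exact: measurable_hp.
move=> x _; rewrite -EFinM !abse_EFin lee_fin !normrM (ger0_norm (cweight_ge0 _ _ _)).
rewrite (ger0_norm (ltW C0)) (ger0_norm (gaussT_ge0 _ _)).
apply: (@le_trans _ _ (cweight c beta (hp x) * (1 + sumsq (hp x)))).
  by rewrite mulrC ler_wpM2l ?cweight_ge0.
apply: le_trans (h _) _; rewrite ler_wpM2l ?(ltW C0) //.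
by apply: exp_sumsq_hp; exact: ltW.
Qed.

(** The chamber is the zero set of a measurable function: the sum of the violations of
    its defining conditions. *)
Lemma measurable_Omega r : measurable (Omega R r : set (r.-tuple T)).
Proof.
pose f (x : r.-tuple T) : R := \sum_(i < r) \sum_(j < r)
   (if (i <= j)%N then Num.max (tnth x j - tnth x i : R) 0 else 0)
   + `|\sum_(i < r) (tnth x i : R)|.
have f1 (x : r.-tuple T) (i j : 'I_r) :
    0 <= (if (i <= j)%N then Num.max (tnth x j - tnth x i : R) 0 else 0).
  by case: ifP => _ //; rewrite le_max lexx orbT.
have -> : Omega R r = setT `&` f @^-1` [set 0].
  rewrite setTI; apply/seteqP; split => x; rewrite /Omega /f /=.
    move=> [h ->]; rewrite normr0 addr0 big1 // => i _; rewrite big1 // => j _.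
    by case: ifP => // ij; apply/max_idPr; rewrite subr_le0 h.
  move=> h.
  have S0 : 0 <= \sum_(i < r) \sum_(j < r)
     (if (i <= j)%N then Num.max (tnth x j - tnth x i : R) 0 else 0).
    by apply: sumr_ge0 => i _; apply: sumr_ge0.
  have /andP[/eqP h1 /eqP h2] : (\sum_(i < r) \sum_(j < r)
     (if (i <= j)%N then Num.max (tnth x j - tnth x i : R) 0 else 0) == 0)
     && (`|\sum_(i < r) (tnth x i : R)| == 0).
    by rewrite -paddr_eq0 // h.
  split; last by apply/eqP; rewrite -normr_eq0 h2.
  move=> i j ij; move/eqP: h1; rewrite psumr_eq0; last by move=> a _; exact: sumr_ge0.
  move/allP/(_ i); rewrite mem_index_enum => /(_ isT) /=.
  rewrite psumr_eq0 // => /allP/(_ j); rewrite mem_index_enum => /(_ isT) /=.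
  by rewrite ij => /eqP/max_idPr; rewrite subr_le0.
suff mf : measurable_fun setT f by apply: mf => //; exact: measurable_set1.
apply: measurable_funD; last first.
  apply: (measurableT_comp (@normr_measurable R setT)).
  by apply: measurable_sum => i; exact: measurable_tnth.
apply: measurable_sum => i; apply: measurable_sum => j; case: (i <= j)%N; last exact: measurable_cst.
apply: measurable_maxr; last exact: measurable_cst.
by apply: measurable_funB; exact: measurable_tnth.
Qed.

Lemma weight_cweight r m beta (x : r.-tuple T) : Omega R r x ->
  weight m beta x = cweight (m%:R / 2) beta (tnth x : 'I_r -> R).
Proof.
move=> [h _]; rewrite /weight /cweight; congr (_ `^ _); congr (_ * _).
rewrite /vandermonde_prod /pvander; apply: eq_bigr => i _; apply: eq_bigr => j ij.
by apply/esym/max_idPl; rewrite subr_ge0 h // ltnW.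
Qed.

Lemma cweight_notOmega r c beta (x : r.-tuple T) : beta != 0 -> ~ Omega R r x ->
  \sum_(i < r) (tnth x i : R) = 0 -> cweight c beta (tnth x : 'I_r -> R) = 0.
Proof.
move=> b0 nO s0.
have [i [j [ij xij]]] : exists i j : 'I_r, (i < j)%N /\ (tnth x i : R) < tnth x j.
  apply: contrapT => h; apply: nO; split => // i j ij.
  rewrite leNgt; apply/negP => xij; apply: h; exists i, j; split => //.
  by rewrite ltn_neqAle ij andbT; apply: contraTneq xij => /val_inj ->; rewrite ltxx.
rewrite /cweight (_ : pvander _ = 0) ?mul0r ?powR0 //.
rewrite /pvander (bigD1 i) //= (bigD1 j) //=.
have /max_idPr -> : tnth x i - tnth x j <= 0 :> R by rewrite subr_le0 ltW.
by rewrite !mul0r.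
Qed.

Lemma measurable_weight r m beta : measurable_fun setT (weight m beta : r.-tuple T -> R).
Proof.
apply: (measurableT_comp (measurable_powR beta)); apply: measurable_funM.
  apply: measurable_prod => i _.
  rewrite (_ : (fun _ => _) = fun u : r.-tuple T =>
     \prod_(j < r) (if (i < j)%N then tnth u i - tnth u j : R else 1)); last first.
    by apply/funext => u; rewrite big_mkcond.
  apply: measurable_prod => j _; case: (i < j)%N; last exact: measurable_cst.
  by apply: measurable_funB; exact: measurable_tnth.
apply: (measurableT_comp (@measurable_expR R)); apply: measurable_funM; first exact: measurable_cst.
by apply: measurable_sum => i; apply: measurable_funX; exact: measurable_tnth.
Qed.

(** On the hyperplane the cut-off weight vanishes off the chamber, and the measure is the
    image of Lebesgue measure under the parametrization by the first r coordinates. *)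
Lemma integral_hyperplane r m beta (H : r.+1.-tuple T -> R) : (0 < m)%N -> 0 < beta ->
  measurable_fun setT H -> (forall x : r.-tuple T, `|H (@hyperplane_point R r.+1 x)| <= 1 + sumsq (hp x)) ->
  \int[hyperplane_lebesgue R r.+1]_(x in Omega R r.+1) (H x * weight m beta x) =
  \int[mu r]_x (H (@hyperplane_point R r.+1 x) * cweight (m%:R / 2) beta (hp x)).
Proof.
move=> m0 b0 mH Hb.
have patch (x : r.-tuple T) :
   ((fun x => (H x * weight m beta x)%:E) \o @hyperplane_point R r.+1) \_
     (@hyperplane_point R r.+1 @^-1` Omega R r.+1) =1
   (fun x => (H (@hyperplane_point R r.+1 x) * cweight (m%:R / 2) beta (hp x))%:E).
  move=> {}x; rewrite /patch; case: ifPn => [|] h.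
    by rewrite /= weight_cweight //; move/set_mem: h.
  rewrite cweight_notOmega ?mulr0 ?gt_eqF //; last exact: (sum_hp x).
  by move=> hO; move/negP: h; apply; exact/mem_set.
have mc : 0 < m%:R / 2 :> R by rewrite divr_gt0 ?ltr0n.
have iH := integrable_cweight_hp mc b0
  (measurableT_comp mH (@measurable_hyperplane_point R r.+1)) Hb.
rewrite /Rintegral; congr fine.
rewrite (integral_pushforward (@measurable_hyperplane_point R r.+1)).
- rewrite integral_mkcond; apply: eq_integral => x _; exact: patch.
- by apply/measurable_EFinP/measurable_funM => //; exact: measurable_weight.
- apply/integrable_mkcond; last first.
    by apply: eq_integrable iH => // x _; rewrite patch.
  rewrite -[X in measurable X]setTI; apply: measurable_hyperplane_point => //.
  exact: measurable_Omega.
- exact: measurable_Omega.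
Qed.

End Weights.

Section Positivity.
Variable R : realType.
Local Notation T := (measurableTypeR R).
Local Notation mu := (tuple_lebesgue R).

Lemma integrable_cweight_hp1 c beta r : 0 < c -> 0 < beta ->
  (mu r).-integrable setT (fun x => (cweight c beta (hp x) : R)%:E).
Proof.
move=> c0 b0.
have := @integrable_cweight_hp R c beta r (fun=> 1) c0 b0 (measurable_cst _).
have h (x : r.-tuple T) : `|1 : R| <= 1 + sumsq (hp x).
  by rewrite normr1 lerDl sumsq_ge0.
move=> /(_ h); congr (integrable _ _ _); apply/funext => x; by rewrite mul1r.
Qed.

Lemma pvander_gt0 n (x : 'I_n -> R) :
  (forall i j : 'I_n, (i < j)%N -> x j < x i) -> 0 < pvander x.
Proof.
move=> h; apply: prodr_gt0 => i _; apply: prodr_gt0 => j ij.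
by rewrite lt_max subr_gt0 h.
Qed.

(** The weight is positive on a cube of measure one inside the chamber, and an integral that
    vanishes would make it zero almost everywhere. *)
Lemma integral_cweight_gt0 c beta r : 0 < c -> 0 < beta ->
  0 < \int[mu r]_x (cweight c beta (hp x) : R).
Proof.
move=> c0 b0; have iW := integrable_cweight_hp1 r c0 b0.
(* Gaps of 3 keep the coordinates decreasing over unit cubes. The coordinates
   are positive, so the last one, minus their sum, is smaller still. *)
pose z (j : 'I_r) : int := (3 * (r - j))%N%:Z.
pose A : set (r.-tuple T) := cube 0 1 z.
have mA : measurable A by exact: measurable_cube.
have muA : mu r A = 1%E by rewrite tuple_lebesgue_cube // invr1 expr1n.
have WA x : A x -> 0 < cweight c beta (hp x).
  move=> Ax; rewrite /cweight powR_gt0 // mulr_gt0 ?expR_gt0 //.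
  have bd (j : 'I_r) : (3 * (r - j))%N%:R <= (tnth x j : R) < (3 * (r - j))%N%:R + 1.
    have := Ax j; rewrite add0r mul1r => fl.
    by have := floor_itv (tnth x j : R); rewrite fl intrD.
  have pos (j : 'I_r) : 0 < (tnth x j : R).
    have /andP[h _] := bd j; apply: lt_le_trans h; rewrite ltr0n muln_gt0 subn_gt0 /=.
    exact: ltn_ord.
  apply: pvander_gt0 => i j ij.
  have ir : (i < r)%N by apply: leq_trans ij _; rewrite -ltnS; exact: ltn_ord.
  have -> : i = widen_ord (leqnSn r) (Ordinal ir) by apply: val_inj.
  rewrite hp_widen; have [jr|jr] := ltnP j r.
    have -> : j = widen_ord (leqnSn r) (Ordinal jr) by apply: val_inj.
    rewrite hp_widen; have /andP[h1 _] := bd (Ordinal ir); have /andP[_ h2] := bd (Ordinal jr).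
    apply: (lt_le_trans h2); apply: le_trans h1; rewrite natr1 ler_nat /=; lia.
  have -> : j = ord_max by apply: val_inj => /=; have := ltn_ord j; lia.
  rewrite hp_max; apply: le_lt_trans (pos _); rewrite oppr_le0.
  by apply: sumr_ge0 => a _; exact: ltW.
rewrite lt0r Rintegral_ge0 ?andbT; last by move=> x _; exact: cweight_ge0.
apply/eqP => I0.
have mW := measurable_int _ iW.
have e0 : (\int[mu r]_x `|(cweight c beta (hp x) : R)%:E| = 0)%E.
  rewrite -[RHS]/(0%:E) -I0 /Rintegral fineK; last exact: (integrable_fin_num measurableT iW).
  by apply: eq_integral => x _; rewrite abse_EFin ger0_norm ?cweight_ge0.
have /(ae_eq_integral_abs _ measurableT mW) [N [mN N0 sub]] := e0.
have AN : A `<=` N.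
  move=> x Ax; apply: sub => /= /(_ I) /= h; have := WA x Ax.
  by case: h => ->; rewrite ltxx.
have : (mu r A <= mu r N)%E by apply: le_measure => //; rewrite inE.
by rewrite muA N0 lee_fin ler10.
Qed.

End Positivity.

(** * The normalized number of tableaux *)

Section Core.
Variables (R : realType) (k l : nat).
Hypothesis (k0 : (0 < k)%N).
Local Notation m := (k + l)%N.

(** The sum that the deviations d_i, e_j must have: n cells, minus the k l cells of the
    rectangle, plus the two staircases, minus the (k + l) copies of n / (k + l) rounded down.
    Only the remainder of that division varies, so it is bounded. *)
Definition excess (n : nat) : int :=
  n%:Z + (\sum_(i < k) i)%N%:Z + (\sum_(j < l) j)%N%:Z - (k * l)%N%:Z
   - (m * (n %/ m))%N%:Z.

Definition scaled (n : nat) r (d : 'I_r -> int) : 'I_r -> R :=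
  fun i => (d i)%:~R / Num.sqrt n%:R.

(** The part of the product formula that varies with the partition, with each factor
    divided by the power of n that makes it converge. The factors phi vanish unless M + d_i and
    M + e_j are nonnegative, and the cut-off Vandermonde products vanish unless d and e are
    strictly decreasing, so for d and e of the right sum it is nonzero only at deviations of a partition. *)
Definition gcore (n : nat) (d : 'I_k -> int) (e : 'I_l -> int) : R :=
  pvander (scaled n d) * pvander (scaled n e) *
  ((\prod_(i < k) phi R (n %/ m) (d i)) * \prod_(j < l) phi R (n %/ m) (e j)) *
  \prod_(i < k) \prod_(j < l) (n%:R / (((2 * (n %/ m))%N%:Z + d i + e j + 1)%:~R)).

(** The scaling s^(r (r - 1) / 2) of a Vandermonde product, as a product over pairs. *)
Definition pairs_prod (r : nat) (s : R) : R := \prod_(i < r) \prod_(j < r | (i < j)%N) s.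

(** The part of the product formula that all partitions of n share. *)
Definition norming (n : nat) : R :=
  n`!%:R / ((n %/ m)`!%:R ^+ m * (n %/ m)%:R ^ (excess n)) *
  (pairs_prod k (Num.sqrt n%:R) * pairs_prod l (Num.sqrt n%:R)) / n%:R ^+ (k * l).

Definition arm_dev n (la : intpart n) (i : 'I_k) : int := (arm k l la i)%:Z - (n %/ m)%N%:Z.
Definition leg_dev n (la : intpart n) (j : 'I_l) : int := (leg k l la j)%:Z - (n %/ m)%N%:Z.

Lemma pairs_prod_gt0 r (s : R) : 0 < s -> 0 < pairs_prod r s.
Proof. by move=> s0; apply: prodr_gt0 => i _; apply: prodr_gt0. Qed.

Lemma m_gt0 : (0 < m)%N. Proof. by rewrite addn_gt0 k0. Qed.

Lemma divn_gt0m n : (m <= n)%N -> (0 < n %/ m)%N.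
Proof. by move=> mn; rewrite divn_gt0 ?m_gt0. Qed.

Lemma norming_gt0 n : (m <= n)%N -> 0 < norming n.
Proof.
move=> mn; have M0 : 0 < (n %/ m)%:R :> R by rewrite ltr0n divn_gt0m.
have n0 : 0 < n%:R :> R by rewrite ltr0n (leq_trans m_gt0).
have f0 a : 0 < a`!%:R :> R by rewrite ltr0n fact_gt0.
by rewrite !(divr_gt0, mulr_gt0, exprn_gt0, exprz_gt0, pairs_prod_gt0) ?sqrtr_gt0.
Qed.

Lemma pvander_scaled n r (a : nat -> nat) (M : nat) : (0 < n)%N ->
  (forall i j, (i < j < r)%N -> (a j < a i)%N) ->
  vander (fun i : 'I_r => (a i)%:R : R) = pairs_prod r (Num.sqrt n%:R) *
    pvander (scaled n (fun i : 'I_r => (a i)%:Z - M%:Z)).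
Proof.
move=> n0 h; rewrite /vander /pairs_prod /pvander -big_split; apply: eq_bigr => i _.
rewrite -big_split; apply: eq_bigr => j ij /=.
have s0 : 0 < Num.sqrt n%:R :> R by rewrite sqrtr_gt0 ltr0n.
rewrite /scaled -mulrBl -intrB opprB addrA subrK.
have -> : ((a i)%:Z - (a j)%:Z)%:~R = (a i)%:R - (a j)%:R :> R by rewrite intrB.
have /max_idPl -> : 0 <= ((a i)%:R - (a j)%:R) / Num.sqrt n%:R :> R.
  by rewrite divr_ge0 ?(ltW s0) // subr_ge0 ler_nat ltnW // h // ij ltn_ord.
by rewrite mulrC divfK ?gt_eqF.
Qed.

Lemma arm_decr n (la : intpart n) i j : is_rect k l la -> (i < j < k)%N ->
  (arm k l la j < arm k l la i)%N.
Proof.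
clear k0; move=> r h; have := @rectP n k l la r j; have := @shape_mono n (part la) i j (part_shape la).
by rewrite /arm; lia.
Qed.

Lemma leg_decr n (la : intpart n) i j : is_rect k l la -> (i < j < l)%N ->
  (leg k l la j < leg k l la i)%N.
Proof.
clear k0; move=> r h; have := @conj_mono _ _ i j (conj_partP la).
by have := @conj_ge n k l la r j; rewrite /leg; lia.
Qed.

Lemma Posz_sum r (a : nat -> nat) : (\sum_(i < r) a i)%N%:Z = \sum_(i < r) (a i)%:Z.
Proof. exact: (big_morph Posz PoszD erefl). Qed.

Lemma sum_shift r (a : nat -> nat) (M : nat) :
  \sum_(i < r) ((a i)%:Z - M%:Z) = (\sum_(i < r) a i)%N%:Z - (r * M)%N%:Z.
Proof. by rewrite sumrB Posz_sum sumr_const card_ord -mulr_natl natz PoszM. Qed.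

Lemma dev_sum n (la : intpart n) : (k <= n)%N -> is_rect k l la -> la \in hook n k l ->
  \sum_i arm_dev la i + \sum_j leg_dev la j = excess n.
Proof.
move=> kn r h; rewrite /arm_dev /leg_dev !sum_shift /excess mulnDl.
by have := sum_arm_leg kn r h; lia.
Qed.

(** The powers of M collected from all phi depend on the sum of the deviations only, and
    that sum is the same for all partitions. *)
Lemma prod_phi_fact r n (a : nat -> nat) : (0 < n %/ m)%N ->
  (\prod_(i < r) phi R (n %/ m) ((a i)%:Z - (n %/ m)%N%:Z)) * \prod_(i < r) (a i)`!%:R =
  (n %/ m)`!%:R ^+ r * (n %/ m)%:R ^ (\sum_(i < r) ((a i)%:Z - (n %/ m)%N%:Z)).
Proof.
move=> M0; rewrite -big_split /=.
under eq_bigr do rewrite phi_fact //.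
rewrite big_split /= prodr_const card_ord; congr (_ * _).
have M1 : (n %/ m)%:R != 0 :> R by rewrite pnatr_eq0 -lt0n.
by rewrite (big_morph _ (fun x y => expfzDr x y M1) (expr0z _)).
Qed.

(** The product formula, sorted into the common factor and the varying one. *)
Lemma num_SYT_gcore n (la : intpart n) : (m <= n)%N -> is_rect k l la -> la \in hook n k l ->
  (num_SYT la)%:R = norming n * gcore n (arm_dev la) (leg_dev la).
Proof.
move=> mn r h; have M0 := divn_gt0m mn.
have kn : (k <= n)%N by apply: leq_trans mn; exact: leq_addr.
have n0 : (0 < n)%N by apply: leq_trans mn; exact: m_gt0.
have := num_SYT_hook kn r h R.
rewrite (pvander_scaled (n %/ m) n0 (fun i j => @arm_decr _ _ i j r)).
rewrite (pvander_scaled (n %/ m) n0 (fun i j => @leg_decr _ _ i j r)).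
set f := (num_SYT la)%:R; set N := n`!%:R.
set Pk := pairs_prod k _; set Pl := pairs_prod l _.
have ea := prod_phi_fact k (arm k l la) M0.
have el := prod_phi_fact l (leg k l la) M0.
set Af := \prod_(i < k) (arm k l la i)`!%:R in ea *.
set Bf := \prod_(i < l) (leg k l la i)`!%:R in el *.
set W := \prod_(i < k) \prod_(j < l) _.
rewrite /norming /gcore -/Pk -/Pl -/N.
rewrite -[scaled n (arm_dev la)]/(scaled n (fun i : 'I_k => (arm k l la i)%:Z - (n %/ m)%N%:Z)).
rewrite -[scaled n (leg_dev la)]/(scaled n (fun i : 'I_l => (leg k l la i)%:Z - (n %/ m)%N%:Z)).
set p := pvander (scaled n _); set q := pvander (scaled n _).
rewrite -/(\prod_(i < k) phi R (n %/ m) ((arm k l la i)%:Z - (n %/ m)%N%:Z)).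
rewrite -/(\prod_(i < l) phi R (n %/ m) ((leg k l la i)%:Z - (n %/ m)%N%:Z)).
move: ea el; set F := \prod_(i < k) phi _ _ _; set G := \prod_(i < l) phi _ _ _ => ea el.
set V := \prod_(i < k) \prod_(j < l) (_ / _).
have f0 a : a`!%:R != 0 :> R by rewrite pnatr_eq0 -lt0n fact_gt0.
have A0 : Af != 0 by apply/prodf_neq0 => i _; exact: f0.
have B0 : Bf != 0 by apply/prodf_neq0 => i _; exact: f0.
have W0 : W != 0.
  by apply/prodf_neq0 => i _; apply/prodf_neq0 => j _; rewrite pnatr_eq0 addn1.
have nn0 : n%:R != 0 :> R by rewrite pnatr_eq0 -lt0n.
have VW : V * W = n%:R ^+ (k * l).
  rewrite -big_split /= (mulnC k l) exprM -[X in _ ^+ X]card_ord -prodr_const; apply: eq_big => // i _.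
  rewrite -big_split /= -[X in _ ^+ X]card_ord -prodr_const; apply: eq_big => // j _.
  rewrite /arm_dev /leg_dev (_ : _ + 1 = (arm k l la i + leg k l la j + 1)%N%:Z); last by lia.
  by rewrite divfK // pnatr_eq0 addn1.
have MM : (n %/ m)`!%:R ^+ m * (n %/ m)%:R ^ (excess n) = F * Af * (G * Bf).
  rewrite ea el -(dev_sum kn r h) exprD expfzDr; first by rewrite /arm_dev /leg_dev; ring.
  by rewrite pnatr_eq0 -lt0n.
have MM0 : (n %/ m)`!%:R ^+ m * (n %/ m)%:R ^ (excess n) != 0 :> R.
  by rewrite mulf_neq0 ?expf_neq0 ?expfz_neq0 // pnatr_eq0 -lt0n.
move=> hf.
apply: (mulIf (mulf_neq0 (mulf_neq0 A0 B0) W0)); rewrite {}hf.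
have N0 : n%:R ^+ (k * l) != 0 :> R by rewrite expf_neq0.
rewrite [RHS](_ : _ = N / ((n %/ m)`!%:R ^+ m * (n %/ m)%:R ^ (excess n)) * (Pk * Pl)
  / n%:R ^+ (k * l) * (p * q) * (F * Af * (G * Bf)) * (V * W)); last by ring.
rewrite VW -MM; set y := _ ^+ m * _ in MM0 *; set x := n%:R ^+ _ in N0 *.
by field; rewrite MM0 N0.
Qed.

Lemma gcore_ge0 n (d : 'I_k -> int) (e : 'I_l -> int) : 0 <= gcore n d e.
Proof.
rewrite /gcore.
have [/forallP h1|] := boolP [forall i, 0 <= (n %/ m)%N%:Z + d i]; last first.
  rewrite negb_forall => /existsP[i hi].
  have -> : \prod_(i < k) phi R (n %/ m) (d i) = 0.
    by rewrite (bigD1 i) //= /phi (negbTE hi) mul0r.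
  by rewrite mul0r mulr0 mul0r.
have [/forallP h2|] := boolP [forall i, 0 <= (n %/ m)%N%:Z + e i]; last first.
  rewrite negb_forall => /existsP[i hi].
  have -> : \prod_(i < l) phi R (n %/ m) (e i) = 0.
    by rewrite (bigD1 i) //= /phi (negbTE hi) mul0r.
  by rewrite !mulr0 mul0r.
rewrite !mulr_ge0 ?pvander_ge0 //; try by apply: prodr_ge0 => i _; exact: phi_ge0.
apply: prodr_ge0 => i _; apply: prodr_ge0 => j _; rewrite divr_ge0 // ler0z.
by have := h1 i; have := h2 j; lia.
Qed.

Lemma gcore_neq0 n (d : 'I_k -> int) (e : 'I_l -> int) : gcore n d e != 0 ->
  [/\ forall i, 0 <= (n %/ m)%N%:Z + d i, forall j, 0 <= (n %/ m)%N%:Z + e j,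
      forall i j : 'I_k, (i < j)%N -> d j < d i &
      forall i j : 'I_l, (i < j)%N -> e j < e i].
Proof.
have pv r (x : 'I_r -> int) : pvander (scaled n x) != 0 ->
    forall i j : 'I_r, (i < j)%N -> x j < x i.
  move=> h i j ij; rewrite ltNge; apply/negP => xij; move/eqP: h; apply.
  rewrite /pvander (bigD1 i) //= (bigD1 j) //=.
  rewrite (_ : Num.max _ _ = 0) ?mul0r //; apply/max_idPr.
  by rewrite /scaled -mulrBl mulr_le0_ge0 ?invr_ge0 ?sqrtr_ge0 // subr_le0 ler_int.
have ph r (x : 'I_r -> int) : \prod_(i < r) phi R (n %/ m) (x i) != 0 ->
    forall i, 0 <= (n %/ m)%N%:Z + x i.
  move=> h i; apply: contraNT h => /negbTE hi.
  by rewrite (bigD1 i) //= /phi hi mul0r.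
rewrite /gcore !mulf_eq0 !negb_or => /andP[/andP[/andP[h1 h2] /andP[h3 h4]] _].
by split; [exact: ph|exact: ph|exact: pv|exact: pv].
Qed.

End Core.

(** * A uniform Gaussian bound *)

Section Bounds.
Variables (R : realType) (k l : nat).
Hypothesis (k0 : (0 < k)%N).
Local Notation m := (k + l)%N.

Let K := (1 + \sum_(i < k) i + \sum_(j < l) j)%N.

Lemma scaled_sqr n r (d : 'I_r -> int) i : scaled R n d i ^+ 2 = (d i)%:~R ^+ 2 / n%:R.
Proof. by rewrite /scaled expr_div_n sqr_sqrtr. Qed.

(** With |d| at most K n the denominator of [phi_upper] is of order n; the linear term in
    the exponent is absorbed by half of the quadratic one at the price of the constant e. *)
Lemma phi_gauss n (d : int) : (m <= n)%N -> (absz d <= K * n)%N ->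
  phi R (n %/ m) d <= expR 1 * expR (- (((d%:~R ^+ 2) / n%:R) / (8 * K)%:R)).
Proof.
move=> mn dK; have M0 := divn_gt0m k0 mn.
have n0 : (0 < n)%N by apply: leq_trans mn; exact: m_gt0.
apply: le_trans (phi_upper _ d M0) _; rewrite -expRD ler_expR.
have -> : `|d%:~R : R| = (absz d)%:R by rewrite natr_absz intr_norm.
have -> : d%:~R ^+ 2 = (absz d)%:R ^+ 2 :> R.
  by rewrite natr_absz intr_norm real_normK ?num_real.
set D := (absz d)%:R.
have nK : (0 : R) < (8 * K)%:R * n%:R by rewrite mulr_gt0 ?ltr0n //.
have sq : 0 <= D ^+ 2 - D.
  by rewrite subr_ge0 -natrX ler_nat; case: (absz d) => // a; rewrite expnS expn1; lia.
have den : 0 < 2 * ((n %/ m)%:R + D) :> R.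
  by rewrite mulr_gt0 // ltr_wpDr // ltr0n.
have den2 : 2 * ((n %/ m)%:R + D) <= (4 * K)%:R * n%:R :> R.
  rewrite -natrD -!natrM ler_nat; have := leq_div n m; have : (1 <= K)%N by [].
  by nia.
have h1 : (D ^+ 2 - D) / ((4 * K)%:R * n%:R) <= (D ^+ 2 - D) / (2 * ((n %/ m)%:R + D)).
  by rewrite ler_wpM2l // lef_pV2 ?posrE // (lt_le_trans den).
have h2 : (D ^+ 2 - 1) / ((8 * K)%:R * n%:R) <= (D ^+ 2 - D) / ((4 * K)%:R * n%:R).
  rewrite (_ : (8 * K)%:R * n%:R = 2 * ((4 * K)%:R * n%:R)); last by rewrite !natrM; ring.
  rewrite invfM mulrA ler_wpM2r ?invr_ge0 ?mulr_ge0 ?ler0n //.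
  rewrite ler_pdivrMr //; have := sqr_ge0 (D - 1); lra.
have h3 : 1 / ((8 * K)%:R * n%:R) <= 1 :> R.
  by rewrite ler_pdivrMr // mul1r -natrM ler1n muln_gt0 n0 muln_gt0.
rewrite -mulrA -invfM mulrC in h2 *.
have -> : D ^+ 2 / (n%:R * (8 * K)%:R) = (D ^+ 2 - 1) / ((8 * K)%:R * n%:R) + 1 / ((8 * K)%:R * n%:R).
  by rewrite -mulrDl subrK [n%:R * _]mulrC.
lra.
Qed.

(** If M + d is at least M / 2 the denominator is of order n. Otherwise d is of order n,
    hence d^2 / n also, and the denominator is at least 1. *)
Lemma hook_factor_bound n (d e : int) : (m <= n)%N ->
  0 <= (n %/ m)%N%:Z + d -> 0 <= (n %/ m)%N%:Z + e ->
  0 <= (n%:R / (((2 * (n %/ m))%N%:Z + d + e + 1)%:~R) : R) <=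
    (16 * m ^ 2)%:R * (1 + d%:~R ^+ 2 / n%:R).
Proof.
move=> mn hd he; have M0 := divn_gt0m k0 mn.
have n0 : (0 < n)%N by apply: leq_trans mn; exact: m_gt0.
have nr0 : 0 < n%:R :> R by rewrite ltr0n.
have m0 := m_gt0 l k0.
have nM : (n <= 2 * m * (n %/ m))%N.
  by have := ltn_ceil n m0; nia.
set M := (n %/ m)%N in hd he M0 nM *.
have q0 : 0 <= d%:~R ^+ 2 / n%:R :> R by rewrite divr_ge0 ?sqr_ge0.
have D1 : 1 <= ((2 * M)%N%:Z + d + e + 1)%:~R :> R.
  by rewrite -[1]/(1%:~R) ler_int; lia.
have D0 := lt_le_trans ltr01 D1.
rewrite divr_ge0 ?(ltW nr0) ?(ltW D0) //=.
have [hM|hM] := leP M%:Z (2 * (M%:Z + d)).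
  apply: (@le_trans _ _ (16 * m ^ 2)%:R); last by rewrite ler_peMr // lerDl.
  rewrite ler_pdivrMr //.
  apply: (@le_trans _ _ ((2 * m * M)%N%:R)); first by rewrite ler_nat.
  have -> : (2 * m * M)%N%:R = (2 * m)%:R * M%:R :> R by rewrite -natrM.
  apply: (@le_trans _ _ ((2 * m)%:R * (2 * ((2 * M)%N%:Z + d + e + 1)%:~R))).
    rewrite ler_wpM2l // -[M%:R]/(M%:Z%:~R) -[2]/(2%:~R) -intrM ler_int; lia.
  rewrite mulrA ler_wpM2r ?(ltW D0) // -natrM ler_nat; nia.
apply: (@le_trans _ _ n%:R).
  by rewrite ler_pdivrMr // ler_peMr // ltW.
apply: (@le_trans _ _ ((16 * m ^ 2)%:R * (d%:~R ^+ 2 / n%:R))); last by rewrite ler_wpM2l // lerDr.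
rewrite mulrA ler_pdivlMr // -natrM.
have -> : d%:~R ^+ 2 = (absz d ^ 2)%:R :> R.
  by rewrite natrX natr_absz intr_norm real_normK ?num_real.
rewrite -natrM ler_nat.
have dM : (M <= 2 * absz d)%N by lia.
have : (n <= 4 * m * absz d)%N by nia.
by rewrite !expnS !expn0 !muln1 => h; nia.
Qed.

(** The M + d_i and M + e_j are nonnegative and their sum is of order n. *)
Lemma abs_dev_le n (d : 'I_k -> int) (e : 'I_l -> int) :
  (m <= n)%N -> \sum_i d i + \sum_j e j = excess k l n ->
  (forall i, 0 <= (n %/ m)%N%:Z + d i) -> (forall j, 0 <= (n %/ m)%N%:Z + e j) ->
  (forall i, (absz (d i) <= K * n)%N) /\ (forall j, (absz (e j) <= K * n)%N).
Proof.
move=> mn hs hd he.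
have n0 : (0 < n)%N by apply: leq_trans mn; exact: m_gt0.
have Mn : (n %/ m <= n)%N by exact: leq_div.
set M := (n %/ m)%N in hd he hs Mn *.
have sd : \sum_i (M%:Z + d i) + \sum_j (M%:Z + e j) <= (K * n)%N%:Z.
  rewrite !big_split /= !sumr_const !card_ord -[M%:Z *+ k]mulr_natl -[M%:Z *+ l]mulr_natl !natz.
  rewrite addrACA hs /excess -/M.
  have -> : (K * n = n + (\sum_(i < k) i + \sum_(j < l) j) * n)%N.
    by rewrite /K -addnA mulnDl mul1n.
  have := leq_pmulr (\sum_(i < k) i + \sum_(j < l) j)%N n0.
  by rewrite [(m * M)%N]mulnDl; lia.
have s1 i : M%:Z + d i <= \sum_i (M%:Z + d i).
  by rewrite (bigD1 i) //= lerDl sumr_ge0.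
have s2 j : M%:Z + e j <= \sum_j (M%:Z + e j).
  by rewrite (bigD1 j) //= lerDl sumr_ge0.
have s3 : 0 <= \sum_i (M%:Z + d i) by apply: sumr_ge0.
have s4 : 0 <= \sum_j (M%:Z + e j) by apply: sumr_ge0.
have Kn : (n <= K * n)%N by rewrite leq_pmull.
split=> i; [have := s1 i; have := hd i | have := s2 i; have := he i]; lia.
Qed.

Definition total_sq n (d : 'I_k -> int) (e : 'I_l -> int) : R :=
  sumsq (scaled R n d) + sumsq (scaled R n e).

Lemma prod_phi_gauss n r (d : 'I_r -> int) : (m <= n)%N ->
  (forall i, (absz (d i) <= K * n)%N) ->
  \prod_(i < r) phi R (n %/ m) (d i) <=
  expR 1 ^+ r * expR (- (sumsq (scaled R n d) / (8 * K)%:R)).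
Proof.
move=> mn hd; apply: (@le_trans _ _ (\prod_(i < r)
   (expR 1 * expR (- (((d i)%:~R ^+ 2) / n%:R / (8 * K)%:R))))).
  by apply: ler_prod => i _; rewrite phi_ge0 phi_gauss.
rewrite big_split /= prodr_const card_ord ler_wpM2l ?exprn_ge0 ?expR_ge0 //.
have -> : sumsq (scaled R n d) = \sum_(i < r) (d i)%:~R ^+ 2 / n%:R.
  by apply: eq_bigr => i _; rewrite scaled_sqr.
by rewrite -expR_sum sumrN -mulr_suml.
Qed.

Lemma gcore_le : exists2 C : R, 0 < C & exists2 c : R, 0 < c &
  forall n (d : 'I_k -> int) (e : 'I_l -> int), (m <= n)%N ->
  \sum_i d i + \sum_j e j = excess k l n ->
  gcore R n d e <= C * expR (- (c * total_sq n d e)).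
Proof.
pose c : R := (8 * K)%:R^-1.
have c0 : 0 < c by rewrite invr_gt0 ltr0n.
have [C1 C10 hC] := gauss_absorb (k * k + l * l + k * l) c0.
exists (expR 1 ^+ m * (16 * m ^ 2)%:R ^+ (k * l) * C1).
  rewrite !mulr_gt0 ?exprn_gt0 ?expR_gt0 // ltr0n muln_gt0 expn_gt0 /=.
  by rewrite m_gt0.
exists (c / 2) => [|n d e mn hs]; first by rewrite divr_gt0.
have S1 := sumsq_ge0 (scaled R n d); have S2 := sumsq_ge0 (scaled R n e).
have S0 : 0 <= total_sq n d e by rewrite addr_ge0.
have [->|g0] := eqVneq (gcore R n d e) 0.
  rewrite !mulr_ge0 ?exprn_ge0 ?expR_ge0 ?(ltW C10) //.
have [hd he _ _] := gcore_neq0 g0.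
have [ad ae] := abs_dev_le mn hs hd he.
set S := total_sq n d e in S0 *.
have p1 : pvander (scaled R n d) <= (1 + S) ^+ (k * k).
  apply: le_trans (pvander_le _) _.
  by rewrite lerXn2r ?nnegrE ?addr_ge0 // lerD2l lerDl.
have p2 : pvander (scaled R n e) <= (1 + S) ^+ (l * l).
  apply: le_trans (pvander_le _) _.
  by rewrite lerXn2r ?nnegrE ?addr_ge0 // lerD2l lerDr.
have p3 := prod_phi_gauss mn ad.
have p4 := prod_phi_gauss mn ae.
have p5 : \prod_(i < k) \prod_(j < l) (n%:R / (((2 * (n %/ m))%N%:Z + d i + e j + 1)%:~R)) <=
   ((16 * m ^ 2)%:R * (1 + S)) ^+ (k * l).
  rewrite (mulnC k l) exprM -[X in _ ^+ X]card_ord -prodr_const; apply: ler_prod => i _.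
  apply/andP; split.
    by apply: prodr_ge0 => j _; case/andP: (hook_factor_bound mn (hd i) (he j)).
  rewrite -[X in _ ^+ X]card_ord -prodr_const; apply: ler_prod => j _.
  case/andP: (hook_factor_bound mn (hd i) (he j)) => -> /= h; apply: le_trans h _.
  rewrite ler_wpM2l // lerD2l -scaled_sqr; apply: le_trans (le_sumsq _ _) _.
  by rewrite lerDl.
have S1' : 0 <= 1 + S by rewrite addr_ge0.
have q1 : 0 <= \prod_(i < k) phi R (n %/ m) (d i) by apply: prodr_ge0 => i _; exact: phi_ge0.
have q2 : 0 <= \prod_(i < l) phi R (n %/ m) (e i) by apply: prodr_ge0 => i _; exact: phi_ge0.
have q3 : 0 <= \prod_(i < k) \prod_(j < l) (n%:R / (((2 * (n %/ m))%N%:Z + d i + e j + 1)%:~R : R)).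
  by apply: prodr_ge0 => i _; apply: prodr_ge0 => j _; case/andP: (hook_factor_bound mn (hd i) (he j)).
have h1 : gcore R n d e <= (1 + S) ^+ (k * k) * (1 + S) ^+ (l * l) *
   ((expR 1 ^+ k * expR (- (sumsq (scaled R n d) / (8 * K)%:R))) *
    (expR 1 ^+ l * expR (- (sumsq (scaled R n e) / (8 * K)%:R)))) *
   ((16 * m ^ 2)%:R * (1 + S)) ^+ (k * l).
  rewrite /gcore; apply: ler_pM => //; first by rewrite !mulr_ge0 ?pvander_ge0.
  by apply: ler_pM; rewrite ?mulr_ge0 ?pvander_ge0 //; apply: ler_pM; rewrite ?pvander_ge0.
apply: le_trans h1 _; rewrite -/c.
rewrite [leLHS](_ : _ = expR 1 ^+ m * (16 * m ^ 2)%:R ^+ (k * l) *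
   ((1 + S) ^+ (k * k + l * l + k * l) * expR (- (c * S)))); last first.
  rewrite !exprD exprMn (_ : - (c * S) = - (sumsq (scaled R n d) * c) - sumsq (scaled R n e) * c).
    by rewrite expRD; ring.
  by rewrite /S /total_sq; ring.
rewrite -[leRHS]mulrA ler_wpM2l ?mulr_ge0 ?exprn_ge0 ?expR_ge0 //.
exact: hC.
Qed.

(** The bound of [gcore_le] raised to the power beta, with room for a statistic of at most
    quadratic growth. *)
Lemma gcore_bound beta : 0 < beta -> exists2 C : R, 0 < C & exists2 c : R, 0 < c &
  forall n (d : 'I_k -> int) (e : 'I_l -> int), (m <= n)%N ->
  \sum_i d i + \sum_j e j = excess k l n ->
  (1 + total_sq n d e) * gcore R n d e `^ beta <= C * expR (- (c * total_sq n d e)).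
Proof.
move=> b0; have [C C0 [c c0 h]] := gcore_le.
have cb : 0 < c * beta by rewrite mulr_gt0.
have [C2 C20 h2] := gauss_absorb 1 cb.
exists (C `^ beta * C2); first by rewrite mulr_gt0 ?powR_gt0.
exists (c * beta / 2) => [|n d e mn hs]; first by rewrite divr_gt0.
have S0 : 0 <= total_sq n d e by rewrite addr_ge0 ?sumsq_ge0.
have : gcore R n d e `^ beta <= C `^ beta * expR (- (c * beta * total_sq n d e)).
  apply: (@le_trans _ _ ((C * expR (- (c * total_sq n d e))) `^ beta)).
    apply: ge0_ler_powR; rewrite ?nnegrE ?gcore_ge0 ?(ltW b0) //.
      by rewrite mulr_ge0 ?expR_ge0 // ltW.
    exact: h.
  rewrite powRM ?expR_ge0 ?(ltW C0) // -expRM le_eqVlt; apply/orP; left.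
  by apply/eqP; congr (_ * expR _); ring.
move=> h3; apply: (@le_trans _ _ ((1 + total_sq n d e) * (C `^ beta * expR (- (c * beta * total_sq n d e))))).
  by rewrite ler_wpM2l // addr_ge0.
rewrite mulrCA -[leRHS]mulrA ler_wpM2l ?powR_ge0 //; exact: h2.
Qed.

End Bounds.

(** * The pointwise limit *)

Section SequenceLimits.
Variable R : realType.
Implicit Types (u v : nat -> R) (a b : R).

Lemma cvg_inv_nat : (n%:R : R)^-1 @[n --> \oo] --> (0 : R).
Proof.
have := @cvg_harmonic R; rewrite -(@cvg_shiftS _ (fun n : nat => n%:R^-1 : R)).
exact.
Qed.

Lemma cvg_inv_sqrt : (Num.sqrt n%:R : R)^-1 @[n --> \oo] --> (0 : R).
Proof.
have -> : (fun n : nat => (Num.sqrt n%:R : R)^-1) = (fun n => Num.sqrt (n%:R^-1)).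
  by apply/funext => n; rewrite sqrtrV.
rewrite -[X in _ --> X](@sqrtr0 R).
by apply: (cvg_comp _ _ cvg_inv_nat); exact: sqrt_continuous.
Qed.

Lemma cvg_bigprod (I : Type) (s : seq I) (P : pred I) (u : I -> nat -> R) (v : I -> R) :
  (forall i, P i -> u i n @[n --> \oo] --> v i) ->
  (\prod_(i <- s | P i) u i n) @[n --> \oo] --> \prod_(i <- s | P i) v i.
Proof.
move=> h; elim: s => [|i s IH].
  by rewrite big_nil; under eq_fun do rewrite big_nil; exact: cvg_cst.
rewrite big_cons; under eq_fun do rewrite big_cons.
by case: (boolP (P i)) => // Pi; apply: cvgM => //; exact: h.
Qed.

Lemma cvg_max0 u a : u n @[n --> \oo] --> a ->
  Num.max (u n) 0 @[n --> \oo] --> Num.max a 0.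
Proof.
have e x : Num.max x 0 = (x + `|x|) / 2 :> R.
  have [x0|x0] := leP 0 x.
    by rewrite ger0_norm //; lra.
  by rewrite ltr0_norm //; lra.
move=> h; rewrite e; under eq_fun do rewrite e.
by apply: cvgM; [apply: cvgD => //; exact: cvg_norm | exact: cvg_cst].
Qed.

Lemma cvg_expR u a : u n @[n --> \oo] --> a -> expR (u n) @[n --> \oo] --> expR a.
Proof. by move=> h; apply: (cvg_comp _ _ h); exact: continuous_expR. Qed.

(** At a = 0 continuity of the power comes from its monotonicity, elsewhere from the
    exponential formula. *)
Lemma cvg_powR u a b : 0 < b -> 0 <= a -> (forall n, 0 <= u n) ->
  u n @[n --> \oo] --> a -> u n `^ b @[n --> \oo] --> a `^ b.
Proof.
move=> b0; rewrite le_eqVlt => /orP[/eqP <-|a0] u0 h.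
  rewrite powR0 ?gt_eqF //; apply/cvgrPdist_lt => e e0.
  have d0 : 0 < e `^ b^-1 by rewrite powR_gt0.
  near=> n; rewrite sub0r normrN ger0_norm ?powR_ge0 //.
  rewrite -[ltRHS](@powRr1 _ e) ?(ltW e0) // -(@mulVf _ b) ?gt_eqF // powRrM.
  apply: gt0_ltr_powR; rewrite ?nnegrE ?(ltW d0) //.
  by near: n; exact: (cvgr_lt _ h).
have lna : ln (u n) @[n --> \oo] --> ln a.
  by apply: (cvg_comp _ _ h); exact: continuous_ln.
have -> : a `^ b = expR (b * ln a) by rewrite /powR gt_eqF.
have lim : expR (b * ln (u n)) @[n --> \oo] --> expR (b * ln a).
  by apply: cvg_expR; apply: cvgM => //; exact: cvg_cst.
apply: cvg_trans lim; apply: near_eq_cvg; near=> n.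
rewrite /powR gt_eqF //; near: n; exact: (cvgr_gt _ h).
Unshelve. all: by end_near. Qed.

End SequenceLimits.

Section CoreLimit.
Variables (R : realType) (k l : nat).
Hypothesis (k0 : (0 < k)%N).
Local Notation m := (k + l)%N.
Local Notation rt n := (Num.sqrt n%:R : R).

Lemma cvg_divn : ((n %/ m)%:R / n%:R : R) @[n --> \oo] --> (m%:R^-1 : R).
Proof.
have mr0 : 0 < m%:R :> R by rewrite ltr0n m_gt0.
apply: (@squeeze_cvgr _ _ _ _ (fun n : nat => m%:R^-1 - n%:R^-1) (fun _ => m%:R^-1)).
- near=> n; have n0 : 0 < n%:R :> R by rewrite ltr0n; near: n; exists 1%N.
  apply/andP; split.
    rewrite lerBlDr -[X in _ <= _ + X]mul1r -mulrDl ler_pdivlMr // ler_pdivrMl //.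
    by rewrite natr1 -natrM ler_nat mulnC ltnW // ltn_ceil // m_gt0.
  by rewrite ler_pdivrMr // ler_pdivlMl // -natrM ler_nat mulnC leq_divM.
- rewrite -[X in _ --> X]subr0; apply: cvgB; [exact: cvg_cst | exact: cvg_inv_nat].
- exact: cvg_cst.
Unshelve. all: by end_near. Qed.

(** Both bounds on [phi] have exponent of the form (t^2 -+ t w) / (2 (q +- t w)), with
    t = |z| / sqrt n, w = 1 / sqrt n and q = M / n, and t w tends to 0. *)
Lemma cvg_phi (z : nat -> int) (x : R) : (z n)%:~R / rt n @[n --> \oo] --> x ->
  phi R (n %/ m) (z n) @[n --> \oo] --> expR (- (m%:R / 2 * x ^+ 2)).
Proof.
move=> hz; have mr0 : 0 < m%:R :> R by rewrite ltr0n m_gt0.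
pose t n : R := `|(z n)%:~R| / rt n.
have ht : t n @[n --> \oo] --> `|x|.
  have -> : t = (fun n => `| (z n)%:~R / rt n |).
    by apply/funext => n; rewrite normrM normfV [X in _ / X]ger0_norm ?sqrtr_ge0.
  exact: cvg_norm.
pose w n : R := (rt n)^-1.
have hw : w n @[n --> \oo] --> (0 : R) by exact: cvg_inv_sqrt.
pose q n : R := (n %/ m)%:R / n%:R.
have hq : q n @[n --> \oo] --> (m%:R^-1 : R) by exact: cvg_divn.
have htw : t n * w n @[n --> \oo] --> (0 : R).
  by rewrite -(mulr0 `|x|); exact: cvgM.
(* The sign (-1) ^ e selects the lower or the upper bound. *)
have lim (e : bool) : expR (- ((t n ^+ 2 - (-1) ^+ e * (t n * w n)) /
    (2 * (q n + (-1) ^+ e * (t n * w n))))) @[n --> \oo] -->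
    expR (- (m%:R / 2 * x ^+ 2)).
  apply: cvg_expR; apply: cvgN.
  rewrite (_ : m%:R / 2 * x ^+ 2 = (`|x| ^+ 2 - (-1) ^+ e * 0) / (2 * (m%:R^-1 + (-1) ^+ e * 0))); last first.
    rewrite !mulr0 subr0 addr0 real_normK ?num_real // invfM invrK; ring.
  apply: cvgM.
    apply: cvgB; last by apply: cvgM => //; exact: cvg_cst.
    by rewrite expr2; under eq_fun do rewrite expr2; exact: cvgM.
  apply: cvgV; first by rewrite mulr0 addr0 mulf_neq0 ?invr_neq0 ?gt_eqF.
  apply: cvgM; first exact: cvg_cst.
  by apply: cvgD => //; apply: cvgM => //; exact: cvg_cst.
have e1 n : (0 < n)%N -> `|(z n)%:~R : R| = t n * rt n.
  by move=> n0; rewrite divfK // gt_eqF // sqrtr_gt0 ltr0n.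
have s2 n : rt n ^+ 2 = n%:R by rewrite sqr_sqrtr.
have e2 n : (0 < n)%N -> (n %/ m)%:R = q n * rt n ^+ 2.
  by move=> n0; rewrite s2 divfK // pnatr_eq0 -lt0n.
apply: (squeeze_cvgr _ (lim true) (lim false)).
near=> n.
have mn : (m <= n)%N by near: n; exists m.
have n0 : (0 < n)%N by apply: leq_trans mn; exact: m_gt0.
have rt0 : 0 < rt n by rewrite sqrtr_gt0 ltr0n.
have rtn0 : rt n != 0 by rewrite gt_eqF.
have q0 : 0 < q n by rewrite divr_gt0 ?ltr0n ?divn_gt0m.
have t0 : 0 <= t n by rewrite divr_ge0 ?normr_ge0 ?(ltW rt0).
have tq : t n * w n < q n.
  have : 0 < q n - t n * w n; last by rewrite subr_gt0.
  near: n; apply: (cvgr_gt (m%:R^-1 - 0)); first exact: cvgB.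
  by rewrite subr0 invr_gt0.
have hM : (absz (z n) < n %/ m)%N.
  rewrite -(ltr_nat R) natr_absz intr_norm e1 // e2 //.
  rewrite (_ : t n * rt n = t n * w n * rt n ^+ 2); last by rewrite /w; field.
  by rewrite ltr_pM2r // exprn_gt0.
have wrt : w n * rt n = 1 by rewrite /w mulVf.
have trt : t n * rt n = t n * w n * rt n ^+ 2.
  by rewrite -[RHS]mulrA expr2 [w n * _]mulrA wrt mul1r.
have num (s : R) : (t n * rt n) ^+ 2 + s * (t n * rt n) = (t n ^+ 2 + s * (t n * w n)) * rt n ^+ 2.
  by rewrite exprMn trt; ring.
have den (s : R) : q n * rt n ^+ 2 + s * (t n * rt n) = (q n + s * (t n * w n)) * rt n ^+ 2.
  by rewrite trt; ring.
have ratio (a b : R) : a * rt n ^+ 2 / (2 * (b * rt n ^+ 2)) = a / (2 * b).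
  by rewrite [2 * _]mulrA -mulf_div divff ?mulr1 // expf_neq0.
apply/andP; split.
  apply: le_trans (phi_lower R hM); rewrite ler_expR lerN2 e1 // e2 // expr1.
  have := num 1; rewrite !mul1r => ->; have := den (-1); rewrite !mulN1r => ->.
  by rewrite ratio ?mulN1r ?opprK.
apply: le_trans (phi_upper R (z n) (divn_gt0m k0 mn)) _; rewrite ler_expR lerN2 e1 // e2 // expr0.
have := num (-1); rewrite !mulN1r => ->; have := den 1; rewrite !mul1r => ->.
by rewrite ratio ?mulN1r ?mul1r.
Unshelve. all: by end_near. Qed.

Lemma cvg_pvander r (d : nat -> 'I_r -> int) (x : 'I_r -> R) :
  (forall i, scaled R n (d n) i @[n --> \oo] --> x i) ->
  pvander (scaled R n (d n)) @[n --> \oo] --> pvander x.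
Proof.
move=> h; apply: cvg_bigprod => i _; apply: cvg_bigprod => j _.
by apply: cvg_max0; apply: cvgB; exact: h.
Qed.

Lemma cvg_prod_phi r (d : nat -> 'I_r -> int) (x : 'I_r -> R) :
  (forall i, scaled R n (d n) i @[n --> \oo] --> x i) ->
  \prod_(i < r) phi R (n %/ m) (d n i) @[n --> \oo] --> expR (- (m%:R / 2) * sumsq x).
Proof.
move=> h; rewrite /sumsq mulr_sumr expR_sum.
by apply: cvg_bigprod => i _; rewrite mulNr; apply: cvg_phi; exact: h.
Qed.

Lemma cvg_hook_factor (d e : nat -> int) (x y : R) :
  (d n)%:~R / rt n @[n --> \oo] --> x -> (e n)%:~R / rt n @[n --> \oo] --> y ->
  (n%:R / (((2 * (n %/ m))%N%:Z + d n + e n + 1)%:~R) : R) @[n --> \oo] --> (m%:R / 2 : R).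
Proof.
move=> hd he; have mr0 : 0 < m%:R :> R by rewrite ltr0n m_gt0.
have small (z : nat -> int) (a : R) : (z n)%:~R / rt n @[n --> \oo] --> a ->
    ((z n)%:~R / rt n * (rt n)^-1) @[n --> \oo] --> (0 : R).
  by move=> hz; rewrite -(mulr0 a); apply: cvgM => //; exact: cvg_inv_sqrt.
have lim : (2 * ((n %/ m)%:R / n%:R) + (d n)%:~R / rt n * (rt n)^-1 +
   (e n)%:~R / rt n * (rt n)^-1 + n%:R^-1)^-1 @[n --> \oo] --> (m%:R / 2 : R).
  have -> : m%:R / 2 = (2 * m%:R^-1 + 0 + 0 + 0)^-1 :> R.
    by rewrite !addr0 invfM invrK mulrC.
  apply: cvgV; first by rewrite !addr0 mulf_neq0 ?invr_neq0 ?gt_eqF.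
  apply: cvgD; last exact: cvg_inv_nat.
  apply: cvgD; last exact: small he.
  apply: cvgD; last exact: small hd.
  by apply: cvgM; [exact: cvg_cst | exact: cvg_divn].
apply: cvg_trans lim; apply: near_eq_cvg; near=> n.
have n0 : (0 < n)%N by near: n; exists 1%N.
have nr0 : n%:R != 0 :> R by rewrite pnatr_eq0 -lt0n.
have rr (a : R) : a / rt n * (rt n)^-1 = a / n%:R.
  by rewrite -mulrA -invfM -expr2 sqr_sqrtr.
rewrite !rr (_ : _ + n%:R^-1 = (2 * (n %/ m)%:R + (d n)%:~R + (e n)%:~R + 1) / n%:R); last by field.
rewrite invf_div; congr (_ / _); rewrite !intrD.
by have -> : ((2 * (n %/ m))%N%:Z)%:~R = 2 * (n %/ m)%:R :> R by rewrite -natrM.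
Unshelve. all: by end_near. Qed.

Lemma cvg_gcore (d : nat -> 'I_k -> int) (e : nat -> 'I_l -> int)
    (x : 'I_k -> R) (y : 'I_l -> R) :
  (forall i, scaled R n (d n) i @[n --> \oo] --> x i) ->
  (forall j, scaled R n (e n) j @[n --> \oo] --> y j) ->
  gcore R n (d n) (e n) @[n --> \oo] --> pvander x * pvander y *
    (expR (- (m%:R / 2) * sumsq x) * expR (- (m%:R / 2) * sumsq y)) *
    ((m%:R / 2) ^+ l) ^+ k.
Proof.
move=> hx hy; apply: cvgM.
  apply: cvgM; first by apply: cvgM; exact: cvg_pvander.
  by apply: cvgM; exact: cvg_prod_phi.
have -> : ((m%:R / 2) ^+ l) ^+ k = \prod_(i < k) \prod_(j < l) (m%:R / 2) :> R.
  by rewrite !prodr_const !card_ord.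
apply: cvg_bigprod => i _; apply: cvg_bigprod => j _.
exact: (@cvg_hook_factor (fun n => d n i) (fun n => e n j) (x i) (y j) (hx i) (hy j)).
Qed.

End CoreLimit.

(** * Sampling the lattice of deviations *)

Section Rounding.
Variable R : realType.
Local Notation T := (measurableTypeR R).

(** Rounding onto the lattice points of sum v: all coordinates but the last are rounded
    down, and the last is what the sum requires. *)
Definition round_hp r (s : R) (v : int) (x : r.-tuple T) : 'I_r.+1 -> int :=
  fun i => if insub (val i) is Some j then Num.floor (v%:~R / r.+1%:R + s * tnth x j)
    else v - \sum_(j < r) Num.floor (v%:~R / r.+1%:R + s * tnth x j).

Lemma round_widen r s v (x : r.-tuple T) (j : 'I_r) :
  round_hp s v x (widen_ord (leqnSn r) j) = Num.floor (v%:~R / r.+1%:R + s * tnth x j).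
Proof.
rewrite /round_hp /=; case: insubP => [i _ /val_inj -> //|].
by rewrite ltn_ord.
Qed.

Lemma round_max r s v (x : r.-tuple T) :
  round_hp s v x ord_max = v - \sum_(j < r) Num.floor (v%:~R / r.+1%:R + s * tnth x j).
Proof. by rewrite /round_hp /= insubF // ltnn. Qed.

Lemma sum_round r s v (x : r.-tuple T) : \sum_i round_hp s v x i = v.
Proof.
rewrite big_ord_recr /= round_max addrC -[RHS](subrK (\sum_(j < r) Num.floor (v%:~R / r.+1%:R + s * tnth x j))).
by congr (_ + _); apply: eq_bigr => j _; rewrite round_widen.
Qed.

(** The error of the last coordinate is the sum of the errors of the others. *)
Lemma round_hp_close r s v (x : r.-tuple T) i :
  `|(round_hp s v x i)%:~R - (v%:~R / r.+1%:R + s * hp x i)| <= r.+1%:R :> R.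
Proof.
have fl (a : R) : -1 <= (Num.floor a)%:~R - a <= 0.
  have /andP[h1 h2] := floor_itv a; rewrite subr_le0 h1 andbT.
  by move: h2; rewrite intrD; lra.
have [ir|ir] := ltnP i r.
  have -> : i = widen_ord (leqnSn r) (Ordinal ir) by apply: val_inj.
  rewrite round_widen hp_widen; apply: (@le_trans _ _ 1); last by rewrite ler1n.
  have /andP[h1 h2] := fl (v%:~R / r.+1%:R + s * (tnth x (Ordinal ir) : R)).
  by rewrite ler_norml h1 (le_trans h2).
have -> : i = ord_max by apply: val_inj => /=; have := ltn_ord i; lia.
rewrite round_max hp_max.
rewrite (_ : _ - _ = \sum_(j < r) ((v%:~R / r.+1%:R + s * tnth x j) -
    (Num.floor (v%:~R / r.+1%:R + s * tnth x j))%:~R)); last first.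
  have ew : (v%:~R / r.+1%:R) *+ r = v%:~R - v%:~R / r.+1%:R :> R.
    by rewrite -mulr_natr -natr1; field; rewrite natr1 pnatr_eq0.
  rewrite intrB rmorph_sum /= sumrB big_split /= sumr_const card_ord ew -mulr_sumr.
  by rewrite mulrN opprD opprK; set S := \sum_(_ < _) _; set F := \sum_(_ < _) _; ring.
apply: le_trans (ler_norm_sum _ _ _) _; apply: (@le_trans _ _ (\sum_(j < r) 1)).
  apply: ler_sum => j _; have /andP[h1 h2] := fl (v%:~R / r.+1%:R + s * (tnth x j : R)).
  by rewrite distrC ler_norml h1 (le_trans h2).
by rewrite sumr_const card_ord ler_nat.
Qed.

Lemma round_cube r s (d : 'I_r.+1 -> int) (x : r.-tuple T) :
  (forall i, round_hp s (\sum_i d i) x i = d i) <->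
  cube ((\sum_i d i)%:~R / r.+1%:R) s (fun j => d (widen_ord (leqnSn r) j)) x.
Proof.
split=> [h j|h i].
  by rewrite -[RHS]h round_widen.
have [ir|ir] := ltnP i r.
  have -> : i = widen_ord (leqnSn r) (Ordinal ir) by apply: val_inj.
  by rewrite round_widen; exact: h.
have -> : i = ord_max by apply: val_inj => /=; have := ltn_ord i; lia.
rewrite round_max (eq_bigr (fun j => d (widen_ord (leqnSn r) j))) => [|j _]; last exact: h.
by rewrite [X in X - _]big_ord_recr /= addrAC subrr add0r.
Qed.

End Rounding.

Section Sampling.
Variables (R : realType) (k' l' : nat).
Local Notation k := k'.+1.
Local Notation l := l'.+1.
Local Notation m := (k + l)%N.
Local Notation T := (measurableTypeR R).
Local Notation Om := (k'.+1.-tuple T * l'.-tuple T)%type.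
Local Notation leb := (@lebesgue_measure R).
Local Notation tmu := (tuple_lebesgue R).
Local Notation mu := (tmu k'.+1 \x tmu l')%E.
Local Notation rt n := (Num.sqrt n%:R : R).
Local Notation exc n := (excess k l n).
Implicit Types (z : Om) (n : nat).

Let k0 : (0 < k)%N. Proof. by []. Qed.

(** The first coordinate of z is s, the scaled sum of the row deviations; the column
    deviations then sum to the rest of [excess]. *)
Definition row_excess n z : int := Num.floor (0 + rt n * (thead z.1 : R)).
(** The lattice points next to [row_point z] and [col_point z] scaled up by sqrt n. They satisfy the
    constraint on the total sum, which is why one coordinate for s, k - 1 for the rows and
    l - 1 for the columns are used. *)
Definition row_sample n z : 'I_k -> int := round_hp (rt n) (row_excess n z) (uncons z.1).2.
Definition col_sample n z : 'I_l -> int := round_hp (rt n) (exc n - row_excess n z) z.2.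

(** The coordinates x_i = s / k + x'_i and y_j = - s / l + y'_j of a pair with total sum
    zero, in terms of z = ((s, x'), y'). *)
Definition row_point z : 'I_k -> R := fun i => (thead z.1 : R) / k%:R + hp (uncons z.1).2 i.
Definition col_point z : 'I_l -> R := fun j => - (thead z.1 : R) / l%:R + hp z.2 j.

Lemma sum_samp n z : \sum_i row_sample n z i + \sum_j col_sample n z j = exc n.
Proof. by rewrite !sum_round addrC subrK. Qed.

Definition box n (d : 'I_k -> int) (e : 'I_l -> int) : set Om :=
  [set z | (forall i, row_sample n z i = d i) /\ (forall j, col_sample n z j = e j)].

(** A lattice point is hit from a box of sides 1 / sqrt n: its sum fixes the rounded s, and
    then each of the two roundings is over a cube. *)
Lemma boxE n d e : \sum_i d i + \sum_j e j = exc n ->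
  box n d e =
  (@uncons R k' @^-1` ([set x : T | Num.floor (0 + rt n * x) = \sum_i d i] `*`
     cube ((\sum_i d i)%:~R / k%:R) (rt n) (fun j => d (widen_ord (leqnSn k') j)))) `*`
  cube ((\sum_j e j)%:~R / l%:R) (rt n) (fun j => e (widen_ord (leqnSn l') j)).
Proof.
move=> s; apply/seteqP; split => z /=.
  move=> [h1 h2].
  have t1 : row_excess n z = \sum_i d i by rewrite -(eq_bigr _ (fun i _ => h1 i)) sum_round.
  have t2 : exc n - row_excess n z = \sum_i e i by rewrite -s t1 addrAC subrr add0r.
  split; first split.
  - exact: t1.
  - by apply/round_cube; rewrite -t1; exact: h1.
  - by apply/round_cube; rewrite -t2; exact: h2.
move=> [[h0 /round_cube h1] /round_cube h2].
have t1 : row_excess n z = \sum_i d i by exact: h0.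
have t2 : exc n - row_excess n z = \sum_i e i by rewrite -s t1 addrAC subrr add0r.
by split; [rewrite /row_sample t1; exact: h1 | rewrite /col_sample t2; exact: h2].
Qed.

Lemma measurable_box n d e : (0 < n)%N -> \sum_i d i + \sum_j e j = exc n ->
  measurable (box n d e).
Proof.
move=> n0 s; have rt0 : 0 < rt n by rewrite sqrtr_gt0 ltr0n.
rewrite boxE //; apply: measurableX; last exact: measurable_cube.
rewrite -[X in measurable X]setTI; apply: measurable_uncons => //.
by apply: measurableX; [exact: measurable_floor_interval | exact: measurable_cube].
Qed.

Lemma measure_box n d e : (0 < n)%N -> \sum_i d i + \sum_j e j = exc n ->
  mu (box n d e) = ((rt n)^-1 ^+ (k' + l').+1)%:E.
Proof.
move=> n0 s; have rt0 : 0 < rt n by rewrite sqrtr_gt0 ltr0n.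
rewrite boxE //.
set A := [set x : T | _]; set B := cube _ _ _; set C := cube _ _ _.
have mA : measurable A by exact: measurable_floor_interval.
have mB : measurable B by exact: measurable_cube.
have mC : measurable C by exact: measurable_cube.
have mAB : measurable (@uncons R k' @^-1` (A `*` B)).
  by rewrite -[X in measurable X]setTI; apply: measurable_uncons => //; exact: measurableX.
rewrite product_measure1E //.
transitivity ((leb A * tmu k' B) * tmu l' C)%E.
  by congr (_ * _)%E; exact: (tuple_lebesgue_cons mA mB).
by rewrite lebesgue_floor_interval // !tuple_lebesgue_cube // -!EFinM -exprS -exprD.
Qed.

Let Bd := (2 * m + \sum_(i < k) i + \sum_(j < l) j + k * l)%N.

(** The division remainder is less than k + l. *)
Lemma excess_bound n : `|(exc n)%:~R : R| <= (m + \sum_(i < k) i + \sum_(j < l) j + k * l)%N%:R.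
Proof.
rewrite -intr_norm [leRHS]pmulrn ler_int /excess.
have := ltn_pmod n (m_gt0 l k0); have := divn_eq n m; rewrite mulnC.
by lia.
Qed.

Lemma scaled_close n z : (0 < n)%N ->
  (forall i, `|scaled R n (row_sample n z) i - row_point z i| <= Bd.+1%:R / rt n) /\
  (forall j, `|scaled R n (col_sample n z) j - col_point z j| <= Bd.+1%:R / rt n).
Proof.
move=> n0; have rt0 : 0 < rt n by rewrite sqrtr_gt0 ltr0n.
have fl : `|(row_excess n z)%:~R - rt n * (thead z.1 : R)| <= 1.
  rewrite /row_excess add0r; have /andP[h1 h2] := floor_itv (rt n * (thead z.1 : R)).
  by rewrite distrC ger0_norm ?subr_ge0 // lerBlDl; move: h2; rewrite intrD => /ltW.
have gen r (v : int) (x : r.-tuple T) (a c : R) i : `|v%:~R - rt n * a| <= c ->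
    `|scaled R n (round_hp (rt n) v x) i - (a / r.+1%:R + hp x i)| <= (r.+1%:R + c) / rt n.
  move=> h; rewrite ler_pdivlMr // -[X in _ * X](ger0_norm (ltW rt0)) -normrM.
  have -> : (scaled R n (round_hp (rt n) v x) i - (a / r.+1%:R + hp x i)) * rt n =
    ((round_hp (rt n) v x i)%:~R - (v%:~R / r.+1%:R + rt n * hp x i)) + (v%:~R - rt n * a) / r.+1%:R.
    rewrite mulrBl /scaled divfK ?gt_eqF //; field.
    by rewrite nat1r pnatr_eq0.
  apply: le_trans (ler_normD _ _) _; apply: lerD; first exact: round_hp_close.
  rewrite normrM normfV ler_pdivrMr ?normr_gt0 ?pnatr_eq0 // normr_nat.
  by apply: (le_trans h); rewrite ler_peMr ?ler1n // (le_trans (normr_ge0 _) h).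
split=> i.
  apply: le_trans (gen _ _ _ _ _ _ fl) _; rewrite ler_wpM2r ?invr_ge0 ?(ltW rt0) //.
  by rewrite natr1 ler_nat /Bd; lia.
have fl2 : `|(exc n - row_excess n z)%:~R - rt n * (- (thead z.1 : R))| <=
   (m + \sum_(i < k) i + \sum_(j < l) j + k * l)%N%:R + 1.
  rewrite (_ : _ - _ = (exc n)%:~R - ((row_excess n z)%:~R - rt n * (thead z.1 : R))); last first.
    by rewrite intrB mulrN opprK opprB addrA addrAC.
  by apply: le_trans (ler_normB _ _) _; apply: lerD; [exact: excess_bound | exact: fl].
apply: le_trans (gen _ _ _ _ _ _ fl2) _; rewrite ler_wpM2r ?invr_ge0 ?(ltW rt0) //.
by rewrite natr1 -natrD ler_nat /Bd; lia.
Qed.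

Lemma cvg_samp z : (forall i, scaled R n (row_sample n z) i @[n --> \oo] --> row_point z i) /\
  (forall j, scaled R n (col_sample n z) j @[n --> \oo] --> col_point z j).
Proof.
have sq (u : nat -> R) (a : R) : (forall n, (0 < n)%N -> `|u n - a| <= Bd.+1%:R / rt n) ->
    u n @[n --> \oo] --> a.
  move=> h; have lim (e : R) : (a + e * (rt n)^-1) @[n --> \oo] --> a.
    rewrite -[X in _ --> X]addr0 -(mulr0 e); apply: cvgD; first exact: cvg_cst.
    by apply: cvgM; [exact: cvg_cst | exact: cvg_inv_sqrt].
  apply: (squeeze_cvgr _ (lim (- Bd.+1%:R)) (lim Bd.+1%:R)); near=> n.
  have n0 : (0 < n)%N by near: n; exists 1%N.
  by have := h n n0; rewrite ler_distl mulNr.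
by split=> i; apply: sq => n n0; have [h1 h2] := scaled_close z n0.
Unshelve. all: by end_near. Qed.

End Sampling.

(** * Sums over partitions as integrals *)

Section RiemannSums.
Variables (R : realType) (k' l' : nat).
Local Notation k := k'.+1.
Local Notation l := l'.+1.
Local Notation m := (k + l)%N.
Local Notation T := (measurableTypeR R).
Local Notation Om := (k'.+1.-tuple T * l'.-tuple T)%type.
Local Notation tmu := (tuple_lebesgue R).
Local Notation mu := (tmu k'.+1 \x tmu l')%E.
Local Notation rt n := (Num.sqrt n%:R : R).
Local Notation exc n := (excess k l n).
Local Notation adev la := (@arm_dev k l _ la).
Local Notation ldev la := (@leg_dev k l _ la).
Variables (beta : R) (H : ('I_k -> R) -> ('I_l -> R) -> R).
Hypothesis b0 : 0 < beta.

Let k0 : (0 < k)%N. Proof. by []. Qed.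

Lemma dev_inj n (la mu : intpart n) : is_rect k l la -> is_rect k l mu ->
  la \in hook n k l -> mu \in hook n k l ->
  adev la =1 (adev mu) ->
  ldev la =1 (ldev mu) -> la = mu.
Proof.
move=> rl rm hl hm ha hb; apply: (hook_inj hl hm).
  move=> i ik; have := ha (Ordinal ik); rewrite /arm_dev /arm /=.
  by have := rectP rl ik; have := rectP rm ik; lia.
move=> j jl; have := hb (Ordinal jl); rewrite /leg_dev /leg /=.
by have := conj_ge rl jl; have := conj_ge rm jl; lia.
Qed.

(** A nonzero [gcore] forces the deviations to be those of arms and legs. *)
Lemma dev_surj n (d : 'I_k -> int) (e : 'I_l -> int) : (m <= n)%N ->
  \sum_i d i + \sum_j e j = exc n -> gcore R n d e != 0 ->
  exists la : intpart n, [/\ la \in hook n k l, is_rect k l la,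
    adev la =1 d & ldev la =1 e].
Proof.
move=> mn s /gcore_neq0[hd he dd de].
pose M := (n %/ m)%N.
pose a (i : nat) := absz (M%:Z + d (inord i)).
pose b (j : nat) := absz (M%:Z + e (inord j)).
have ad i : (a i)%:Z = M%:Z + d (inord i) by rewrite gez0_abs.
have be j : (b j)%:Z = M%:Z + e (inord j) by rewrite gez0_abs.
have da i j : (i < j < k)%N -> (a j < a i)%N.
  move=> /andP[ij jk]; rewrite -ltz_nat !ad ltrD2l dd // !inordK //.
  exact: ltn_trans jk.
have db i j : (i < j < l)%N -> (b j < b i)%N.
  move=> /andP[ij jk]; rewrite -ltz_nat !be ltrD2l de // !inordK //.
  exact: ltn_trans jk.
have sab : (\sum_(i < k) a i + \sum_(j < l) b j + k * l =
    n + \sum_(i < k) i + \sum_(j < l) j)%N.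
  have sa : \sum_(i < k) d i = (\sum_(i < k) a i)%N%:Z - (k * M)%N%:Z.
    by rewrite -sum_shift; apply: eq_bigr => i _; rewrite ad inord_val addrC addKr.
  have sb : \sum_(i < l) e i = (\sum_(i < l) b i)%N%:Z - (l * M)%N%:Z.
    by rewrite -sum_shift; apply: eq_bigr => i _; rewrite be inord_val addrC addKr.
  have : (\sum_(i < k) a i)%N%:Z - (k * M)%N%:Z + ((\sum_(i < l) b i)%N%:Z - (l * M)%N%:Z) = exc n.
    by rewrite -sa -sb.
  by rewrite /excess [(m * _)%N]mulnDl -/M; lia.
have [la [h1 h2 h3 h4]] := hook_surj da db sab.
exists la; split=> // i; rewrite /arm_dev /leg_dev ?h3 ?h4 // ?ad ?be inord_val addrC addKr //.
Qed.

Definition sample_term n (z : Om) : R :=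
  H (scaled R n (row_sample n z)) (scaled R n (col_sample n z)) *
  gcore R n (row_sample n z) (col_sample n z) `^ beta.

Definition part_term n (la : intpart n) : R :=
  H (scaled R n (adev la)) (scaled R n (ldev la)) *
  gcore R n (adev la) (ldev la) `^ beta.

(** The sampled term is a step function: it takes on the box of a partition the value of
    that partition, and vanishes where the sampled point comes from no partition. *)
Lemma sample_termE n z : (m <= n)%N -> sample_term n z =
  \sum_(la in hook n k l | is_rect k l la)
    part_term la * \1_(box n (adev la) (ldev la)) z.
Proof.
move=> mn.
have inbox (la : intpart n) : box n (adev la) (ldev la) z -> sample_term n z = part_term la.
  move=> [h1 h2]; rewrite /sample_term /part_term.
  have -> : row_sample n z = adev la by apply/funext.
  by have -> : col_sample n z = ldev la by apply/funext.
have [g0|g0] := eqVneq (gcore R n (row_sample n z) (col_sample n z)) 0.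
  have F0 : sample_term n z = 0 by rewrite /sample_term g0 powR0 ?mulr0 // gt_eqF.
  rewrite F0 big1 // => la _; rewrite indicE; case: (boolP (z \in _)); last by move=> _; rewrite mulr0n mulr0.
  by move=> /set_mem/inbox; rewrite F0 => <-; rewrite mul0r.
have [la [h1 h2 h3 h4]] := dev_surj mn (sum_samp n z) g0.
have zb : box n (adev la) (ldev la) z by split=> i; rewrite ?h3 ?h4.
rewrite (bigD1 la) /=; last by rewrite h1.
rewrite indicE mem_set // mulr1 -(inbox la zb) big1 ?addr0 // => mu /andP[/andP[m1 m2] ml].
rewrite indicE; case: (boolP (z \in _)); last by move=> _; rewrite mulr0n mulr0.
move/set_mem => [q1 q2]; case/eqP: ml; apply: dev_inj => // i.
  by rewrite -q1 h3.
by rewrite -q2 h4.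
Qed.

Lemma hook_dev_sum n (la : intpart n) : (m <= n)%N -> la \in hook n k l -> is_rect k l la ->
  \sum_i (adev la) i + \sum_j (ldev la) j = exc n.
Proof. by move=> mn h r; apply: dev_sum => //; apply: leq_trans mn; exact: leq_addr. Qed.

Lemma integrable_box n (la : intpart n) (c : R) : (m <= n)%N -> la \in hook n k l -> is_rect k l la ->
  mu.-integrable setT (fun z : Om => (c * \1_(box n (adev la) (ldev la)) z)%:E).
Proof.
move=> mn h r; have n0 : (0 < n)%N by apply: leq_trans mn.
have mB : measurable (box n (adev la) (ldev la) : set Om).
  by apply: measurable_box => //; exact: hook_dev_sum.
have : mu.-integrable setT (fun z : Om => (\1_(box n (adev la) (ldev la)) z : R)%:E).
  apply/integrableP; split; first by apply/measurable_EFinP; exact: measurable_indic.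
  under eq_integral do rewrite abse_EFin ger0_norm //.
  rewrite integral_indic // setIT [X in (X < _)%E](_ : _ = ((rt n)^-1 ^+ (k' + l').+1)%:E) ?ltry //.
  by apply: measure_box => //; exact: hook_dev_sum.
by move=> /(integrableZl measurableT c).
Qed.

(** All boxes have the same measure, so the integral of the step function is the sum over
    partitions up to this measure. *)
Lemma integral_sample_term n : (m <= n)%N ->
  mu.-integrable setT (EFin \o sample_term n) /\
  (\int[mu]_z (sample_term n z)%:E)%E =
  ((\sum_(la in hook n k l | is_rect k l la) part_term la) * (rt n)^-1 ^+ (k' + l').+1)%:E.
Proof.
move=> mn; have n0 : (0 < n)%N by apply: leq_trans mn.
pose c (la : intpart n) : R := if (la \in hook n k l) && is_rect k l la then part_term la else 0.
pose f (la : intpart n) (z : Om) : \bar R :=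
  ((if (la \in hook n k l) && is_rect k l la then part_term la * \1_(box n (adev la) (ldev la)) z else 0)%:E).
have fi la : mu.-integrable setT (f la).
  rewrite /f; case: (boolP ((la \in hook n k l) && is_rect k l la)) => [/andP[h r]|_].
    exact: integrable_box.
  exact: integrable0.
have fE : (EFin \o sample_term n) = (fun z => \sum_(la <- index_enum (intpart n)) f la z)%E.
  apply/funext => z /=; rewrite sample_termE // big_mkcond -sumEFin.
  by apply: eq_bigr.
rewrite -[X in X = _ :> \bar R]/(\int[mu]_z (EFin \o sample_term n) z)%E fE.
split; first by apply: integrable_sum.
rewrite integral_sum // mulr_suml -sumEFin [RHS]big_mkcond /=; apply: eq_bigr => la _.
rewrite /f; case: (boolP ((la \in hook n k l) && is_rect k l la)) => [/andP[h r]|_]; last first.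
  by rewrite integral0.
have mB : measurable (box n (adev la) (ldev la) : set Om).
  by apply: measurable_box => //; exact: hook_dev_sum.
under eq_integral do rewrite EFinM.
rewrite integralZl //; last first.
  by have := integrable_box 1 mn h r; congr (integrable _ _ _); apply/funext => z; rewrite mul1r.
rewrite integral_indic // setIT [X in (_ * X)%E](_ : _ = ((rt n)^-1 ^+ (k' + l').+1)%:E) ?EFinM //.
by apply: measure_box => //; exact: hook_dev_sum.
Qed.

End RiemannSums.

(** * Passing to the limit under the integral *)

Section SumSq.
Variable R : realType.
Local Notation T := (measurableTypeR R).

(** The constant vector is orthogonal to the hyperplane of zero sum. *)
Lemma sumsq_shift r (a : R) (x : r.-tuple T) :
  sumsq (fun i => a + hp x i) = r.+1%:R * a ^+ 2 + sumsq (hp x).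
Proof.
rewrite /sumsq; under eq_bigr do rewrite sqrrD.
rewrite !big_split /= sumr_const card_ord; congr (_ + _).
by rewrite -mulr_sumr sum_hp !mulr0 !addr0 mulr_natl.
Qed.

Lemma sumsq_uncons r (u : r.+1.-tuple T) :
  \sum_(i < r.+1) (tnth u i : R) ^+ 2 =
  (thead u : R) ^+ 2 + \sum_(j < r) (tnth (uncons u).2 j : R) ^+ 2.
Proof.
rewrite big_ord_recl; congr (_ + _).
by apply: eq_bigr => j _; rewrite tnth_uncons.
Qed.

Lemma pvander_shift n (a : R) (x : 'I_n -> R) : pvander (fun i => a + x i) = pvander x.
Proof.
apply: eq_bigr => i _; apply: eq_bigr => j _; congr (Num.max _ _).
by rewrite opprD addrACA subrr add0r.
Qed.

Lemma sqr_close (a b B : R) : `|a - b| <= B -> b ^+ 2 / 2 - B ^+ 2 <= a ^+ 2.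
Proof.
move=> h; have : (a - b) ^+ 2 <= B ^+ 2.
  by rewrite -[(a - b) ^+ 2]real_normK ?num_real // lerXn2r ?nnegrE // (le_trans _ h).
have := sqr_ge0 (2 * a - b); nra.
Qed.

End SumSq.

Section Convergence.
Variables (R : realType) (k' l' : nat).
Local Notation k := k'.+1.
Local Notation l := l'.+1.
Local Notation m := (k + l)%N.
Local Notation T := (measurableTypeR R).
Local Notation Om := (k'.+1.-tuple T * l'.-tuple T)%type.
Local Notation tmu := (tuple_lebesgue R).
Local Notation mu := (tmu k'.+1 \x tmu l')%E.
Local Notation rt n := (Num.sqrt n%:R : R).
Variables (beta : R) (H : ('I_k -> R) -> ('I_l -> R) -> R).
Hypothesis b0 : 0 < beta.
Hypothesis Hbound : forall x y, `|H x y| <= 1 + (sumsq x + sumsq y).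
Hypothesis Hcvg : forall (xn : nat -> 'I_k -> R) (yn : nat -> 'I_l -> R) x y,
  (forall i, xn n i @[n --> \oo] --> x i) ->
  (forall j, yn n j @[n --> \oo] --> y j) -> H (xn n) (yn n) @[n --> \oo] --> H x y.

Let k0 : (0 < k)%N. Proof. by []. Qed.

Definition core_lim (x : 'I_k -> R) (y : 'I_l -> R) : R :=
  pvander x * pvander y *
    (expR (- (m%:R / 2) * sumsq x) * expR (- (m%:R / 2) * sumsq y)) *
    ((m%:R / 2) ^+ l) ^+ k.

Definition limit_term (z : Om) : R :=
  H (row_point z) (col_point z) * core_lim (row_point z) (col_point z) `^ beta.

Lemma core_lim_ge0 x y : 0 <= core_lim x y.
Proof.
by rewrite !mulr_ge0 ?pvander_ge0 ?expR_ge0 // !exprn_ge0 // divr_ge0.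
Qed.

Lemma cvg_sample_term z : sample_term beta H n z @[n --> \oo] --> limit_term z.
Proof.
have [h1 h2] := cvg_samp z; apply: cvgM; first exact: Hcvg.
apply: cvg_powR => //; first exact: core_lim_ge0.
  by move=> n; exact: gcore_ge0.
exact: cvg_gcore.
Qed.

(** [gcore_bound] is a Gaussian bound in the sampled point, which is within a constant of z;
    hence a Gaussian bound in z, with a smaller rate. *)
Lemma sample_term_dominated : exists2 C : R, 0 < C & exists2 c : R, 0 < c &
  forall n (z : Om), (m <= n)%N ->
  `|sample_term beta H n z| <= C * (gaussT c z.1 * gaussT c z.2).
Proof.
have [C C0 [c c0 hC]] := gcore_bound l k0 b0.
have [B B0 hB] : exists2 B : R, 0 <= B & forall n (z : Om), (0 < n)%N ->
  (forall i, `|scaled R n (row_sample n z) i - row_point z i| <= B / rt n) /\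
  (forall j, `|scaled R n (col_sample n z) j - col_point z j| <= B / rt n).
  by eexists; last (move=> n z n0; exact: scaled_close); exact: ler0n.
exists (C * expR (c * (m%:R * B ^+ 2))); first by rewrite mulr_gt0 ?expR_gt0.
exists (c / (2 * k%:R)) => [|n z mn]; first by rewrite divr_gt0 ?mulr_gt0 ?ltr0n.
have n0 : (0 < n)%N by apply: leq_trans mn.
set S := total_sq R n (row_sample n z) (col_sample n z).
have h1 : `|sample_term beta H n z| <= C * expR (- (c * S)).
  apply: le_trans (hC _ _ _ mn (sum_samp n z)).
  by rewrite normrM (ger0_norm (powR_ge0 _ _)) ler_wpM2r ?powR_ge0.
apply: le_trans h1 _; rewrite -mulrA ler_wpM2l ?(ltW C0) // /gaussT -!expRD ler_expR.
have [hd he] := hB n z n0.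
have rt1 : 1 <= rt n by rewrite -[X in X <= _]sqrtr1 ler_wsqrtr // ler1n.
have rt0 : 0 < rt n by apply: lt_le_trans rt1.
have Brt : B / rt n <= B by rewrite ler_pdivrMr // ler_peMr.
have low r (x y : 'I_r -> R) : (forall i, `|x i - y i| <= B / rt n) ->
    sumsq y / 2 - r%:R * B ^+ 2 <= sumsq x.
  move=> h; rewrite /sumsq mulr_suml mulr_natl -[r in X in _ - X]card_ord -sumr_const -sumrB.
  by apply: ler_sum => i _; apply: sqr_close; apply: le_trans (h i) Brt.
have ld := low _ _ _ hd; have le := low _ _ _ he.
(* The weight 1 / k accommodates the coordinate s, which enters with k (s / k)^2. *)
have sd : k%:R^-1 * \sum_(i < k) (tnth z.1 i : R) ^+ 2 <= sumsq (row_point z).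
  rewrite sumsq_shift sumsq_uncons mulrDr; apply: lerD.
    have kn : k%:R != 0 :> R by rewrite pnatr_eq0.
    by rewrite le_eqVlt; apply/orP; left; apply/eqP; set a := thead _; move: kn; set q := k%:R => kn; field.
  apply: le_trans (sumsq_hp _); rewrite ler_piMl ?invf_le1 ?ltr0n ?ler1n //.
  by apply: sumr_ge0 => i _; exact: sqr_ge0.
have se : k%:R^-1 * \sum_(i < l') (tnth z.2 i : R) ^+ 2 <= sumsq (col_point z).
  rewrite sumsq_shift; apply: (@le_trans _ _ (sumsq (hp z.2))).
    apply: le_trans (sumsq_hp _); rewrite ler_piMl ?invf_le1 ?ltr0n ?ler1n //.
    by apply: sumr_ge0 => i _; exact: sqr_ge0.
  by rewrite lerDr mulr_ge0 ?sqr_ge0.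
have hS : (sumsq (row_point z) + sumsq (col_point z)) / 2 - m%:R * B ^+ 2 <= S.
  rewrite /S /total_sq natrD; move: ld le.
  move: (sumsq (row_point z)) (sumsq (col_point z)) (sumsq (scaled R n (row_sample n z))).
  move: (sumsq (scaled R n (col_sample n z))) (k%:R : R) (l%:R : R) (B ^+ 2) => a1 a2 a3 a4 a5 a6 a7.
  by lra.
have : c * ((k%:R^-1 * \sum_(i < k) (tnth z.1 i : R) ^+ 2 +
   k%:R^-1 * \sum_(i < l') (tnth z.2 i : R) ^+ 2) / 2 - m%:R * B ^+ 2) <= c * S.
  rewrite ler_pM2l //; apply: le_trans hS; rewrite lerD2r ler_pM2r ?invr_gt0 //; exact: lerD.
set U := \sum_(i < k) _; set V := \sum_(i < l') _ => h.
rewrite (_ : c * (m%:R * B ^+ 2) + _ = - (c * ((k%:R^-1 * U + k%:R^-1 * V) / 2 - m%:R * B ^+ 2))).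
  by rewrite lerN2.
by field; rewrite nat1r pnatr_eq0.
Qed.

(** Rounding moves z by O(1 / sqrt n), so the step functions converge pointwise, and
    [sample_term_dominated] allows dominated convergence. *)
Lemma limit_term_cvg : mu.-integrable setT (EFin \o limit_term) /\
  (\sum_(la in hook n k l | is_rect k l la) part_term beta H la) *
     (rt n)^-1 ^+ (k' + l').+1 @[n --> \oo] --> \int[mu]_z limit_term z.
Proof.
have [C C0 [c c0 dom]] := sample_term_dominated.
pose f n := EFin \o sample_term beta H (n + m).
pose g (z : Om) : \bar R := (C%:E * (gaussT c z.1 * gaussT c z.2)%:E)%E.
have mn n : (m <= n + m)%N by exact: leq_addl.
have mf n : measurable_fun setT (f n).
  by have [/measurable_int] := integral_sample_term H b0 (mn n).
have mlim : measurable_fun setT limit_term.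
  apply: (@measurable_fun_cvg _ _ _ _ (fun n => sample_term beta H (n + m))).
    by move=> n; apply/measurable_EFinP; exact: mf.
  move=> z _; rewrite (@cvg_shiftn m _ (fun n => sample_term beta H n z)).
  exact: cvg_sample_term.
have ig : mu.-integrable setT g.
  apply: integrableZl => //.
  by apply: integrable_prodf; exact: integrable_gaussT.
have [] := @dominated_convergence _ _ _ mu setT measurableT f (EFin \o limit_term) g.
- exact: mf.
- exact/measurable_EFinP.
- apply: aeW => z _; apply: cvg_EFin; first by near=> n.
  rewrite (@cvg_shiftn m _ (fun n => sample_term beta H n z)).
  exact: cvg_sample_term.
- exact: ig.
- apply: aeW => z n _; rewrite /f /g /= lee_fin; exact: dom.
move=> il _ cv; split => //.
pose a (n : nat) : R := (\sum_(la in hook n k l | is_rect k l la) part_term beta H la) *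
     (rt n)^-1 ^+ (k' + l').+1.
rewrite -(@cvg_shiftn m _ a).
have e : [sequence (\int[mu]_(z in setT) f n z)%E]_n = (fun n => (a (n + m)%N)%:E).
  by apply/funext => n; have [_ <-] := integral_sample_term H b0 (mn n).
move: cv; rewrite e -(fineK (integrable_fin_num measurableT il)).
exact: fine_cvg.
Unshelve. all: by end_near. Qed.

End Convergence.

(** * The limiting integrals *)

Section LimitIntegrals.
Variables (R : realType) (k' l' : nat).
Local Notation k := k'.+1.
Local Notation l := l'.+1.
Local Notation m := (k + l)%N.
Local Notation T := (measurableTypeR R).
Local Notation Om := (k'.+1.-tuple T * l'.-tuple T)%type.
Local Notation leb := (@lebesgue_measure R).
Local Notation tmu := (tuple_lebesgue R).
Local Notation mu := (tmu k'.+1 \x tmu l')%E.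
Variable beta : R.
Hypothesis b0 : 0 < beta.

Lemma integral_gauss_gt0 (c : R) : 0 < c -> 0 < \int[leb]_x expR (- (c * (x : R) ^+ 2)).
Proof.
move=> c0; pose s := Num.sqrt ((2 * c)^-1).
have s2 : s ^+ 2 = (2 * c)^-1 by rewrite sqr_sqrtr // invr_ge0 mulr_ge0 // ltW.
have s0 : s != 0 by rewrite gt_eqF // sqrtr_gt0 invr_gt0 mulr_gt0.
have e : (fun x : R => expR (- (c * x ^+ 2))) = (fun x => (normal_peak s)^-1 * normal_pdf 0 s x).
  apply/funext => x; rewrite normal_pdfE // mulKf ?gt_eqF ?normal_peak_gt0 //.
  rewrite /normal_fun subr0; congr expR.
  have cn : c != 0 by rewrite gt_eqF.
  by rewrite s2; field.
rewrite e RintegralZl //; last exact: integrable_normal_pdf.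
have p0 : 0 < (normal_peak s)^-1.
  by have := normal_peak_gt0 s0; move: (normal_peak s) => t t0; rewrite invr_gt0.
rewrite (_ : Rintegral _ _ _ = 1) ?mulr1 //.
have h : (\int[leb]_x (normal_pdf 0 s x)%:E)%E = 1%E by exact: integral_normal_pdf.
by rewrite /Rintegral h.
Qed.

Lemma integral_triple (f1 : T -> R) (f2 : k'.-tuple T -> R) (f3 : l'.-tuple T -> R) :
  leb.-integrable setT (EFin \o f1) -> (tmu k').-integrable setT (EFin \o f2) ->
  (tmu l').-integrable setT (EFin \o f3) ->
  mu.-integrable setT (fun z : Om => (f1 (thead z.1) * f2 (uncons z.1).2 * f3 z.2)%:E) /\
  \int[mu]_z (f1 (thead z.1) * f2 (uncons z.1).2 * f3 z.2) =
  (\int[leb]_s f1 s) * (\int[tmu k']_x f2 x) * (\int[tmu l']_y f3 y).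
Proof.
move=> i1 i2 i3; have i12 := integrable_prodf i1 i2.
have iu := integrable_uncons i12.
split; first exact: (integrable_prodf iu i3).
rewrite (integral_prodf iu i3); congr (_ * _).
by rewrite -(integral_prodf i1 i2) -(integral_uncons i12).
Qed.

Let c : R := m%:R / 2.
Let a : R := c * beta * (k%:R^-1 + l%:R^-1).
Let C0 : R := ((c ^+ l) ^+ k) `^ beta.

Let c_gt0 : 0 < c. Proof. by rewrite divr_gt0 ?ltr0n. Qed.
Let a_gt0 : 0 < a.
Proof. by rewrite !mulr_gt0 // addr_gt0 ?invr_gt0 ?ltr0n. Qed.
Let C0_gt0 : 0 < C0. Proof. by rewrite powR_gt0 // !exprn_gt0. Qed.

(** The limiting density is a Gaussian in s times the two chamber weights. *)
Lemma core_lim_split (z : Om) : core_lim (row_point z) (col_point z) `^ beta =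
  C0 * (expR (- (a * (thead z.1 : R) ^+ 2)) * cweight c beta (hp (uncons z.1).2) *
        cweight c beta (hp z.2)).
Proof.
rewrite /core_lim !pvander_shift !sumsq_shift -/c /cweight.
set X := hp _; set Y := hp _; set s : R := thead _.
rewrite [X in X `^ beta](_ : _ = (c ^+ l) ^+ k * (expR (- (a / beta * s ^+ 2)) *
   (pvander X * expR (- c * sumsq X)) * (pvander Y * expR (- c * sumsq Y)))).
  rewrite !powRM ?mulr_ge0 ?pvander_ge0 ?expR_ge0 ?exprn_ge0 ?(ltW c_gt0) //.
  by rewrite -!expRM; congr (_ * (expR _ * _ * _)); field; rewrite gt_eqF.
rewrite !mulrDr !expRD.
have -> : expR (- (a / beta * s ^+ 2)) =
   expR (- c * (k%:R * (s / k%:R) ^+ 2)) * expR (- c * (l%:R * (- s / l%:R) ^+ 2)).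
  rewrite -expRD; congr expR; rewrite /a.
  have kn : k%:R != 0 :> R by rewrite pnatr_eq0.
  have ln : l%:R != 0 :> R by rewrite pnatr_eq0.
  have bn : beta != 0 by rewrite gt_eqF.
  by move: kn ln; set u := k%:R; set v := l%:R => un vn; field; do ?[apply/andP; split => //].
ring.
Qed.

Let G := \int[leb]_x expR (- (a * (x : R) ^+ 2)).
Let Wk := \int[tmu k']_x (cweight c beta (hp x) : R).
Let Wl := \int[tmu l']_x (cweight c beta (hp x) : R).

Lemma integral_limit_term1 : \int[mu]_z limit_term beta (fun _ _ => 1) z = C0 * (G * Wk * Wl).
Proof.
have [i e] := integral_triple (integrable_gauss1 a_gt0)
  (integrable_cweight_hp1 k' c_gt0 b0) (integrable_cweight_hp1 l' c_gt0 b0).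
rewrite -e -RintegralZl //.
by apply: eq_Rintegral => z _; rewrite /limit_term mul1r core_lim_split.
Qed.

Lemma integral_limit_term1_gt0 : 0 < C0 * (G * Wk * Wl).
Proof.
by rewrite !mulr_gt0 ?integral_gauss_gt0 ?integral_cweight_gt0.
Qed.

Lemma integrable_coord_cweight r (p : 'I_r.+1) :
  (tmu r).-integrable setT (fun x => (hp x p * cweight c beta (hp x))%:E).
Proof.
apply: integrable_cweight_hp => //; first exact: measurable_hp.
by move=> x; exact: norm_le_sumsq.
Qed.

Lemma integrable_sgauss b : leb.-integrable setT (fun x : T => ((x : R) / b * expR (- (a * (x : R) ^+ 2)))%:E).
Proof.
have [C1 C10 h1] := gauss_absorb 1 a_gt0.
have a2 : 0 < a / 2 by rewrite divr_gt0.
have := integrableZl measurableT (`|b^-1| * C1) (integrable_gauss1 a2).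
apply: le_integrable => //.
  apply/measurable_EFinP/measurable_funM; first exact: measurable_funM.
  apply: (measurableT_comp (@measurable_expR R)).
  by apply: measurable_funN; apply: measurable_funM => //; exact: measurable_funX.
move=> x _; rewrite -EFinM !abse_EFin lee_fin /= !normrM (gtr0_norm C10) !(ger0_norm (expR_ge0 _)) normr_id.
rewrite [`|x| * _]mulrC -[leLHS]mulrA -[leRHS]mulrA ler_wpM2l //.
apply: le_trans (h1 _ (sqr_ge0 x)); rewrite expr1 ler_wpM2r ?expR_ge0 //.
rewrite -[X in 1 + X]real_normK ?num_real //; have := sqr_ge0 (`|x : R| - 1); have := normr_ge0 (x : R); nra.
Qed.

Lemma integral_sgauss b : \int[leb]_x ((x : R) / b * expR (- (a * (x : R) ^+ 2))) = 0.
Proof.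
apply: (Rintegral_odd (f := fun x => (x : R) / b * expR (- (a * (x : R) ^+ 2)))).
  exact: integrable_sgauss.
by move=> x; rewrite !mulNr sqrrN.
Qed.

(** The coordinate is s / k + x'_p. The part s / k integrates to zero as an odd function
    of s, and the part x'_p factors. *)
Lemma integral_limit_row (p : 'I_k) : \int[mu]_z limit_term beta (fun x _ => x p) z =
  C0 * (G * (\int[tmu k']_x (hp x p * cweight c beta (hp x))) * Wl).
Proof.
have [i1 e1] := integral_triple (integrable_sgauss k%:R)
  (integrable_cweight_hp1 k' c_gt0 b0) (integrable_cweight_hp1 l' c_gt0 b0).
have [i2 e2] := integral_triple (integrable_gauss1 a_gt0)
  (integrable_coord_cweight p) (integrable_cweight_hp1 l' c_gt0 b0).
rewrite -[G * _ * _]add0r -e2.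
have <- : \int[mu]_z ((thead z.1 : R) / k%:R * expR (- (a * (thead z.1 : R) ^+ 2)) *
   cweight c beta (hp (uncons z.1).2) * cweight c beta (hp z.2)) = 0.
  by rewrite e1 integral_sgauss !mul0r.
rewrite -RintegralD // -RintegralZl //; last exact: (integrableD measurableT i1 i2).
by apply: eq_Rintegral => z _; rewrite /limit_term core_lim_split /row_point; ring.
Qed.

Lemma integral_limit_col (q : 'I_l) : \int[mu]_z limit_term beta (fun _ y => y q) z =
  C0 * (G * Wk * (\int[tmu l']_y (hp y q * cweight c beta (hp y)))).
Proof.
have [i1 e1] := integral_triple (integrable_sgauss (- l%:R))
  (integrable_cweight_hp1 k' c_gt0 b0) (integrable_cweight_hp1 l' c_gt0 b0).
have [i2 e2] := integral_triple (integrable_gauss1 a_gt0)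
  (integrable_cweight_hp1 k' c_gt0 b0) (integrable_coord_cweight q).
rewrite -[G * _ * _]add0r -e2.
have <- : \int[mu]_z ((thead z.1 : R) / (- l%:R) * expR (- (a * (thead z.1 : R) ^+ 2)) *
   cweight c beta (hp (uncons z.1).2) * cweight c beta (hp z.2)) = 0.
  by rewrite e1 integral_sgauss !mul0r.
rewrite -RintegralD // -RintegralZl //; last exact: (integrableD measurableT i1 i2).
by apply: eq_Rintegral => z _; rewrite /limit_term core_lim_split /col_point invrN; ring.
Qed.

End LimitIntegrals.

(** * Partitions without the full rectangle *)

Section Defective.
Variables (R : realType) (k l : nat).
Hypothesis (k0 : (0 < k)%N).
Local Notation m := (k + l)%N.

(** A partition of the hook is determined by k rows and l columns of length at most n. *)
Lemma card_hook n : (#|hook n k l| <= n.+1 ^ m)%N.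
Proof.
pose f (la : intpart n) : {ffun 'I_k -> 'I_n.+1} * {ffun 'I_l -> 'I_n.+1} :=
  ([ffun i : 'I_k => inord (part la i)], [ffun j : 'I_l => inord (conj_part la j)]).
have fi : {in hook n k l &, injective f}.
  move=> la mu hl hm [/ffunP h1 /ffunP h2]; apply: (hook_inj hl hm).
    move=> i ik; have := congr1 val (h1 (Ordinal ik)); rewrite !ffunE /= !inordK //.
      by rewrite ltnS; exact: shape_le (part_shape mu).
    by rewrite ltnS; exact: shape_le (part_shape la).
  move=> i ik; have := congr1 val (h2 (Ordinal ik)); rewrite !ffunE /= !inordK //.
    by rewrite ltnS; exact: conj_le.
  by rewrite ltnS; exact: conj_le.
rewrite -(card_in_imset fi); apply: leq_trans (max_card _) _.
by rewrite card_prod !card_ffun !card_ord expnD.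
Qed.

(** The exponents of M in the product formula of the smaller hook and in the norming
    factor of the full one differ by d + 2 d M, where d is the number of missing rows. *)
Lemma excess_diff (k2 l2 d n M sA sB s1 s2 s3 s4 : nat) :
  (sA + sB + k2 * l2 = n + s1 + s2)%N -> (2 * s1 + k2 = k2 * k2)%N -> (2 * s2 + l2 = l2 * l2)%N ->
  (2 * s3 + (k2 + d) = (k2 + d) * (k2 + d))%N -> (2 * s4 + (l2 + d) = (l2 + d) * (l2 + d))%N ->
  n%:Z + s3%:Z + s4%:Z - ((k2 + d) * (l2 + d))%N%:Z - ((k2 + d + (l2 + d)) * M)%N%:Z
   - (sA%:Z - (k2 * M)%N%:Z + (sB%:Z - (l2 * M)%N%:Z)) = - (d%:Z + (2 * d * M)%N%:Z) :> int.
Proof.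
rewrite !mulnDl !mulnDr => h1 h2 h3 h4 h5.
have := mulnC k2 d; have := mulnC l2 d; have := mulnC k2 l2.
lia.
Qed.

Lemma double_sum_ord r : (2 * \sum_(i < r) i + r = r * r)%N.
Proof.
elim: r => [|r IH]; first by rewrite big_ord0.
have -> : (\sum_(i < r.+1) i = \sum_(i < r) i + r)%N by rewrite big_ord_recr.
by move: IH; move: (\sum_(i < r) i)%N => s; lia.
Qed.

Lemma vander_le n r (a : nat -> nat) : (forall i, (i < r)%N -> (a i <= 2 * n)%N) -> (0 < n)%N ->
  (forall i j, (i < j < r)%N -> (a j < a i)%N) ->
  0 <= vander (fun i : 'I_r => (a i)%:R : R) <= (2 * n)%:R ^+ (r * r).
Proof.
move=> ha n0 hd; have n1 : 1 <= (2 * n)%:R :> R by rewrite ler1n muln_gt0.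
rewrite prodr_ge0 /=; last first.
  move=> i _; apply: prodr_ge0 => j ij.
  by rewrite subr_ge0 ler_nat ltnW // hd // ij ltn_ord.
rewrite exprM -[X in _ ^+ X]card_ord -prodr_const; apply: ler_prod => i _.
rewrite prodr_ge0 /=; last first.
  by move=> j ij; rewrite subr_ge0 ler_nat ltnW // hd // ij ltn_ord.
rewrite big_mkcond -[X in _ ^+ X]card_ord -prodr_const; apply: ler_prod => j _.
case: ifP => ij; last by rewrite ler01.
rewrite subr_ge0 ler_nat ltnW ?hd ?ij ?ltn_ord //=.
by rewrite lerBlDr (le_trans (_ : _ <= (2 * n)%:R)) ?lerDl // ler_nat ha.
Qed.

(** M! / M^M is the value of [phi] at - M, so the Gaussian bound makes it exponentially
    small. *)
Lemma fact_pow_le n : (m <= n)%N ->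
  (n %/ m)`!%:R / (n %/ m)%:R ^+ (n %/ m) <= expR 1 * expR (- ((4 * m)%:R^-1 * n%:R)) :> R.
Proof.
move=> mn; have M0 := divn_gt0m k0 mn; have m0 := m_gt0 l k0.
have nM : (n < m * (n %/ m).+1)%N by rewrite mulnC ltn_ceil.
set M := (n %/ m)%N in M0 nM *.
have -> : M`!%:R / M%:R ^+ M = phi R M (- M%:Z).
  by rewrite /phi subrr lexx /= fact0 divr1 exprnN.
apply: le_trans (phi_upper R (- M%:Z) M0) _.
rewrite rmorphN normrN normr_nat -expRD ler_expR.
have Mr : 0 < M%:R :> R by rewrite ltr0n.
have mr : 0 < m%:R :> R by rewrite ltr0n.
have -> : - ((M%:R ^+ 2 - M%:R) / (2 * (M%:R + M%:R))) = - ((M%:R - 1) / 4) :> R.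
  by move: Mr; move: (M%:R : R) => x x0; field; rewrite gt_eqF // addr_gt0.
have : n%:R <= m%:R * (M%:R + 1) :> R by rewrite natr1 -natrM ler_nat ltnW.
rewrite natrM invfM -mulrA -ler_pdivrMl // => h.
set t := m%:R^-1 * n%:R in h *.
lra.
Qed.

(** The product formula in the smaller hook has 2 d arms and legs fewer, each of which would
    have contributed a factor near M^M / M!. Compared with the norming factor of the full hook
    a factor (M! / M^M)^(2 d) remains, exponentially small by [fact_pow_le], while everything
    else is polynomial in n. *)
Lemma defective_le : exists2 C : R, 0 < C & exists2 c : R, 0 < c &
  forall n (la : intpart n), (m <= n)%N -> la \in hook n k l -> ~~ is_rect k l la ->
  (num_SYT la)%:R / norming R k l n <= C * expR (- (c * n%:R)).
Proof.
have m0 := m_gt0 l k0.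
pose c : R := (4 * m)%:R^-1.
have c0 : 0 < c by rewrite invr_gt0 ltr0n muln_gt0.
pose E := (k * k + l * l + k * l)%N.
have [C1 C10 h1] := gauss_absorb E c0.
exists (2 ^+ E * expR 1 * C1); first by rewrite !mulr_gt0 ?exprn_gt0 ?expR_gt0.
exists (c / 2) => [|n la mn hk nr]; first by rewrite divr_gt0.
have n0 : (0 < n)%N by apply: leq_trans mn.
have M0 := divn_gt0m k0 mn.
have [d [dk dl hk2 r2]] := hook_defect hk.
have d0 : (0 < d)%N by case: d r2 {dk dl hk2} => //; rewrite !subn0 (negbTE nr).
set k2 := (k - d)%N in hk2 r2; set l2 := (l - d)%N in hk2 r2.
have k2n : (k2 <= n)%N by lia.
have pos := norming_gt0 R k0 mn.
have hf := num_SYT_hook k2n r2 hk2 R.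
have hs := sum_arm_leg k2n r2 hk2.
set f := (num_SYT la)%:R in hf *.
set Af := \prod_(i < k2) (arm k2 l2 la i)`!%:R in hf.
set Bf := \prod_(i < l2) (leg k2 l2 la i)`!%:R in hf.
set W := \prod_(i < k2) \prod_(j < l2) _ in hf.
have /andP[vA0 vA] : 0 <= vander (fun i : 'I_k2 => (arm k2 l2 la i)%:R : R) <= (2 * n)%:R ^+ (k2 * k2).
  apply: vander_le => // [i ik|i j]; last exact: (arm_decr r2).
  by rewrite /arm; have := shape_le i (part_shape la); lia.
have /andP[vB0 vB] : 0 <= vander (fun i : 'I_l2 => (leg k2 l2 la i)%:R : R) <= (2 * n)%:R ^+ (l2 * l2).
  apply: vander_le => // [i ik|i j]; last exact: (leg_decr r2).
  by rewrite /leg; have := conj_le la i; lia.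
set vanA := vander _ in hf vA0 vA; set vanB := vander _ in hf vB0 vB.
set M := (n %/ m)%N in M0 *.
have ea := @prod_phi_fact R k l k2 n (arm k2 l2 la) M0.
have el := @prod_phi_fact R k l l2 n (leg k2 l2 la) M0.
rewrite -/M in ea el.
have f0 a : 0 < a`!%:R :> R by rewrite ltr0n fact_gt0.
have Mr : 0 < M%:R :> R by rewrite ltr0n.
have prod1 r (a : nat -> nat) : \prod_(i < r) phi R M ((a i)%:Z - M%:Z) <= 1.
  rewrite -[leRHS](expr1n _ r) -[X in _ ^+ X]card_ord -prodr_const.
  by apply: ler_prod => i _; rewrite phi_ge0 phi_le1.
have Af0 : 0 < Af by apply: prodr_gt0.
have Bf0 : 0 < Bf by apply: prodr_gt0.
have W1 : 1 <= W.
  apply: (@le_trans _ _ (\prod_(i < k2) \prod_(j < l2) (1 : R))).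
    by rewrite big1 // => i _; rewrite big1.
  apply: ler_prod => i _; rewrite prodr_ge0 //=; apply: ler_prod => j _.
  by rewrite ler01 ler1n addn1.
rewrite -/Af in ea; rewrite -/Bf in el.
set P := \prod_(i < k2) _ in ea; set Q := \prod_(i < l2) _ in el.
set za := \sum_(i < k2) _ in ea; set zb := \sum_(i < l2) _ in el.
have zE : excess k l n - (za + zb) = - (d%:Z + (2 * d * M)%N%:Z).
  rewrite /za /zb !sum_shift /excess -/M.
  have ek : (k2 + d = k)%N by rewrite subnK.
  have el2 : (l2 + d = l)%N by rewrite subnK.
  rewrite -[in LHS]ek -[in LHS]el2.
  exact: (excess_diff M hs (double_sum_ord _) (double_sum_ord _) (double_sum_ord _) (double_sum_ord _)).
have P0 : 0 <= P by apply: prodr_ge0 => i _; exact: phi_ge0.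
have Q0 : 0 <= Q by apply: prodr_ge0 => i _; exact: phi_ge0.
have Mz z : 0 < M%:R ^ z :> R by exact: exprz_gt0.
(* Since every phi is at most 1, the factorials are at least their main terms. *)
have AfBf : M`!%:R ^+ (k2 + l2) * M%:R ^ (za + zb) <= Af * Bf.
  rewrite exprD expfzDr ?gt_eqF // mulrACA -ea -el mulrACA ler_piMl ?mulr_ge0 ?(ltW Af0) ?(ltW Bf0) //.
  by rewrite -[leRHS](mul1r 1) ler_pM // prod1.
have fle : f * (Af * Bf) <= n`!%:R * (vanA * vanB).
  rewrite -hf ler_wpM2l //; rewrite -[leLHS]mulr1; apply: ler_wpM2l => //.
  by rewrite mulr_ge0 // ltW.
have Mf : M`!%:R ^+ (k2 + l2) * M%:R ^ (za + zb) != 0 :> R.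
  by rewrite mulf_neq0 ?gt_eqF // exprn_gt0.
have nr0 : 0 < n%:R :> R by rewrite ltr0n.
have rt1 : 1 <= Num.sqrt n%:R :> R by rewrite -[X in X <= _]sqrtr1 ler_wsqrtr // ler1n.
have pp1 r : 1 <= pairs_prod r (Num.sqrt n%:R : R).
  apply: (@le_trans _ _ (\prod_(i < r) \prod_(j < r | (i < j)%N) (1 : R))).
    by rewrite big1 // => i _; rewrite big1.
  by apply: ler_prod => i _; rewrite prodr_ge0 //=; apply: ler_prod => j _; rewrite ler01.
have q1 : M`!%:R / M%:R ^+ M <= 1 :> R.
  have := phi_le1 R (- M%:Z) M0.
  by rewrite /phi subrr lexx /= fact0 divr1 exprnN.
have q0 : 0 < M`!%:R / M%:R ^+ M :> R by rewrite divr_gt0 ?exprn_gt0.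
(* Of the 2 d factors M! / M^M a single one is kept. *)
have main : f / norming R k l n <=
   vanA * vanB * n%:R ^+ (k * l) * (M`!%:R / M%:R ^+ M).
  rewrite ler_pdivrMr // /norming -/M.
  have fle2 : f <= n`!%:R * (vanA * vanB) / (M`!%:R ^+ (k2 + l2) * M%:R ^ (za + zb)).
    rewrite ler_pdivlMr; last by rewrite mulr_gt0 ?exprn_gt0.
    by apply: le_trans fle; rewrite ler_wpM2l.
  apply: le_trans fle2 _.
  have eM : M`!%:R ^+ m * M%:R ^ excess k l n =
      M`!%:R ^+ (k2 + l2) * M%:R ^ (za + zb) * ((M`!%:R / M%:R ^+ M) ^+ (2 * d) / M%:R ^+ d) :> R.
    have -> : excess k l n = (za + zb) + (- (d%:Z + (2 * d * M)%N%:Z)) by rewrite -zE addrC subrK.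
    have -> : (m = k2 + l2 + 2 * d)%N by rewrite /k2 /l2; clear -dk dl; lia.
    have eN : M%:R ^ (- (d%:Z + (2 * d * M)%N%:Z)) = M%:R ^- d * M%:R ^- (2 * d * M) :> R.
      by rewrite opprD expfzDr ?gt_eqF // !exprnN.
    rewrite exprD expfzDr ?gt_eqF // eN.
    rewrite expr_div_n -exprM [(M * (2 * d))%N]mulnC.
    by ring.
  rewrite eM.
  set q := M`!%:R / M%:R ^+ M in q0 q1 *.
  set F := M`!%:R ^+ (k2 + l2) * _ in Mf *.
  have qd : q ^+ (2 * d) / M%:R ^+ d <= q.
    apply: (@le_trans _ _ (q ^+ (2 * d))).
      by rewrite ler_piMr ?exprn_ge0 ?(ltW q0) // invf_le1 ?exprn_gt0 // exprn_ege1 // ler1n.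
    by apply: ler_iXnr; rewrite ?muln_gt0 ?(ltW q0).
  have qd0 : 0 < q ^+ (2 * d) / M%:R ^+ d by rewrite divr_gt0 ?exprn_gt0.
  have F0 : 0 < F by rewrite mulr_gt0 ?exprn_gt0.
  set Pk := pairs_prod k _; set Pl := pairs_prod l _.
  have Pk1 : 1 <= Pk by exact: pp1.
  have Pl1 : 1 <= Pl by exact: pp1.
  set D := q ^+ (2 * d) / M%:R ^+ d in qd qd0 *.
  have nkl : 0 < n%:R ^+ (k * l) :> R by rewrite exprn_gt0.
  rewrite [leRHS](_ : _ = (n`!%:R * (vanA * vanB) / F) * ((q / D) * (Pk * Pl))); last first.
    by field; rewrite ?gt_eqF.
  rewrite ler_peMr //; first by rewrite divr_ge0 ?mulr_ge0 // ltW.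
  rewrite -[X in X <= _](mul1r 1) ler_pM //.
    by rewrite ler_pdivlMr // mul1r.
  by rewrite -[X in X <= _](mul1r 1) ler_pM.
apply: le_trans main _.
have hq := fact_pow_le mn.
rewrite -/M -/c in hq.
have big : vanA * vanB * n%:R ^+ (k * l) <= (2 * n)%:R ^+ E.
  have n2 : 1 <= (2 * n)%:R :> R by rewrite ler1n muln_gt0.
  rewrite /E !exprD; apply: ler_pM; rewrite ?mulr_ge0 ?exprn_ge0 //.
    apply: ler_pM => //.
      by apply: le_trans vA _; apply: ler_weXn2l => //; rewrite leq_mul // leq_subr.
    by apply: le_trans vB _; apply: ler_weXn2l => //; rewrite leq_mul // leq_subr.
  by rewrite lerXn2r ?nnegrE // ler_nat leq_pmull.
apply: (@le_trans _ _ ((2 * n)%:R ^+ E * (expR 1 * expR (- (c * n%:R))))).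
  by apply: ler_pM => //; rewrite ?mulr_ge0 ?exprn_ge0 // ltW.
rewrite natrM exprMn -[leLHS]mulrA -!(mulrA (2 ^+ E)) ler_wpM2l ?exprn_ge0 //.
rewrite [leLHS]mulrCA -[leRHS]mulrA ler_wpM2l ?expR_ge0 //.
apply: le_trans (h1 _ (ler0n _ _)); rewrite ler_wpM2r ?expR_ge0 //.
by rewrite lerXn2r ?nnegrE ?addr_ge0 // lerDr.
Qed.

(** Polynomially many exponentially small terms. The factor n leaves room for a statistic
    that is at most n. *)
Lemma defective_sum (beta : R) : 0 < beta -> exists2 C : R, 0 < C &
  forall n, (m <= n)%N ->
  n%:R * \sum_(la in hook n k l | ~~ is_rect k l la)
     ((num_SYT la)%:R / norming R k l n) `^ beta <= C / n%:R.
Proof.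
move=> b0; have [C C0 [c c0 hC]] := defective_le.
have cb : 0 < c * beta by rewrite mulr_gt0.
have [C2 C20 h2] := gauss_absorb (m + 2) cb.
exists (C `^ beta * C2) => [|n mn]; first by rewrite mulr_gt0 ?powR_gt0.
have m0 := m_gt0 l k0.
have nr : 0 < n%:R :> R by rewrite ltr0n (leq_trans m0).
rewrite ler_pdivlMr //.
have term (la : intpart n) : la \in hook n k l -> ~~ is_rect k l la ->
   ((num_SYT la)%:R / norming R k l n) `^ beta <= C `^ beta * expR (- (c * beta * n%:R)).
  move=> h1 h3; apply: (@le_trans _ _ ((C * expR (- (c * n%:R))) `^ beta)).
    apply: ge0_ler_powR; rewrite ?nnegrE ?mulr_ge0 ?expR_ge0 ?divr_ge0 ?invr_ge0 ?(ltW b0) ?(ltW C0) //.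
      by rewrite ltW // norming_gt0.
    exact: hC.
  rewrite powRM ?expR_ge0 ?(ltW C0) // -expRM le_eqVlt; apply/orP; left.
  by apply/eqP; congr (_ * expR _); ring.
have sumb : \sum_(la in hook n k l | ~~ is_rect k l la)
     ((num_SYT la)%:R / norming R k l n) `^ beta <=
     (n.+1 ^ m)%:R * (C `^ beta * expR (- (c * beta * n%:R))).
  apply: (@le_trans _ _ (\sum_(la in hook n k l) (C `^ beta * expR (- (c * beta * n%:R))))).
    rewrite [leRHS](bigID (fun la => is_rect k l la)) /= -[leLHS]add0r; apply: lerD.
      by apply: sumr_ge0 => la _; rewrite mulr_ge0 ?powR_ge0 ?expR_ge0.
    by apply: ler_sum => la /andP[]; exact: term.
  rewrite sumr_const -[leLHS]mulr_natl ler_wpM2r ?ler_nat ?card_hook //.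
  by rewrite mulr_ge0 ?powR_ge0 ?expR_ge0.
apply: (@le_trans _ _ (n%:R * ((n.+1 ^ m)%:R * (C `^ beta * expR (- (c * beta * n%:R)))) * n%:R)).
  by rewrite ler_wpM2r // ler_wpM2l.
rewrite [leLHS](_ : _ = C `^ beta * ((n%:R ^+ 2 * (n.+1 ^ m)%:R) * expR (- (c * beta * n%:R)))); last by ring.
apply: ler_wpM2l; first exact: powR_ge0.
have := h2 _ (ler0n R n); set e1 := expR _ => h3.
apply: (@le_trans _ _ ((1 + n%:R) ^+ (m + 2) * e1)).
  rewrite ler_wpM2r ?expR_ge0 // exprD mulrC natrX nat1r ler_wpM2l ?exprn_ge0 //.
  by rewrite lerXn2r ?nnegrE // ler_nat.
apply: le_trans h3 _; rewrite -[leRHS]mulr1; apply: ler_wpM2l; first exact: ltW.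
rewrite -[leRHS]expR0 ler_expR oppr_le0 mulr_ge0 // ?divr_ge0 //; exact: ltW.
Qed.

End Defective.

(** * Limits of means *)

Section Assembly.
Variables (R : realType) (k' l' : nat).
Local Notation k := k'.+1.
Local Notation l := l'.+1.
Local Notation m := (k + l)%N.
Local Notation tmu := (tuple_lebesgue R).
Local Notation mu := (tmu k'.+1 \x tmu l')%E.
Local Notation rt n := (Num.sqrt n%:R : R).
Local Notation nrm n := (norming R k l n).
Local Notation adev la := (@arm_dev k l _ la).
Local Notation ldev la := (@leg_dev k l _ la).
Variable beta : R.
Hypothesis b0 : 0 < beta.

Let k0 : (0 < k)%N. Proof. by []. Qed.

(** Replacing n / (k + l) by its integer part, and shifting by the size of the staircase
    and of the rectangle, is invisible on the scale sqrt n. *)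
Lemma cvg_divn_error (a : R) :
  ((n %/ m)%:R - n%:R / m%:R + a) / rt n @[n --> \oo] --> (0 : R).
Proof.
have lim (b : R) : b * (rt n)^-1 @[n --> \oo] --> (0 : R).
  by rewrite -(mulr0 b); apply: cvgM; [exact: cvg_cst | exact: cvg_inv_sqrt].
apply: (squeeze_cvgr _ (lim (a - 1)) (lim a)); near=> n.
have mr : 0 < m%:R :> R by rewrite ltr0n.
have h1 : (n %/ m)%:R <= n%:R / m%:R :> R.
  by rewrite ler_pdivlMr // -natrM ler_nat leq_divM.
have h2 : n%:R / m%:R <= (n %/ m)%:R + 1 :> R.
  by rewrite ler_pdivrMr // natr1 -natrM ler_nat ltnW // ltn_ceil.
by rewrite !ler_wpM2r ?invr_ge0 ?sqrtr_ge0 //; lra.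
Unshelve. all: by end_near. Qed.

(** Numerators and denominators of the means, normalized to have a finite limit: the box
    measure is (sqrt n)^(1 - k - l). *)
Definition hook_sum n (h : intpart n -> R) : R :=
  (\sum_(la in hook n k l) h la * (num_SYT la)%:R `^ beta) /
  (nrm n `^ beta * rt n ^+ (k' + l').+1).

Definition defect_sum n (h : intpart n -> R) : R :=
  (\sum_(la in hook n k l | ~~ is_rect k l la) h la * ((num_SYT la)%:R / nrm n) `^ beta)
   * (rt n)^-1 ^+ (k' + l').+1.

Definition rect_sum n (h : intpart n -> R) : R :=
  (\sum_(la in hook n k l | is_rect k l la)
     h la * gcore R n (adev la) (ldev la) `^ beta) * (rt n)^-1 ^+ (k' + l').+1.

Lemma hook_sum_split n (h : intpart n -> R) : (m <= n)%N ->
  hook_sum h = rect_sum h + defect_sum h.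
Proof.
move=> mn; have N0 := norming_gt0 R k0 mn.
have Nb : nrm n `^ beta != 0 by rewrite gt_eqF // powR_gt0.
rewrite /hook_sum invfM mulrA /rect_sum /defect_sum -mulrDl -exprVn; congr (_ * _).
rewrite (bigID (fun la => is_rect k l la)) /= mulrDl; congr (_ + _); rewrite mulr_suml.
  apply: eq_bigr => la /andP[hk r].
  rewrite (num_SYT_gcore R k0 mn r hk) powRM ?gcore_ge0 ?(ltW N0) //.
  by field.
apply: eq_bigr => la _.
have iN : (nrm n)^-1 `^ beta = (nrm n `^ beta)^-1.
  apply: (mulIf Nb); rewrite mulVf // -powRM ?invr_ge0 ?(ltW N0) //.
  by rewrite mulVf ?gt_eqF // powR1.
by move: N0 iN; move: (norming R k l n) => N N0 iN; rewrite [in RHS]powRM ?invr_ge0 ?(ltW N0) // iN mulrA.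
Qed.

Lemma cvg_defect_sum (h : forall n, intpart n -> R) :
  (forall n (la : intpart n), (0 < n)%N -> `|h n la| <= n%:R) ->
  defect_sum (h n) @[n --> \oo] --> (0 : R).
Proof.
move=> hb; have [C C0 hC] := defective_sum l k0 b0.
have lim (b : R) : b * n%:R^-1 @[n --> \oo] --> (0 : R).
  by rewrite -(mulr0 b); apply: cvgM; [exact: cvg_cst | exact: cvg_inv_nat].
apply: (squeeze_cvgr _ (lim (- C)) (lim C)); near=> n.
have mn : (m <= n)%N by near: n; exists m.
have n0 : (0 < n)%N by apply: leq_trans mn.
rewrite mulNr -ler_norml; apply: le_trans (hC n mn).
rewrite /defect_sum normrM normrX normfV (ger0_norm (sqrtr_ge0 _)).
have rt1 : 1 <= rt n by rewrite -[X in X <= _]sqrtr1 ler_wsqrtr // ler1n.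
have rti : (rt n)^-1 ^+ (k' + l').+1 <= 1.
  by rewrite exprn_ile1 ?invr_ge0 ?sqrtr_ge0 // invf_le1 // (lt_le_trans ltr01).
rewrite -[leRHS]mulr1; apply: ler_pM => //.
rewrite mulr_sumr; apply: le_trans (ler_norm_sum _ _ _) _; apply: ler_sum => la _.
by rewrite normrM (ger0_norm (powR_ge0 _ _)) ler_wpM2r ?powR_ge0 // hb.
Unshelve. all: by end_near. Qed.

Let one_bound (x : 'I_k -> R) (y : 'I_l -> R) : `|1 : R| <= 1 + (sumsq x + sumsq y).
Proof. by rewrite normr1 lerDl addr_ge0 ?sumsq_ge0. Qed.

Let I0 : R := \int[mu]_z limit_term beta (fun _ _ => 1) z.

Lemma cvg_hook_sum1 : hook_sum (fun _ : intpart n => 1) @[n --> \oo] --> I0.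
Proof.
have [_ h0] := @limit_term_cvg R k' l' beta (fun _ _ => 1) b0 one_bound
  (fun _ _ _ _ _ _ => cvg_cst _).
have lim : rect_sum (fun _ : intpart n => 1) + defect_sum (fun _ : intpart n => 1) @[n --> \oo] --> I0 + 0.
  apply: cvgD; first exact: h0.
  by apply: cvg_defect_sum => n la n0; rewrite normr1 ler1n.
rewrite -[I0]addr0; apply: cvg_trans lim; apply: near_eq_cvg; near=> n.
rewrite hook_sum_split //; near: n; exists m => //.
Unshelve. all: by end_near. Qed.

Section OneStatistic.
Variable g : forall n, intpart n -> nat.
Arguments g : clear implicits.
Variable H : ('I_k -> R) -> ('I_l -> R) -> R.
Variable err : nat -> R.
Hypothesis g_le : forall n la, (g n la <= n)%N.
Hypothesis Hbound : forall x y, `|H x y| <= 1 + (sumsq x + sumsq y).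
Hypothesis Hcvg : forall (xn : nat -> 'I_k -> R) (yn : nat -> 'I_l -> R) x y,
  (forall i, xn n i @[n --> \oo] --> x i) ->
  (forall j, yn n j @[n --> \oo] --> y j) -> H (xn n) (yn n) @[n --> \oo] --> H x y.
Hypothesis err0 : err n @[n --> \oo] --> (0 : R).
Hypothesis gE : forall n (la : intpart n), (m <= n)%N -> la \in hook n k l -> is_rect k l la ->
  ((g n la)%:R - n%:R / m%:R) / rt n =
  H (scaled R n (adev la)) (scaled R n (ldev la)) + err n.

Let dev n (la : intpart n) : R := ((g n la)%:R - n%:R / m%:R) / rt n.

Lemma dev_le n (la : intpart n) : (0 < n)%N -> `|dev la| <= n%:R.
Proof.
move=> n0; have rt1 : 1 <= rt n by rewrite -[X in X <= _]sqrtr1 ler_wsqrtr // ler1n.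
have rt0 := lt_le_trans ltr01 rt1.
rewrite normrM normfV (ger0_norm (ltW rt0)) ler_pdivrMr //.
apply: (@le_trans _ _ n%:R); last by rewrite ler_peMr.
have h1 : 0 <= (n%:R / m%:R : R) by rewrite divr_ge0.
have h2 : n%:R / m%:R <= n%:R :> R by rewrite ler_pdivrMr ?ltr0n // ler_peMr // ler1n.
have h3 : 0 <= ((g n la)%:R : R) by [].
have h4 : (g n la)%:R <= n%:R :> R by rewrite ler_nat.
by rewrite ler_norml; apply/andP; split; lra.
Qed.

Lemma cvg_hook_sum_dev :
  hook_sum (@dev n) @[n --> \oo] --> \int[mu]_z limit_term beta H z.
Proof.
have [_ h1] := @limit_term_cvg R k' l' beta H b0 Hbound Hcvg.
have [_ h0] := @limit_term_cvg R k' l' beta (fun _ _ => 1) b0 one_bound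
  (fun _ _ _ _ _ _ => cvg_cst _).
set I := Rintegral _ _ _.
have lim : (\sum_(la in hook n k l | is_rect k l la) part_term beta H la) *
     (rt n)^-1 ^+ (k' + l').+1 + err n *
     ((\sum_(la in hook n k l | is_rect k l la) part_term beta (fun (_ : 'I_k -> R) (_ : 'I_l -> R) => 1) la) *
     (rt n)^-1 ^+ (k' + l').+1) + defect_sum (@dev n) @[n --> \oo] --> I + 0 * I0 + 0.
  apply: cvgD; first by apply: cvgD => //; apply: cvgM => //; exact: h0.
  by apply: cvg_defect_sum => n la n0; exact: dev_le.
rewrite (_ : I = I + 0 * I0 + 0); last by rewrite mul0r !addr0.
apply: cvg_trans lim; apply: near_eq_cvg; near=> n.
have mn : (m <= n)%N by near: n; exists m.
rewrite hook_sum_split //; congr (_ + _).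
rewrite /rect_sum mulrA -mulrDl mulr_sumr -big_split /=; congr (_ * _).
apply: eq_bigr => la /andP[hk r]; rewrite /dev gE // /part_term; ring.
Unshelve. all: by end_near. Qed.

(** Subtracting n / (k + l) and dividing by sqrt n commutes with taking means, so the
    coefficient is the mean of the scaled statistic. *)
Lemma cvg_sqrt_coef : I0 != 0 ->
  sqrt_coef k l (fun n => hook_mean k l beta (g n)) n @[n --> \oo] -->
  (\int[mu]_z limit_term beta H z) / I0.
Proof.
move=> I00.
have lim : hook_sum (@dev n) / hook_sum (fun _ : intpart n => 1) @[n --> \oo] -->
    (\int[mu]_z limit_term beta H z) / I0.
  by apply: cvgM; [exact: cvg_hook_sum_dev | apply: cvgV => //; exact: cvg_hook_sum1].
apply: cvg_trans lim; apply: near_eq_cvg; near=> n.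
have mn : (m <= n)%N by near: n; exists m.
have n0 : (0 < n)%N by apply: leq_trans mn.
have rtn : 0 < rt n by rewrite sqrtr_gt0 ltr0n.
have N0 := norming_gt0 R k0 mn.
have U0 : nrm n `^ beta * rt n ^+ (k' + l').+1 != 0.
  by rewrite mulf_neq0 ?gt_eqF ?powR_gt0 ?exprn_gt0.
have S1 : hook_sum (fun _ : intpart n => 1) != 0.
  near: n; exact: (cvgr_neq0 _ cvg_hook_sum1 I00).
rewrite /hook_sum in S1 *; rewrite /sqrt_coef /hook_mean.
set U := _ * _ in U0 S1 *.
have e1 : \sum_(la in hook n k l) 1 * (num_SYT la)%:R `^ beta = \sum_(la in hook n k l) (num_SYT la)%:R `^ beta :> R.
  by apply: eq_bigr => la _; rewrite mul1r.
rewrite e1 in S1 *; set S := \sum_(la in _) _ `^ _ in S1 *.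
have S0 : S != 0 by apply: contraNneq S1 => ->; rewrite mul0r.
have e2 : \sum_(la in hook n k l) dev la * (num_SYT la)%:R `^ beta =
   (\sum_(la in hook n k l) (g n la)%:R * (num_SYT la)%:R `^ beta - n%:R / m%:R * S) / rt n.
  rewrite mulrBl mulr_suml mulr_sumr mulr_suml -sumrB; apply: eq_bigr => la _.
  rewrite /dev; ring.
rewrite e2; set X := \sum_(la in _) _ * _.
have rtn0 : rt n != 0 by rewrite gt_eqF.
have mr0 : m%:R != 0 :> R by rewrite pnatr_eq0.
move: mr0; set w := m%:R => w0.
by field; rewrite rtn0 !nat1r -natrD pnatr_eq0 S0 U0.
Unshelve. all: by end_near. Qed.

End OneStatistic.
End Assembly.

(** * The expected rows and columns *)

Section MainLimits.
Variable R : realType.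

Lemma limit_coefE r m (beta : R) (p : 'I_r.+1) : (0 < m)%N -> 0 < beta ->
  limit_coef m beta p =
  (\int[tuple_lebesgue R r]_x (hp x p * cweight (m%:R / 2) beta (hp x))) /
  (\int[tuple_lebesgue R r]_x cweight (m%:R / 2) beta (hp x)).
Proof.
move=> m0 b0; rewrite /limit_coef.
rewrite (@integral_hyperplane R r m beta (fun x => tnth x p)) //; first last.
- by move=> x; exact: norm_le_sumsq.
- exact: measurable_tnth.
congr (_ / _).
have := @integral_hyperplane R r m beta (fun=> 1) m0 b0 (measurable_cst _).
have h (x : r.-tuple (measurableTypeR R)) : `|1 : R| <= 1 + sumsq (hp x).
  by rewrite normr1 lerDl sumsq_ge0.
move=> /(_ h) e.
transitivity (\int[hyperplane_lebesgue R r.+1]_(x in Omega R r.+1) (1 * weight m beta x)).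
  by apply: eq_Rintegral => x _; rewrite mul1r.
by rewrite e; apply: eq_Rintegral => x _; rewrite mul1r.
Qed.

Lemma part_le n (la : intpart n) i : (part la i <= n)%N.
Proof. exact: shape_le (part_shape la). Qed.

Lemma row_cancel (c g w v p : R) : c * (g * w * v) != 0 ->
  c * (g * p * v) / (c * (g * w * v)) = p / w.
Proof.
rewrite !mulf_eq0 !negb_or => /andP[c0 /andP[/andP[g0 w0] v0]].
by field; rewrite c0 g0 w0 v0.
Qed.

Lemma col_cancel (c g w v p : R) : c * (g * w * v) != 0 ->
  c * (g * w * p) / (c * (g * w * v)) = p / v.
Proof.
rewrite !mulf_eq0 !negb_or => /andP[c0 /andP[/andP[g0 w0] v0]].
by field; rewrite c0 g0 w0 v0.
Qed.

(** A row of length part la p is its arm up to a constant, so its scaled deviation has the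
    limit x_p, and the Gaussian factor in s and the column weight cancel from the ratio. *)
Lemma cvg_row_coef k l (beta : R) (p : 'I_k) : (0 < l)%N -> 0 < beta ->
  row_coef k l beta p n @[n --> \oo] --> limit_coef (k + l) beta p.
Proof.
case: k p => [[]//|k'] p; case: l => // l' _ b0.
pose a : R := l'.+1%:R - (k'.+1 - p.+1)%:R.
pose err n : R := ((n %/ (k'.+1 + l'.+1))%:R - n%:R / (k'.+1 + l'.+1)%:R + a) / Num.sqrt n%:R.
have I0 := integral_limit_term1 k' l' b0.
have I00 := integral_limit_term1_gt0 k' l' b0.
have lim : row_coef k'.+1 l'.+1 beta p n @[n --> \oo] -->
   (\int[(tuple_lebesgue R k'.+1 \x tuple_lebesgue R l')%E]_z limit_term beta (fun x _ => x p) z) /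
   (\int[(tuple_lebesgue R k'.+1 \x tuple_lebesgue R l')%E]_z limit_term beta (fun _ _ => 1) z).
  apply: (@cvg_sqrt_coef R k' l' beta b0 (fun n la => part la p) (fun x _ => x p) err).
  - by move=> n la; exact: part_le.
  - move=> x y; apply: le_trans (norm_le_sumsq x p) _.
    by rewrite lerD2l lerDl sumsq_ge0.
  - by move=> xn yn x y hx _; exact: hx.
  - exact: (cvg_divn_error k' l' a).
  - move=> n la mn hk r; rewrite /scaled /err -mulrDl; congr (_ / _).
    have lp := rectP r (ltn_ord p).
    have e : (arm k'.+1 l'.+1 la p)%:R = (part la p)%:R - l'.+1%:R + (k'.+1 - p.+1)%:R :> R.
      by rewrite /arm natrD (natrB _ lp).
    by rewrite /arm_dev intrB -!pmulrn e /a; ring.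
  - by rewrite I0 gt_eqF.
rewrite (@limit_coefE k' (k'.+1 + l'.+1) beta p) //.
rewrite I0 (integral_limit_row l' b0 p) in lim.
rewrite -> (row_cancel _ (lt0r_neq0 I00)) in lim.
by [].
Qed.

Lemma cvg_col_coef k l (beta : R) (q : 'I_l) : (0 < k)%N -> 0 < beta ->
  col_coef k l beta q n @[n --> \oo] --> limit_coef (k + l) beta q.
Proof.
case: l q => [[]//|l'] q; case: k => // k' _ b0.
pose a : R := k'.+1%:R - (l'.+1 - q.+1)%:R.
pose err n : R := ((n %/ (k'.+1 + l'.+1))%:R - n%:R / (k'.+1 + l'.+1)%:R + a) / Num.sqrt n%:R.
have I0 := integral_limit_term1 k' l' b0.
have I00 := integral_limit_term1_gt0 k' l' b0.
have lim : col_coef k'.+1 l'.+1 beta q n @[n --> \oo] -->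
   (\int[(tuple_lebesgue R k'.+1 \x tuple_lebesgue R l')%E]_z limit_term beta (fun _ y => y q) z) /
   (\int[(tuple_lebesgue R k'.+1 \x tuple_lebesgue R l')%E]_z limit_term beta (fun _ _ => 1) z).
  apply: (@cvg_sqrt_coef R k' l' beta b0 (fun n la => conj_part la q) (fun _ y => y q) err).
  - by move=> n la; exact: conj_le.
  - move=> x y; apply: le_trans (norm_le_sumsq y q) _.
    by rewrite lerD2l lerDr sumsq_ge0.
  - by move=> xn yn x y _ hy; exact: hy.
  - exact: (cvg_divn_error k' l' a).
  - move=> n la mn hk r; rewrite /scaled /err -mulrDl; congr (_ / _).
    have lp := conj_ge r (ltn_ord q).
    have e : (leg k'.+1 l'.+1 la q)%:R = (conj_part la q)%:R - k'.+1%:R + (l'.+1 - q.+1)%:R :> R.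
      by rewrite /leg natrD (natrB _ lp).
    by rewrite /leg_dev intrB -!pmulrn e /a; ring.
  - by rewrite I0 gt_eqF.
rewrite (@limit_coefE l' (k'.+1 + l'.+1) beta q) //.
rewrite I0 (integral_limit_col k' b0 q) in lim.
rewrite -> (col_cancel _ (lt0r_neq0 I00)) in lim.
by [].
Qed.

Lemma asymp_equiv_sqrt k l (a : nat -> R) (c : R) : (0 < k)%N ->
  sqrt_coef k l a n @[n --> \oo] --> c ->
  asymp_equiv a (fun n => n%:R / (k + l)%:R + c * Num.sqrt n%:R).
Proof.
move=> k0 hc; have mr : 0 < (k + l)%:R :> R by rewrite ltr0n addn_gt0 k0.
have lim (u : nat -> R) : u n @[n --> \oo] --> c ->
    ((k + l)%:R^-1 + u n * (Num.sqrt n%:R)^-1) @[n --> \oo] --> ((k + l)%:R^-1 : R).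
  move=> hu; rewrite -[X in _ --> X]addr0 -(mulr0 c); apply: cvgD; first exact: cvg_cst.
  by apply: cvgM => //; exact: cvg_inv_sqrt.
have inv0 : (k + l)%:R^-1 != 0 :> R by rewrite invr_neq0 ?gt_eqF.
have limc := lim _ (cvg_cst c).
have fac n (b : R) : (0 < n)%N -> n%:R / (k + l)%:R + b * Num.sqrt n%:R =
    n%:R * ((k + l)%:R^-1 + b * (Num.sqrt n%:R)^-1).
  move=> n0; have rt0 : Num.sqrt n%:R != 0 :> R by rewrite gt_eqF // sqrtr_gt0 ltr0n.
  rewrite mulrDr; congr (_ + _); rewrite -[in RHS](@sqr_sqrtr R n%:R) ?ler0n //.
  by rewrite sqrtr_sqr ger0_norm ?sqrtr_ge0 //; field.
have ne0 : \forall n \near \oo, (k + l)%:R^-1 + c * (Num.sqrt n%:R)^-1 != 0 :> R.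
  have := @cvgr_neq0 R R^o nat \oo _ (fun n : nat => (k + l)%:R^-1 + c * (Num.sqrt n%:R)^-1) (k + l)%:R^-1.
  move=> h; apply: h; [exact: limc | exact: inv0].

have ne : \forall n \near \oo, n%:R / (k + l)%:R + c * Num.sqrt n%:R != 0 :> R.
  near=> n; have n0 : (0 < n)%N by near: n; exists 1%N.
  rewrite fac // mulf_neq0 ?pnatr_eq0 -?lt0n //.
  by near: n.
split => //.
have lim1 : ((k + l)%:R^-1 + sqrt_coef k l a n * (Num.sqrt n%:R)^-1) /
   ((k + l)%:R^-1 + c * (Num.sqrt n%:R)^-1) @[n --> \oo] --> (1 : R).
  rewrite -[X in _ --> X](divff inv0); apply: cvgM; first exact: lim.
  apply: cvgV; [exact: inv0 | exact: limc].
apply: cvg_trans lim1; apply: near_eq_cvg; near=> n.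
have n0 : (0 < n)%N by near: n; exists 1%N.
rewrite (sqrt_coefE k l a n0) !fac // invfM mulrACA divff ?mul1r //.
by rewrite pnatr_eq0 -lt0n.
Unshelve. all: by end_near. Qed.

End MainLimits.

Theorem theorem6p3 (R : realType) (k l : nat) (beta : R) (p : 'I_k) (q : 'I_l) :
  (1 <= k)%N -> (1 <= l)%N -> 0 < beta ->
  [/\ row_coef k l beta p n @[n --> \oo] --> limit_coef (k + l) beta p,
      col_coef k l beta q n @[n --> \oo] --> limit_coef (k + l) beta q,
      asymp_equiv (row_mean k l beta p)
        (fun n => n%:R / (k + l)%:R + limit_coef (k + l) beta p * Num.sqrt n%:R) &
      asymp_equiv (col_mean k l beta q)
        (fun n => n%:R / (k + l)%:R + limit_coef (k + l) beta q * Num.sqrt n%:R)].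
Proof.
move=> k0 l0 b0; have hr := @cvg_row_coef R k l beta p l0 b0; have hc := @cvg_col_coef R k l beta q k0 b0.
by split => //; apply: asymp_equiv_sqrt.
Qed.
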